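(* Let $v\in\mathbb N^n$ and put $\mathbb X=x_1+\cdots+x_n$, $\mathbb V=\langle v\rangle_1+\cdots+\langle v\rangle_n$. Then $$\sum_{u\in\mathbb N^n}\frac{(bt^{n-1})_v}{(bt^{n-1})_u}\,\mathsf E_{u/v}(a,b)\,\mathsf M_u(x)=\mathsf M_v(x)\prod_{i=1}^n\frac{(a\langle v\rangle_i)_\infty\,(bx_i)_\infty}{(b\langle v\rangle_i)_\infty\,(ax_i)_\infty}=\mathsf M_v(x)\;\sigma_1\!\left[\frac{a-b}{1-q}\,(\mathbb X-\mathbb V)\right].$$
   Context: Notation. Fix $n\ge 1$, a complex $q$ with $|q|<1$, and $t$, with $q,t$ generic (the coefficients of all polynomials below are rational functions of $q,t$). $\mathbb N=\{0,1,2,\dots\}$, $x=(x_1,\dots,x_n)$. A composition is $u=(u_1,\dots,u_n)\in\mathbb N^n$; $|u|=u_1+\cdots+u_n$; $u^+$ is the weakly decreasing rearrangement of $u$; $0=(0,\dots,0)$. $(b)_\infty=\prod_{i\ge0}(1-bq^i)$, $(b)_k=\prod_{i=0}^{k-1}(1-bq^i)$ for $k\in\mathbb N$, and for a composition $u$, $(b)_u=\prod_{i=1}^n(bt^{1-i})_{u^+_i}$. The spectral vector $\langle u\rangle\in\mathbb C^n$ has entries $\langle u\rangle_i=q^{u_i}t^{k_i}$, where $k_i=\#\{j:u_j<u_i\}+\#\{j>i:u_j=u_i\}$; so $\langle 0\rangle=(t^{n-1},\dots,t,1)$. The diagram of $u$ is the set of $s=(i,j)$ with $1\le i\le n$, $1\le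 j\le u_i$; for such $s$, $a(s)=u_i-j$ and $l(s)=\#\{k>i: j\le u_k\le u_i\}+\#\{k<i: j\le u_k+1\le u_i\}$. Put $n(u)=\sum_{s\in u}l(s)$, $n'(u)=\sum_i\binom{u_i}{2}$, $c'_u=\prod_{s\in u}(1-q^{a(s)+1}t^{l(s)})$. The interpolation Macdonald polynomial $M_u(x)$ is the unique polynomial of degree $|u|$ in $x_1,\dots,x_n$ such that $M_u(\langle v\rangle)=0$ for all $v\in\mathbb N^n$ with $|v|\le|u|$, $v\ne u$, and such that the coefficient of $x^u=x_1^{u_1}\cdots x_n^{u_n}$ is $q^{-n'(u)}$. Its normalised version is $\mathsf M_u(x)=q^{n'(u)}t^{n(u)}M_u(x)/c'_u$. Let $\mathsf E_u(x)=\lim_{z\to0}z^{|u|}\mathsf M_u(x/z)$ be the top-degree homogeneous component of $\mathsf M_u$ (a normalised nonsymmetric Macdonald polynomial: $\mathsf E_u=t^{n(u)}E_u/c'_u$, with $E_u$ the nonsymmetric Macdonald polynomial in which $x^u$ has coefficient 1). Connection coefficients: define $c_{uv}(a,b)$ by $\mathsf M_u(ax)=\sum_v c_{uv}(a,b)\mathsf M_v(bx)$, and $\mathsf E_{u/v}(a,b)=\dfrac{\mathsf E_v(\langle 0\rangle/a)}{\mathsf E_u(\langle 0\rangle/b)}\,c_{uv}(a,b)$. It is a polynomial in $a,b$, homogeneous of degree $|u|-|v|$ (and zero if $|v|>|u|$). For alphabets (formal sums of letters) $\mathbb A,\mathbb B$, $\sigma_z\!\left[\frac{\mathbb A-\mathbb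 B}{1-q}\right]$ means $\prod_{y\in\mathbb B}(zy)_\infty\big/\prod_{y\in\mathbb A}(zy)_\infty$; products of alphabets are expanded distributively, so $(a-b)(\mathbb X-\mathbb V)=(a\mathbb X+b\mathbb V)-(a\mathbb V+b\mathbb X)$. The identity is understood as an identity of formal power series in $a$ and $b$. *)

(* Defs.v *)
From HB Require Import structures.
From mathcomp Require Import all_boot all_order all_algebra.
(* multinomials must be imported before MathComp-Analysis: in the other order
   the two grammars are rejected as incompatible. *)
From mathcomp Require Import complex mpoly.
From mathcomp Require Import boolp classical_sets reals topology normedtype.
From mathcomp Require Import sequences.

Set Implicit Arguments.
Unset Strict Implicit.
Unset Printing Implicit Defensive.

Import Order.TTheory GRing.Theory Num.Theory.
Import numFieldNormedType.Exports.

Local Open Scope ring_scope.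

Record fps (A : Type) := Fps { fcoef : nat -> A }.

Lemma fpsP A (f g : fps A) : fcoef f =1 fcoef g -> f = g.
Proof. by case: f g => [f] [g] /= /funext ->. Qed.

HB.instance Definition _ (A : Type) := gen_eqMixin (fps A).
HB.instance Definition _ (A : Type) := gen_choiceMixin (fps A).

Section FpsRing.
Context (A : comNzRingType).
Implicit Types f g h : fps A.

Definition fps_zero : fps A := Fps (fun=> 0).
Definition fps_opp f := Fps (fun n => - fcoef f n).
Definition fps_add f g := Fps (fun n => fcoef f n + fcoef g n).
Definition fps_one : fps A := Fps (fun n => (n == 0)%:R).
Definition fps_mul f g :=
  Fps (fun n => \sum_(i < n.+1) fcoef f i * fcoef g (n - i)).

Fact fps_addA : associative fps_add.
Proof. by move=> f g h; apply/fpsP => n /=; rewrite addrA. Qed.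
Fact fps_addC : commutative fps_add.
Proof. by move=> f g; apply/fpsP => n /=; rewrite addrC. Qed.
Fact fps_add0 : left_id fps_zero fps_add.
Proof. by move=> f; apply/fpsP => n /=; rewrite add0r. Qed.
Fact fps_addN : left_inverse fps_zero fps_opp fps_add.
Proof. by move=> f; apply/fpsP => n /=; rewrite addNr. Qed.

HB.instance Definition _ :=
  GRing.isZmodule.Build (fps A) fps_addA fps_addC fps_add0 fps_addN.

Let trunc k f : {poly A} := \poly_(i < k.+1) fcoef f i.

Let trunc_coef k f i : (i <= k)%N -> (trunc k f)`_i = fcoef f i.
Proof. by move=> ik; rewrite coef_poly ltnS ik. Qed.

Let fps_mulE k f g n :
  (n <= k)%N -> fcoef (fps_mul f g) n = (trunc k f * trunc k g)`_n.
Proof.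
move=> nk; rewrite coefM; apply: eq_bigr => i _.
by rewrite !trunc_coef ?(leq_trans _ nk) ?leq_subr // -ltnS.
Qed.

Fact fps_mulA : associative fps_mul.
Proof.
move=> f g h; apply/fpsP => n; rewrite !(fps_mulE _ _ (leqnn n)).
have -> : (trunc n f * trunc n (fps_mul g h))`_n
        = (trunc n f * (trunc n g * trunc n h))`_n.
  rewrite coefM [RHS]coefM; apply: eq_bigr => i _; congr (_ * _).
  by rewrite trunc_coef ?leq_subr // (fps_mulE _ _ (leq_subr i n)).
have -> : (trunc n (fps_mul f g) * trunc n h)`_n
        = ((trunc n f * trunc n g) * trunc n h)`_n.
  rewrite coefM [RHS]coefM; apply: eq_bigr => i _; congr (_ * _).
  by have ik : (i <= n)%N by [rewrite -ltnS]; rewrite trunc_coef // (fps_mulE _ _ ik).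
by rewrite mulrA.
Qed.
Fact fps_mulC : commutative fps_mul.
Proof.
by move=> f g; apply/fpsP => n; rewrite !(fps_mulE _ _ (leqnn n)) mulrC.
Qed.
Fact fps_mul1 : left_id fps_one fps_mul.
Proof.
move=> f; apply/fpsP => n /=; rewrite big_ord_recl /= subn0 mul1r big1 ?addr0 //.
by move=> i _; rewrite mul0r.
Qed.
Fact fps_mulDl : left_distributive fps_mul fps_add.
Proof.
move=> f g h; apply/fpsP => n /=; rewrite -big_split; apply: eq_bigr => i _ /=.
by rewrite mulrDl.
Qed.
Fact fps_one_neq0 : fps_one != fps_zero.
Proof.
by apply/eqP => /(congr1 (fun f => fcoef f 0)) /= /eqP; rewrite oner_eq0.
Qed.

HB.instance Definition _ := GRing.Zmodule_isComNzRing.Build (fps A)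
  fps_mulA fps_mulC fps_mul1 fps_mulDl fps_one_neq0.

Definition fps_unit : pred (fps A) := fun f => `[< exists g, g * f = 1 >].
Definition fps_inv f : fps A := xget f [set g : fps A | g * f = 1]%classic.

Fact fps_mulV : {in fps_unit, left_inverse 1 fps_inv *%R}.
Proof.
move=> f /asboolP[g gf]; rewrite /fps_inv.
by case: xgetP => [h _ //|/(_ g)]; case.
Qed.
Fact fps_unitP f g : g * f = 1 -> fps_unit f.
Proof. by move=> gf; apply/asboolP; exists g. Qed.
Fact fps_inv_out : {in [predC fps_unit], fps_inv =1 id}.
Proof.
move=> f /asboolP nf; rewrite /fps_inv; case: xgetP => // g _ gf.
by case: nf; exists g.
Qed.

HB.instance Definition _ := GRing.ComNzRing_hasMulInverse.Build (fps A)
  fps_mulV fps_unitP fps_inv_out.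

Definition fpsC (c : A) : fps A := Fps (fun n => if n == 0 then c else 0).
Definition fpsX : fps A := Fps (fun n => (n == 1)%:R).

End FpsRing.

(* K[[a,b]] as K[[b]][[a]]: the outer series variable is a, the inner one b. *)
Notation fps2 K := (fps (fps K)).

Definition ser_a (K : comNzRingType) : fps2 K := fpsX (fps K).
Definition ser_b (K : comNzRingType) : fps2 K := fpsC (fpsX K).
Definition cst (K : comNzRingType) (c : K) : fps2 K := fpsC (fpsC c).

Definition coef2 (K : comNzRingType) (f : fps2 K) (i j : nat) : K :=
  fcoef (fcoef f i) j.

(* Here too the outer indeterminate stands for a and the inner one for b. *)
Definition fps2_of_poly (K : comNzRingType) (p : {poly {poly K}}) : fps2 K :=
  Fps (fun i => Fps (fun j => p`_i`_j)).

(* The formal sum of the family F over all compositions exists and equals S: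
   each coefficient receives only finitely many nonzero contributions, and
   these add up to the coefficient of S. *)
Definition fps2_sums_to (K : comNzRingType) n
    (F : 'X_{1..n} -> fps2 K) (S : fps2 K) : Prop :=
  forall i j, exists D,
    (forall u, (D <= mdeg u)%N -> coef2 (F u) i j = 0) /\
    \sum_(u : 'X_{1..n < D}) coef2 (F u) i j = coef2 S i j.

Definition qpoch (A : comNzRingType) (q y : A) (k : nat) : A :=
  \prod_(i < k) (1 - y * q ^+ i).

(* The infinite product is the coefficientwise limit, in the topology of K, of
   the finite ones. *)
Definition qpoch_inf (K : numFieldType) (q : K) (y : fps2 K) : fps2 K :=
  Fps (fun i => Fps (fun j => limn (fun N => coef2 (qpoch (cst q) y N) i j))).

(* The parts of u^+ are indexed from 0, so t^(1-i) becomes t^(-i). *)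
Definition qpoch_comp (K : numFieldType) (q t : K) (y : fps2 K)
    n (u : 'X_{1..n}) : fps2 K :=
  \prod_(i < n) qpoch (cst q) (y * cst (t ^- i)) (nth 0 (sort geq u) i).

(* The alphabet A - B is represented by the pair of the list of letters of A
   and the list of letters of B. *)
Definition alphabet (L : Type) : Type := (seq L * seq L)%type.

Definition letter (L : Type) (y : L) : alphabet L := ([:: y], [::]).

Definition alph_sum (L : Type) n (y : 'I_n -> L) : alphabet L :=
  ([seq y i | i <- enum 'I_n], [::]).

Definition alph_sub (L : Type) (A B : alphabet L) : alphabet L :=
  (A.1 ++ B.2, A.2 ++ B.1).

Definition alph_mul (L : comNzRingType) (A B : alphabet L) : alphabet L :=
  ([seq y * z | y <- A.1, z <- B.1] ++ [seq y * z | y <- A.2, z <- B.2],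
   [seq y * z | y <- A.1, z <- B.2] ++ [seq y * z | y <- A.2, z <- B.1]).

(* sigma_z [ A / (1 - q) ] *)
Definition sigma (K : numFieldType) (q : K) (z : fps2 K)
    (A : alphabet (fps2 K)) : fps2 K :=
  (\prod_(y <- A.2) qpoch_inf q (z * y)) /
  (\prod_(y <- A.1) qpoch_inf q (z * y)).

(* A composition u in N^n is an element of 'X_{1..n}; |u| is mdeg u. The entries
   are indexed from 0, which affects neither the exponents k_i of the spectral
   vector nor the leg lengths, as only relative positions matter there. The
   columns j of the diagram still run from 1 to u_i. *)

Definition spec_exp n (u : 'X_{1..n}) (i : 'I_n) : nat :=
  (#|[pred j : 'I_n | u j < u i]| +
   #|[pred j : 'I_n | (i < j) && (u j == u i)]|)%N.

Definition spectral (K : numFieldType) (q t : K) n (u : 'X_{1..n}) : 'I_n -> K :=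
  fun i => q ^+ u i * t ^+ spec_exp u i.

Definition leg n (u : 'X_{1..n}) (i : 'I_n) (j : nat) : nat :=
  (#|[pred k : 'I_n | (i < k) && (j <= u k <= u i)]| +
   #|[pred k : 'I_n | (k < i) && (j <= (u k).+1 <= u i)]|)%N.

Definition stat_n n (u : 'X_{1..n}) : nat :=
  (\sum_(i < n) \sum_(1 <= j < (u i).+1) leg u i j)%N.

Definition stat_n' n (u : 'X_{1..n}) : nat :=
  (\sum_(i < n) 'C(u i, 2))%N.

Definition cprime (K : numFieldType) (q t : K) n (u : 'X_{1..n}) : K :=
  \prod_(i < n) \prod_(1 <= j < (u i).+1)
    (1 - q ^+ (u i - j).+1 * t ^+ leg u i j).

(* Since 0^-1 = 0 in a field, q != 0 and t != 0 do not follow from the third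
   condition. *)
Definition generic (K : numFieldType) (q t : K) : Prop :=
  [/\ q != 0, t != 0 &
      forall i j : int, q ^ i * t ^ j = 1 -> i = 0 /\ j = 0].

Definition is_interpM (K : numFieldType) (q t : K) n (u : 'X_{1..n})
    (p : {mpoly K[n]}) : Prop :=
  [/\ msize p = (mdeg u).+1,
      forall v : 'X_{1..n}, (mdeg v <= mdeg u)%N -> v != u ->
        p.@[spectral q t v] = 0 &
      p@_u = (q ^+ stat_n' u)^-1].

Definition interpM (K : numFieldType) (q t : K) n (u : 'X_{1..n}) :
    {mpoly K[n]} :=
  xget 0 [set p | is_interpM q t u p]%classic.

(* The normalised polynomial (upright M_u); its top-degree component nE is the
   upright E_u. *)
Definition nM (K : numFieldType) (q t : K) n (u : 'X_{1..n}) : {mpoly K[n]} :=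
  (q ^+ stat_n' u * t ^+ stat_n u / cprime q t u) *: interpM q t u.

Definition nE (K : numFieldType) (q t : K) n (u : 'X_{1..n}) : {mpoly K[n]} :=
  pihomog mdeg (mdeg u) (nM q t u).

Definition dilate (K : numFieldType) n (a : K) (p : {mpoly K[n]}) :
    {mpoly K[n]} :=
  p \mPo [tuple a *: 'X_i | i < n].

(* Cutting off at |v| < D expresses that the expansion is a finite one. *)
Definition is_connection (K : numFieldType) (q t : K) n (u : 'X_{1..n})
    (a b : K) (c : 'X_{1..n} -> K) : Prop :=
  exists D, (forall v, (D <= mdeg v)%N -> c v = 0) /\
    dilate a (nM q t u) = \sum_(v : 'X_{1..n < D}) c v *: dilate b (nM q t v).

Definition connection (K : numFieldType) (q t : K) n (u v : 'X_{1..n})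
    (a b : K) : K :=
  xget (fun=> 0) [set c | is_connection q t u a b c]%classic v.

Definition skewE_at (K : numFieldType) (q t : K) n (u v : 'X_{1..n})
    (a b : K) : K :=
  (nE q t v).@[fun i => spectral q t 0%MM i / a] /
  (nE q t u).@[fun i => spectral q t 0%MM i / b] * connection q t u v a b.

(* The defining formula has denominators in a and b; E_{u/v} itself is the
   polynomial agreeing with it at all nonzero a and b. *)
Definition skewE (K : numFieldType) (q t : K) n (u v : 'X_{1..n}) :
    {poly {poly K}} :=
  xget 0 [set p : {poly {poly K}} | forall a b : K, a != 0 -> b != 0 ->
            p.[a%:P].[b] = skewE_at q t u v a b]%classic.

(* Main.v *)
(* Every composition is obtained from 0 by the moves w -> (w_2, ..., w_n, w_1 + 1)
   and by transpositions, and on spectral vectors these moves are implemented by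
   the Demazure-Lusztig operators h_i and an affine rotation.  Put
   K_w(y) = \sum_u E_u(y) M_u(<w>) / E_u(<0>); the sum is finite because M_u
   vanishes at <w> for |u| > |w|.  The operators h_i act on K in the same way
   through y and through w, and the affine part of the Hecke action relates
   K_{(w_2, ..., w_n, w_1 + 1)} to K_w.  By induction on w, with (a)_w denoting
   \prod_i (a t^(k_i))_{w_i}, the expression (a)_z K_w(a <z>) is symmetric in z
   and w.  Expanding E_u in the M_v and using that M_v(<w>) = 0 for |v| > |w|, this
   symmetry yields the theorem at b = 0 and x = <w>.  The case of general a, b at
   x = <w> follows since the matrix of the E_{u/v}(a,b) is the inverse of that of
   the E_{u/v}(b,0) multiplied by that of the E_{u/v}(a,0).  Finally, each
   coefficient of a^i b^j is polynomial in x, and a polynomial vanishing at all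
   spectral vectors is zero. *)
Require Import Defs.
From HB Require Import structures.
From mathcomp Require Import all_boot all_order all_fingroup all_algebra.
From mathcomp Require Import complex mpoly ring zify.
From mathcomp Require Import boolp classical_sets reals topology normedtype.
From mathcomp Require Import sequences.

Set Implicit Arguments.
Unset Strict Implicit.
Unset Printing Implicit Defensive.

Import Order.TTheory GRing.Theory Num.Theory.
Import numFieldNormedType.Exports.

Local Open Scope ring_scope.

(** * Compositions and their spectral exponents *)

Section Compositions.
Variable n : nat.
Implicit Types (u v w : 'X_{1..n.+1}) (i j k : 'I_n.+1).

(** The working objects are the Lagrange polynomials [lagrange u], of degree at most |u|, equal to 1
    at <u> and to 0 at the other <w> with |w| <= |u|. Values on the grid of spectral vectors
    determine a polynomial, so operator identities are checked pointwise, where [hop] mixes the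
    values at w and [cswap r w] and [tau] shifts them along [cshift]. The price is the
    normalisation: M_u is fixed by a coefficient, and turning this into its value [mu u] at <u>
    takes an induction over diagrams. The symmetry of the kernel is hidden, since y enters through
    homogeneous polynomials and w through inhomogeneous ones. What closes the induction is a pair of
    linear relations for the kernel at [cshift w]: one lowers E_u in y, the other is the eigenvalue
    equation of M_u in w. Solving them expresses the kernel at [cshift w] by the one at w. Infinite
    products enter only at the end: the product of the (a<w>_i)_infinity times the finite symbol
    (a)_w is independent of w, so at x = <w> the right-hand side is a ratio of finite products. *)

Definition cshift w : 'X_{1..n.+1} :=
  [multinom (w (ordS i) + (i == ord_max))%N | i < n.+1].

Definition swap (r : nat) : 'S_n.+1 := tperm (inord r) (inord r.+1).

Lemma inord_val r : (r < n)%N -> (inord r : 'I_n.+1) = r :> nat.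
Proof. by move=> h; rewrite /= inordK // ltnS ltnW. Qed.

Lemma inordS_val r : (r < n)%N -> (inord r.+1 : 'I_n.+1) = r.+1 :> nat.
Proof. by move=> h; rewrite /= inordK // ltnS. Qed.

Lemma inord_neqS r : (r < n)%N -> (inord r == inord r.+1 :> 'I_n.+1) = false.
Proof.
by move=> h; apply/negbTE; rewrite -val_eqE /= inord_val // inordS_val // neq_ltn ltnSn.
Qed.

Lemma swapl r : swap r (inord r) = inord r.+1. Proof. by rewrite tpermL. Qed.
Lemma swapr r : swap r (inord r.+1) = inord r. Proof. by rewrite tpermR. Qed.
Lemma swapD r i : i != inord r -> i != inord r.+1 -> swap r i = i.
Proof. by rewrite eq_sym => h1; rewrite eq_sym => h2; rewrite tpermD. Qed.
Lemma swapK r : involutive (swap r). Proof. exact: tpermK. Qed.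
Lemma swapV r : (swap r)^-1%g = swap r. Proof. exact: tpermV. Qed.

Definition cswap r w : 'X_{1..n.+1} := [multinom w (swap r i) | i < n.+1].

Lemma cswapE r w i : cswap r w i = w (swap r i).
Proof. by rewrite mnmE. Qed.

Lemma cswapK r : involutive (cswap r).
Proof. by move=> w; apply/mnmP => i; rewrite !cswapE swapK. Qed.

Lemma cswap_id r w : w (inord r) = w (inord r.+1) -> (cswap r w) = w.
Proof.
move=> h; apply/mnmP => i; rewrite cswapE.
case: (eqVneq i (inord r)) => [->|h1]; first by rewrite swapl.
case: (eqVneq i (inord r.+1)) => [->|h2]; first by rewrite swapr.
by rewrite swapD.
Qed.

Lemma ordS_lt i : i != ord_max -> ordS i = i.+1 :> nat.
Proof.
move=> h; rewrite /= modn_small //; move: (ltn_ord i); rewrite ltnS leq_eqVlt.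
by case/predU1P => // e; case/eqP: h; apply/val_inj.
Qed.

Lemma ordS_max : ordS (ord_max : 'I_n.+1) = ord0.
Proof. by apply/val_inj; rewrite /= modnn. Qed.

Lemma ord_pred0 : ord_pred (ord0 : 'I_n.+1) = ord_max.
Proof. by rewrite -ordS_max ordSK. Qed.

Lemma ordS_eq0 i : (ordS i == ord0) = (i == ord_max).
Proof. by rewrite -ordS_max (inj_eq (can_inj (@ordSK n.+1))). Qed.

Lemma cshiftE w i : cshift w i = (w (ordS i) + (i == ord_max))%N.
Proof. by rewrite mnmE. Qed.

Lemma big_ordS (R : Type) (idx : R) (op : Monoid.com_law idx) (F : 'I_n.+1 -> R) :
  \big[op/idx]_i F (ordS i) = \big[op/idx]_i F i.
Proof.
rewrite [RHS](reindex (@ordS n.+1)) //.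
by exists (@ord_pred n.+1) => i _; rewrite ?ordSK ?ord_predK.
Qed.

Lemma mdeg_cshift w : mdeg (cshift w) = (mdeg w).+1.
Proof.
rewrite !mdegE; under eq_bigr do rewrite cshiftE.
rewrite big_split /= (big_ordS _ (fun i => w i)) -[RHS]addn1; congr addn.
by rewrite (bigD1 ord_max) //= eqxx big1 // => i /negbTE ->.
Qed.

Lemma cshift_inj : injective cshift.
Proof.
move=> u w /mnmP h; apply/mnmP => i.
by move: (h (ord_pred i)); rewrite !cshiftE ord_predK => /addIn.
Qed.

Lemma cshiftP w : (0 < w ord_max)%N -> exists u, w = cshift u.
Proof.
move=> h; exists [multinom (w (ord_pred i) - (i == ord0))%N | i < n.+1].
apply/mnmP => i; rewrite cshiftE mnmE ordSK ordS_eq0.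
by case: (eqVneq i ord_max) => [->|] /=; rewrite ?subn0 ?addn0 // subn1 addn1 prednK.
Qed.

Lemma cshift_max w : cshift w ord_max = (w ord0).+1.
Proof. by rewrite cshiftE ordS_max eqxx addn1. Qed.

(** The measure is the degree, then the distance of the last nonzero entry from the end. If that
    entry stands last, w is a [cshift]; otherwise exchanging it with the zero on its right brings it
    nearer to the end. The side conditions of the swap step are what later keeps [exch] nonzero and
    the change of leg lengths under control. *)
Lemma comp_ind (P : 'X_{1..n.+1} -> Prop) :
  P 0%MM -> (forall w, P w -> P (cshift w)) ->
  (forall w r, (r < n)%N -> w (inord r) = 0%N -> (0 < w (inord r.+1))%N ->
     (forall k, (r.+1 < k)%N -> w k = 0%N) -> P w -> P (cswap r w)) ->
  forall w, P w.
Proof.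
move=> P0 PS Psw w; have [d] := ubnP (mdeg w).
elim: d w => // d IH w /ltnSE dw.
have [/eqP|wn0] := eqVneq (mdeg w) 0%N; first by rewrite mdeg_eq0 => /eqP ->.
have H m : forall u j, (mdeg u <= d)%N -> (0 < u j)%N ->
    (forall k, (j < k)%N -> u k = 0%N) -> (n - j)%N = m -> P u.
  elim: m => [|m IHm] u j du uj ju nj.
    have ej : j = ord_max by apply/val_inj => /=; move: (ltn_ord j) nj; lia.
    move: uj; rewrite ej => /cshiftP[u' eu]; rewrite eu; apply/PS/IH.
    by move: du; rewrite eu mdeg_cshift.
  have jn : (j < n)%N by lia.
  have ej : inord j = j by apply/val_inj; rewrite /= inord_val.
  have vj := inordS_val jn.
  have e1 : (cswap j u) (inord j) = 0%N.
    by rewrite cswapE swapl ju // vj.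
  have e2 : (cswap j u) (inord j.+1) = u j by rewrite cswapE swapr ej.
  have e3 k : (j.+1 < k)%N -> (cswap j u) k = 0%N.
    move=> jk; rewrite cswapE swapD ?ju ?(ltn_trans _ jk) //.
      by rewrite ej -val_eqE /=; lia.
    by rewrite -val_eqE /= vj; lia.
  rewrite -[u](cswapK j); apply: Psw => //; first by rewrite e2.
  apply: (IHm _ (inord j.+1)); rewrite ?e2 ?mdeg_mperm //.
    by move=> k; rewrite vj; apply: e3.
  by rewrite vj; lia.
have [j0 hj0] : exists j, (0 < w j)%N.
  apply/existsP; apply: contraNT wn0; rewrite negb_exists => /forallP h.
  by rewrite mdeg_eq0; apply/eqP/mnmP => i; move: (h i); rewrite mnmE; case: (w i).
case: (arg_maxnP (P := fun j => 0 < w j) val hj0)%N => j wj jmax.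
apply: (H (n - j)%N w j) => // k jk; apply/eqP; rewrite -leqn0 leqNgt.
by apply/negP => /jmax /=; rewrite leqNgt jk.
Qed.

Lemma spec_expE u i :
  spec_exp u i = (\sum_j ((u j < u i) || ((i < j) && (u j == u i))))%N.
Proof.
rewrite /spec_exp -!sum1_card [X in (X + _)%N]big_mkcond.
rewrite [X in (_ + X)%N]big_mkcond -big_split /=; apply: eq_bigr => j _.
by rewrite !inE; have [] := ltngtP (u j) (u i); rewrite ?andbF //= ?andbT.
Qed.

(** The tie rule is made for this: the entry w_0 + 1 now stands last, and w_j < w_0 + 1 means w_j <=
    w_0, which is what was counted for w_0 in the first place. *)
Lemma spec_exp_cshift w i : spec_exp (cshift w) i = spec_exp w (ordS i).
Proof.
rewrite !spec_expE.
rewrite -(big_ordS _ (fun j => ((w j < w (ordS i)) || ((ordS i < j) && (w j == w (ordS i))) : nat)%N)).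
apply: eq_bigr => j _; rewrite !cshiftE; congr nat_of_bool.
case: (eqVneq i ord_max) => [->|hi]; case: (eqVneq j ord_max) => [->|hj].
- by rewrite !ltnn.
- rewrite ordS_max (ordS_lt hj) /= addn0 addn1 !ltnS.
  have -> : (n < j)%N = false by move: (ltn_ord j); lia.
  by rewrite /= orbF leq_eqVlt orbC.
- rewrite ordS_max (ordS_lt hi) addn0 addn1 ltn0 /=.
  have -> : (i < n)%N by move: hi (ltn_ord i); rewrite -val_eqE /=; lia.
  by rewrite orbF orbC -leq_eqVlt.
- by rewrite (ordS_lt hi) (ordS_lt hj) !addn0 ltnS.
Qed.

(** The swap changes the relative position of the pair r, r+1 only, and these two entries are
    distinct, so no tie is affected. *)
Lemma spec_exp_swap w r i : (r < n)%N -> w (inord r) != w (inord r.+1) ->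
  spec_exp (cswap r w) i = spec_exp w (swap r i).
Proof.
move=> rn h; rewrite !spec_expE.
rewrite [RHS](reindex_inj (@perm_inj _ (swap r))) /=; apply: eq_bigr => j _.
rewrite !cswapE; case: (eqVneq (w (swap r j)) (w (swap r i))) => e; last by rewrite !andbF.
rewrite !andbT; congr (nat_of_bool (_ || _)).
have v1 := inord_val rn; have v2 := inordS_val rn.
case: (eqVneq i (inord r)) e => [->|h1] e.
  rewrite swapl v1 v2; move: e; rewrite swapl.
  case: (eqVneq j (inord r)) => [->|g1]; first by rewrite swapl v1 v2 ltnn ltnn.
  case: (eqVneq j (inord r.+1)) => [->|g2].
    by rewrite swapr => e; rewrite e eqxx in h.
  by rewrite swapD // => _; move: g1 g2; rewrite -!val_eqE /= v1 v2; lia.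
case: (eqVneq i (inord r.+1)) e => [->|h2] e.
  rewrite swapr v1 v2; move: e; rewrite swapr.
  case: (eqVneq j (inord r)) => [->|g1].
    by rewrite swapl => e; rewrite e eqxx in h.
  case: (eqVneq j (inord r.+1)) => [->|g2]; first by rewrite swapr v1 v2 !ltnn.
  by rewrite swapD // => _; move: g1 g2; rewrite -!val_eqE /= v1 v2; lia.
rewrite (swapD h1 h2).
case: (eqVneq j (inord r)) => [->|g1].
  by rewrite swapl v1 v2; move: h1 h2; rewrite -!val_eqE /= v1 v2; lia.
case: (eqVneq j (inord r.+1)) => [->|g2].
  by rewrite swapr v1 v2; move: h1 h2; rewrite -!val_eqE /= v1 v2; lia.
by rewrite swapD.
Qed.

(** The left entry counts the right one as a tie and nothing else differs. This puts <w> on the zero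
    locus of [exch] exactly when the swap fixes w. *)
Lemma spec_exp_adj w r : (r < n)%N -> w (inord r) = w (inord r.+1) ->
  spec_exp w (inord r) = (spec_exp w (inord r.+1)).+1.
Proof.
move=> rn e; have v1 := inord_val rn; have v2 := inordS_val rn.
rewrite !spec_expE (bigD1 (inord r.+1)) //= [in RHS](bigD1 (inord r.+1)) //= v1 v2.
rewrite e eqxx !ltnn ltnSn /= add1n add0n; congr _.+1; apply: eq_bigr => j hj.
congr nat_of_bool; case: (ltngtP (w j) (w (inord r.+1))) => //= ejw; rewrite ?andbF ?andbT //.
by move: hj; rewrite -val_eqE /= v2; lia.
Qed.

Lemma spec_exp_max0 w : w ord_max = 0%N -> spec_exp w ord_max = 0%N.
Proof.
move=> e; rewrite spec_expE big1 // => j _; rewrite e ltn0 /=.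
by rewrite ltnNge -ltnS ltn_ord.
Qed.

End Compositions.

(* Here A * B is triangular with invertible diagonal, so B is invertible. *)
Lemma triangular_eq0 (K : fieldType) (I : finType) (deg : I -> nat)
    (A B : I -> I -> K) :
  (forall u w, (deg w <= deg u)%N -> (\sum_k A u k * B k w == 0) = (w != u)) ->
  forall c : I -> K, (forall w, \sum_k c k * B k w = 0) -> c =1 fun=> 0.
Proof.
move=> hAB c hc.
pose mA := \matrix_(i < #|I|, j < #|I|) A (enum_val i) (enum_val j).
pose mB := \matrix_(i < #|I|, j < #|I|) B (enum_val i) (enum_val j).
have sumE (F : I -> K) : \sum_k F k = \sum_(i < #|I|) F (enum_val i).
  by rewrite (reindex (fun i : 'I_#|I| => enum_val i)) //; apply: onW_bij; apply: enum_val_bij.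
have free : row_free (mA *m mB).
  rewrite -kermx_eq0; apply/eqP/row_matrixP => i; rewrite row0.
  set v := row i _; have : v *m (mA *m mB) = 0.
    by apply/sub_kermxP; apply: row_sub.
  move: {i}v => v hv; apply/rowP => i; rewrite mxE; move: i.
  (* A left null vector vanishes by induction on the degree of the index: in column i the rows of
     lower degree are already killed, and among the others only the diagonal entry is nonzero. *)
  suff H m : forall i, deg (enum_val i) = m -> v 0 i = 0.
    by move=> i; apply: H erefl.
  elim/ltn_ind: m => m IH i di.
  move/rowP/(_ i): hv; rewrite !mxE (bigD1 i) //= big1 => [|j ji].
    move/eqP; rewrite addr0 mulf_eq0 !mxE; case/orP => [/eqP //|].
    under eq_bigr do rewrite !mxE.
    by rewrite -(sumE (fun k => A (enum_val i) k * B k (enum_val i))) hAB ?eqxx.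
  case: (ltnP (deg (enum_val j)) (deg (enum_val i))) => dij.
    by rewrite (IH _ _ j erefl) ?mul0r // -di.
  rewrite !mxE; under eq_bigr do rewrite !mxE.
  rewrite -(sumE (fun k => A (enum_val j) k * B k (enum_val i))).
  apply/eqP; rewrite mulf_eq0 hAB // (inj_eq enum_val_inj) orbC.
  by rewrite eq_sym ji.
have uB : mB \in unitmx.
  by move: free; rewrite row_free_unit unitmx_mul => /andP[].
pose r := \row_(i < #|I|) c (enum_val i).
have : r *m mB = 0.
  apply/rowP => j; rewrite !mxE; under eq_bigr do rewrite !mxE.
  by rewrite -(sumE (fun k => c k * B k (enum_val j))) hc.
move/(canRL (mulmxK uB)); rewrite mul0mx => /rowP r0 k.
by move: (r0 (enum_rank k)); rewrite !mxE enum_rankK.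
Qed.

(** * Linear maps that preserve homogeneity *)

Section HomogeneousMaps.
Variables (n : nat) (K : fieldType).
Implicit Types p g : {mpoly K[n]}.

Lemma msize_pihomogP p d :
  reflect (forall k, (d <= k)%N -> pihomog mdeg k p = 0) (msize p <= d)%N.
Proof.
apply: (iffP idP) => [h k dk|h].
  rewrite pihomogE big_seq_cond big_pred0 // => m.
  apply/negP => /andP[/msize_mdeg_lt hm /eqP hk].
  by move: (leq_trans hm h); rewrite hk ltnNge dk.
rewrite msizeE; apply/bigmax_leqP_seq => m hm _; rewrite ltnNge; apply/negP => dm.
have := h _ dm; move/mpolyP/(_ m); rewrite mcoeff0 pihomogE raddf_sum /=.
under eq_bigr do rewrite mcoeffZ mcoeffX.
rewrite (big_rem m) //= !eqxx /= mulr1 big1_seq ?addr0 => [/eqP|k].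
  by rewrite mcoeff_eq0 hm.
case/andP=> _; rewrite mem_rem_uniq ?msupp_uniq // !inE => /andP[/negbTE -> _].
by rewrite mulr0.
Qed.

(** Through this lemma, identities between interpolation polynomials pass to their top-degree
    components. *)
Lemma pihomog_linear (L : {linear {mpoly K[n]} -> {mpoly K[n]}}) :
  (forall d p, p \is d.-homog -> L p \is d.-homog) ->
  forall d p, pihomog mdeg d (L p) = L (pihomog mdeg d p).
Proof.
move=> hL d p; set N := maxn (msize p) d.+1.
rewrite {1}(@pihomog_partitionE _ _ mdeg N p (leq_maxl _ _)) (linear_sum L) (linear_sum (pihomog mdeg d)) /=.
have dN : (d < N)%N by rewrite leq_maxr.
rewrite (bigD1 (Ordinal dN)) //= (pihomog_dE (hL _ _ (pihomogP _ _ _))).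
rewrite big1 ?addr0 // => k hk.
by apply: (@pihomog_ne0 _ _ _ k); rewrite ?hL ?pihomogP // -val_eqE.
Qed.

Lemma msize_linear (L : {linear {mpoly K[n]} -> {mpoly K[n]}}) :
  (forall d p, p \is d.-homog -> L p \is d.-homog) ->
  forall p, (msize (L p) <= msize p)%N.
Proof.
move=> hL p; apply/msize_pihomogP => k hk; rewrite pihomog_linear //.
by move/msize_pihomogP: (leqnn (msize p)) => ->; rewrite ?linear0.
Qed.

Lemma pihomogXM i d p :
  pihomog mdeg d.+1 ('X_i * p) = 'X_i * pihomog mdeg d p.
Proof.
set N := maxn (msize p) d.+1.
rewrite {1}(@pihomog_partitionE _ _ mdeg N p (leq_maxl _ _)) mulr_sumr (linear_sum (pihomog mdeg d.+1)) /=.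
have dN : (d < N)%N by rewrite leq_maxr.
have hX k : 'X_i * pihomog mdeg k p \is k.+1.-homog.
  by rewrite -add1n; apply: dhomogM; rewrite ?pihomogP // dhomogX /= mdeg1.
rewrite (bigD1 (Ordinal dN)) //= (pihomog_dE (hX d)) big1 ?addr0 // => k hk.
by apply: (@pihomog_ne0 _ _ _ k.+1); rewrite ?hX // eqSS.
Qed.

Definition scale_subst (c : 'I_n -> K) (s : 'I_n -> 'I_n) : {mpoly K[n]} -> {mpoly K[n]} :=
  comp_mpoly [tuple c i *: 'X_(s i) | i < n].

HB.instance Definition _ c s := GRing.LRMorphism.on (scale_subst c s).

Lemma scale_substE c s p x :
  (scale_subst c s p).@[x] = p.@[fun i => c i * x (s i)].
Proof.
rewrite /scale_subst comp_mpoly_meval; apply: meval_eq => i.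
by rewrite tnth_mktuple mevalZ mevalXU.
Qed.

Lemma scale_subst_homog c s d p : p \is d.-homog -> scale_subst c s p \is d.-homog.
Proof.
move/dhomogP => hp; rewrite /scale_subst comp_mpolyEX big_seq; apply: rpred_sum => m hm.
apply: rpredZ; rewrite comp_mpolyX.
under eq_bigr do rewrite tnth_mktuple exprZn.
rewrite scaler_prod; apply: rpredZ.
rewrite mprodXnE dhomogX /= mdeg_sum -(hp m hm); apply/eqP; rewrite [RHS]mdegE; apply: eq_bigr => i _.
by rewrite mdegMn mdeg1 mul1n.
Qed.

End HomogeneousMaps.

(** * Divided differences *)

Section DividedDifference.
Variables (n : nat) (K : fieldType).
Implicit Types p g : {mpoly K[n.+1]}.

Lemma msym_meval (s : 'S_n.+1) p x : (msym s p).@[x] = p.@[x \o s].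
Proof.
elim/mpolyind: p => [|c m p _ _ IH]; first by rewrite msym0 !meval0.
rewrite msymD msymZ !mevalD !mevalZ IH msymX !mevalX; congr (_ * _ + _).
rewrite (reindex_inj (@perm_inj _ s)); apply: eq_bigr => i _ /=.
by rewrite mnmE permK.
Qed.

Lemma msym_homog (s : 'S_n.+1) d p : p \is d.-homog -> msym s p \is d.-homog.
Proof. by move=> hp; rewrite homog_piE -msym_pihomog pihomog_dE. Qed.

Let dX r : {mpoly K[n.+1]} := 'X_(inord r) - 'X_(inord r.+1).

Lemma dX_neq0 r : (r < n)%N -> dX r != 0.
Proof.
move=> rn; rewrite subr_eq0; apply/eqP => /mpolyP/(_ U_(inord r)%MM).
rewrite !mcoeffXU eqxx eq_sym inord_neqS // => /eqP.
by rewrite oner_eq0.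
Qed.

Lemma divdiff_var r k : exists e : K, msym (swap n r) 'X_k - 'X_k = dX r * e%:MP.
Proof.
rewrite /dX msymX swapV.
have -> : [multinom U_(k)%MM (swap n r i) | i < n.+1] = U_(swap n r k)%MM.
  by apply/mnmP => i; rewrite !mnmE -{1}[k](swapK r) (inj_eq perm_inj).
case: (eqVneq k (inord r)) => [->|h1].
  by exists (-1); rewrite swapl mpolyCN mulrN1 opprB.
case: (eqVneq k (inord r.+1)) => [->|h2].
  by exists 1; rewrite swapr mulr1.
by exists 0; rewrite swapD // subrr mpolyC0 mulr0.
Qed.

(** Splitting off one variable and using s(fg) - fg = s(f)(s(g) - g) + (s(f) - f)g. Homogeneity is
    recorded for 'X_r times g, so that no predecessor of a degree appears. *)
Lemma divdiff_monomial r m : exists g,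
  dX r * g = msym (swap n r) 'X_[m] - 'X_[m] /\ 'X_(inord r) * g \is (mdeg m).-homog.
Proof.
elim: {m}(mdeg m) {-2}m (erefl (mdeg m)) => [m hm|d IH m hm].
  exists 0; rewrite !mulr0 rpred0; split => //.
  by move/eqP: hm; rewrite mdeg_eq0 => /eqP ->; rewrite mpolyX0 msym1 subrr.
have [k hk] : exists k, m k != 0%N.
  apply/existsP; apply: contraT; rewrite negb_exists => /forallP h.
  suff m0 : m = 0%MM by rewrite m0 mdeg0 in hm.
  by apply/mnmP => i; rewrite mnm0E; apply/eqP; move: (h i); rewrite negbK.
have em : m = (U_(k) + (m - U_(k)))%MM by rewrite addmC submK // lep1mP.
have dm : mdeg (m - U_(k)) = d.
  by move: hm; rewrite {1}em mdegD mdeg1 add1n => -[].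
have [g [hg gh]] := IH _ dm; have [e he] := divdiff_var r k.
exists (msym (swap n r) 'X_k * g + e%:MP * 'X_[m - U_(k)]); split.
  rewrite [in RHS]em mpolyXD msymM mulrDr mulrCA hg mulrA -he; ring.
have -> : mdeg m = (1 + mdeg (m - U_(k))%MM)%N by rewrite dm hm.
rewrite mulrDr; apply: rpredD; rewrite mulrCA.
  apply: dhomogM => //.
  by apply: msym_homog; rewrite dhomogX /= mdeg1.
rewrite mul_mpolyC; apply: rpredZ; apply: dhomogM.
  by rewrite dhomogX /= mdeg1.
by rewrite dhomogX.
Qed.

Lemma divdiff_exists r p : exists g, dX r * g = msym (swap n r) p - p /\
  forall d, p \is d.-homog -> 'X_(inord r) * g \is d.-homog.
Proof.
pose G m := projT1 (cid (divdiff_monomial r m)).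
have G1 m := proj1 (projT2 (cid (divdiff_monomial r m))).
have G2 m := proj2 (projT2 (cid (divdiff_monomial r m))).
exists (\sum_(m <- msupp p) p@_m *: G m); split.
  rewrite [in RHS](mpolyE p) (linear_sum (msym (swap n r))) /= -sumrB mulr_sumr.
  by apply: eq_bigr => m _; rewrite msymZ -scalerBr -scalerAr G1.
move=> d /dhomogP hp; rewrite mulr_sumr big_seq; apply: rpred_sum => m hm.
by rewrite -scalerAr; apply: rpredZ; rewrite -(hp m hm); apply: G2.
Qed.

(** The value 0 for r >= n, where there is no adjacent pair, makes the map linear for every
    index. *)
Definition divdiff r p : {mpoly K[n.+1]} :=
  if (r < n)%N then projT1 (cid (divdiff_exists r p)) else 0.

Lemma divdiffE r p : (r < n)%N ->
  ('X_(inord r) - 'X_(inord r.+1)) * divdiff r p = msym (swap n r) p - p.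
Proof. by move=> rn; rewrite /divdiff rn; case: cid => g []. Qed.

Lemma divdiff_is_linear r : linear (divdiff r).
Proof.
move=> c p g; case: (ltnP r n) => rn; last first.
  by rewrite /divdiff ltnNge rn scaler0 addr0.
apply: (mulfI (dX_neq0 rn)); rewrite divdiffE // mulrDr -scalerAr !divdiffE //.
by rewrite linearP /= scalerBr opprD addrACA.
Qed.

HB.instance Definition _ r :=
  GRing.isLinear.Build K {mpoly K[n.+1]} {mpoly K[n.+1]} _ (divdiff r) (divdiff_is_linear r).

Lemma divdiff_homog r d p :
  p \is d.-homog -> 'X_(inord r) * divdiff r p \is d.-homog.
Proof.
move=> hp; rewrite /divdiff; case: ifP => _; last by rewrite mulr0 rpred0.
by case: cid => g [? h] /=; apply: h.
Qed.

End DividedDifference.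

(** * Interpolation at spectral vectors *)

Section Interpolation.
Variables (K : numFieldType) (q t : K) (n : nat).
Hypothesis qt_generic : generic q t.
Implicit Types (u v w : 'X_{1..n.+1}) (p g : {mpoly K[n.+1]}) (x : 'I_n.+1 -> K).

Local Notation sp := (spectral q t).

Let q_neq0 : q != 0. Proof. by case: qt_generic. Qed.
Let t_neq0 : t != 0. Proof. by case: qt_generic. Qed.

Lemma generic_exp a b c d :
  q ^+ a * t ^+ b = q ^+ c * t ^+ d -> a = c /\ b = d.
Proof.
move=> e; case: qt_generic => _ _ /(_ (a%:Z - c%:Z) (b%:Z - d%:Z)).
rewrite !expfzDr // -!invr_expz -!exprnP mulrACA e -invfM mulfV.
  by move=> /(_ erefl) [h1 h2]; split; lia.
by rewrite mulf_neq0 // expf_neq0.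
Qed.

Lemma sp_neq0 w i : sp w i != 0.
Proof. by rewrite /spectral mulf_neq0 // expf_neq0. Qed.

Lemma sp_cshift w i : sp (cshift w) i = (if i == ord_max then q else 1) * sp w (ordS i).
Proof.
rewrite /spectral spec_exp_cshift cshiftE exprD -mulrA mulrCA; congr (_ * _).
by case: eqP.
Qed.

Lemma sp_cshift_max w : sp (cshift w) ord_max = q * sp w ord0.
Proof. by rewrite sp_cshift eqxx ordS_max. Qed.

Lemma sp_cswap w r : (r < n)%N -> w (inord r) != w (inord r.+1) ->
  sp (cswap r w) =1 sp w \o swap n r.
Proof. by move=> rn h i; rewrite /spectral spec_exp_swap // cswapE. Qed.

Lemma sp_adj w r : (r < n)%N -> w (inord r) = w (inord r.+1) ->
  sp w (inord r) = t * sp w (inord r.+1).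
Proof. by move=> rn h; rewrite /spectral spec_exp_adj // h exprS mulrCA. Qed.

Lemma sp_neq w r : (r < n)%N -> sp w (inord r) != sp w (inord r.+1).
Proof.
move=> rn; apply/eqP => /generic_exp [h1]; rewrite spec_exp_adj // => h2; lia.
Qed.

Lemma sp_neq_t w r : (r < n)%N -> w (inord r) != w (inord r.+1) ->
  sp w (inord r) != t * sp w (inord r.+1).
Proof.
by move=> rn /eqP h; apply/eqP; rewrite /spectral mulrCA -exprS => /generic_exp [].
Qed.

Lemma sp_max0 w : w ord_max = 0%N -> sp w ord_max = 1.
Proof. by move=> h; rewrite /spectral h spec_exp_max0 // !expr0 mulr1. Qed.

Lemma q_sp_neq1 w i : q * sp w i - 1 != 0.
Proof.
rewrite subr_eq0 /spectral mulrA -exprS; apply/eqP => h.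
by have [] // := @generic_exp (w i).+1 (spec_exp w i) 0 0; rewrite h !expr0 mulr1.
Qed.

(** The coefficient of the transposition in [hop]. It is homogeneous of degree 0, hence blind to
    dilation, and at a spectral vector it vanishes exactly when the two entries of the composition
    coincide. *)
Definition exch r x : K :=
  (x (inord r) - t * x (inord r.+1)) / (t * (x (inord r) - x (inord r.+1))).

Lemma exch_sp_eq0 r w : (r < n)%N ->
  (exch r (sp w) == 0) = (w (inord r) == w (inord r.+1)).
Proof.
move=> rn; rewrite /exch !mulf_eq0 invr_eq0 !mulf_eq0 (negbTE t_neq0) /=.
rewrite [_ - sp w (inord r.+1) == 0]subr_eq0 (negbTE (sp_neq w rn)) orbF subr_eq0.
by apply/idP/idP => [|/eqP/(sp_adj rn) ->//]; apply: contraTT => /(sp_neq_t rn).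
Qed.

(* The Demazure-Lusztig operator, normalised to fix symmetric polynomials. *)
Definition hop r p : {mpoly K[n.+1]} :=
  msym (swap n r) p + (t^-1 - 1) *: ('X_(inord r) * divdiff r p).

Lemma hop_is_linear r : linear (hop r).
Proof.
move=> c p g; rewrite /hop !linearP /= mulrDr -scalerAr scalerDr !scalerA.
by rewrite addrACA scalerDr scalerA (mulrC c).
Qed.

HB.instance Definition _ r :=
  GRing.isLinear.Build K {mpoly K[n.+1]} {mpoly K[n.+1]} _ (hop r) (hop_is_linear r).

Lemma hop_homog r d p : p \is d.-homog -> hop r p \is d.-homog.
Proof.
by move=> hp; apply: rpredD; [exact: msym_homog|apply: rpredZ; exact: divdiff_homog].
Qed.

Lemma hop_meval0 r p x : x (inord r) = 0 -> (hop r p).@[x] = p.@[x \o swap n r].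
Proof.
by move=> h; rewrite /hop mevalD mevalZ mevalM mevalXU h mul0r mulr0 addr0 msym_meval.
Qed.

Lemma hop_meval r p x : (r < n)%N -> x (inord r) != x (inord r.+1) ->
  (hop r p).@[x] = (1 - exch r x) * p.@[x] + exch r x * p.@[x \o swap n r].
Proof.
move=> rn; rewrite -subr_eq0 => hx; have := congr1 (meval x) (divdiffE p rn).
rewrite /hop /exch mevalM !mevalB !mevalD !mevalXU !mevalZ mevalM mevalXU msym_meval => e.
have -> : (divdiff r p).@[x] =
  (p.@[x \o swap n r] - p.@[x]) / (x (inord r) - x (inord r.+1)).
  by rewrite -e mulrC mulKf.
field; exact/andP.
Qed.

(** If w_r = w_{r+1}, swapping coordinates of <w> leaves the grid, but then the coefficient is zero.
    So [hop] acts on functions on the grid. *)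
Lemma hop_sp r p w : (r < n)%N ->
  (hop r p).@[sp w] = (1 - exch r (sp w)) * p.@[sp w] + exch r (sp w) * p.@[sp (cswap r w)].
Proof.
move=> rn; rewrite hop_meval ?sp_neq //.
case: (eqVneq (w (inord r)) (w (inord r.+1))) => h.
  by have /eqP -> : exch r (sp w) == 0; rewrite ?exch_sp_eq0 ?h // !mul0r.
by congr (_ + _ * _); apply: meval_eq => i; rewrite sp_cswap.
Qed.

(** With variables numbered from 0 to n, [tau p] at x is p(x_n / q, x_0, ..., x_{n-1}), and [tauV]
    substitutes (x_1, ..., x_n, q x_0); on the grid [tauV] is composition with [cshift]. *)
Definition tau : {mpoly K[n.+1]} -> {mpoly K[n.+1]} :=
  scale_subst (fun i => if i == ord0 then q^-1 else 1) (@ord_pred n.+1).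
HB.instance Definition _ := GRing.LRMorphism.on tau.

Definition tauV : {mpoly K[n.+1]} -> {mpoly K[n.+1]} :=
  scale_subst (fun i => if i == ord_max then q else 1) (@ordS n.+1).
HB.instance Definition _ := GRing.LRMorphism.on tauV.

Lemma tau_homog d p : p \is d.-homog -> tau p \is d.-homog.
Proof. exact: scale_subst_homog. Qed.

Lemma tauV_homog d p : p \is d.-homog -> tauV p \is d.-homog.
Proof. exact: scale_subst_homog. Qed.

Lemma tau_sp p w : (tau p).@[sp (cshift w)] = p.@[sp w].
Proof.
rewrite /tau scale_substE; apply: meval_eq => i.
rewrite sp_cshift ord_predK -ordS_eq0 ord_predK.
by case: ifP => _; rewrite ?mul1r // mulKf.
Qed.

Lemma tauV_sp p w : (tauV p).@[sp w] = p.@[sp (cshift w)].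
Proof. by rewrite /tauV scale_substE; apply: meval_eq => i; rewrite sp_cshift. Qed.

(** The raising operator of Knop and Sahi. Its first factor vanishes at <w> when the last entry of w
    is 0, that is when w is not a [cshift]; at every other grid point [tau] gives the value. *)
Definition phiop p : {mpoly K[n.+1]} := ('X_ord_max - 1) * tau p.

Lemma phiop_sp0 p w : w ord_max = 0%N -> (phiop p).@[sp w] = 0.
Proof.
by move=> h; rewrite /phiop mevalM mevalB mevalXU meval1 sp_max0 // subrr mul0r.
Qed.

Lemma phiop_sp p w : (phiop p).@[sp (cshift w)] = (q * sp w ord0 - 1) * p.@[sp w].
Proof. by rewrite /phiop mevalM mevalB mevalXU meval1 sp_cshift_max tau_sp. Qed.

Lemma msize_phiop p d : (msize p <= d)%N -> (msize (phiop p) <= d.+1)%N.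
Proof.
move=> hp; rewrite /phiop; have [->|tp0] := eqVneq (tau p) 0.
  by rewrite mulr0 msize0.
have [e|X0] := eqVneq ('X_ord_max - 1 : {mpoly K[n.+1]}) 0.
  by rewrite e mul0r msize0.
rewrite msizeM //; have h1 : (msize (tau p) <= d)%N.
  by apply: leq_trans hp; apply: (msize_linear (L := tau)) => k g; apply: tau_homog.
have h2 : (msize ('X_ord_max - 1 : {mpoly K[n.+1]}) <= 2)%N.
  apply: leq_trans (msizeD_le _ _) _.
  by rewrite msizeN msizeX mdeg1 msize1.
by rewrite -[d.+1]/((2 + d).-1) -!subn1 leq_sub2r // leq_add.
Qed.

Lemma msize_hop r p : (msize (hop r p) <= msize p)%N.
Proof. by apply: (msize_linear (L := hop r)) => k g; apply: hop_homog. Qed.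

(** The degree is only bounded; that it is attained follows once the coefficient of x^u is known to
    be nonzero. *)
Definition is_lagrange u p := (msize p <= (mdeg u).+1)%N /\
  forall w, (mdeg w <= mdeg u)%N -> p.@[sp w] = (w == u)%:R.

(** [phiop] carries a solution for u to one for [cshift u]. For a swap, [hop] produces values at
    both u and [cswap r u], and subtracting the right multiple of p removes the one at u. *)
Lemma lagrange_exists u : exists p, is_lagrange u p.
Proof.
elim/comp_ind: u => [|u [p [sp_p hp]]|u r rn h0 h1 _ [p [sp_p hp]]].
- exists 1; split; first by rewrite msize1 mdeg0.
  by move=> w; rewrite mdeg0 leqn0 mdeg_eq0 => ->; rewrite meval1.
- exists ((q * sp u ord0 - 1)^-1 *: phiop p); split.
    rewrite mdeg_cshift; apply: leq_trans (msizeZ_le _ _) _; exact: msize_phiop.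
  move=> w; rewrite mevalZ mdeg_cshift => dw.
  have [w0|/cshiftP[w' ew]] := posnP (w ord_max).
    rewrite phiop_sp0 // mulr0; case: eqP => // ew.
    by move: w0; rewrite ew cshift_max.
  rewrite ew phiop_sp (inj_eq (@cshift_inj n)) hp; last by rewrite -ltnS -mdeg_cshift -ew.
  by case: eqP => [->|_]; rewrite ?mulr0 // mulr1 mulVf ?q_sp_neq1.
- have hne : (cswap r u) (inord r) != (cswap r u) (inord r.+1).
    by rewrite !cswapE swapl swapr h0 -lt0n.
  have hneu : cswap r u != u.
    by apply: contraTneq h1 => e; rewrite -{1}e cswapE swapr h0.
  exists ((exch r (sp (cswap r u)))^-1 *: (hop r p - (1 - exch r (sp u)) *: p)); split.
    rewrite mdeg_mperm; apply: leq_trans (msizeZ_le _ _) _.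
    apply: leq_trans (msizeD_le _ _) _; rewrite msizeN geq_max.
    rewrite (leq_trans (msize_hop _ _)) //=.
    by apply: leq_trans (msizeZ_le _ _) _.
  rewrite mdeg_mperm => w dw; rewrite mevalZ mevalB mevalZ hop_sp // !hp ?mdeg_mperm //.
  rewrite (can2_eq (@cswapK n r) (@cswapK n r)).
  have [->|wu] := eqVneq w u.
    by rewrite [u == _]eq_sym (negbTE hneu) !mulr0 addr0 !mulr1 subrr mulr0.
  have [->|wsu] := eqVneq w (cswap r u); last by rewrite !mulr0 addr0 subrr mulr0.
  by rewrite !mulr0 add0r subr0 mulr1 mulVf // exch_sp_eq0.
Qed.

Definition lagrange u := projT1 (cid (lagrange_exists u)).

Lemma msize_lagrange u : (msize (lagrange u) <= (mdeg u).+1)%N.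
Proof. by case: (projT2 (cid (lagrange_exists u))). Qed.

Lemma lagrange_sp u w : (mdeg w <= mdeg u)%N -> (lagrange u).@[sp w] = (w == u)%:R.
Proof. by case: (projT2 (cid (lagrange_exists u))) => _; apply. Qed.

(** Monomials and grid points of degree at most d have the same index set, so evaluation is a square
    matrix. The Lagrange polynomials provide the triangular product of [triangular_eq0]: existence
    gives uniqueness. *)
Lemma grid_eq0 d p : (msize p <= d.+1)%N ->
  (forall w, (mdeg w <= d)%N -> p.@[sp w] = 0) -> p = 0.
Proof.
move=> sp_p hp; rewrite (mpolywE sp_p) big1 // => m _.
have E (g : {mpoly K[n.+1]}) w : (msize g <= d.+1)%N ->
    g.@[sp w] = \sum_(k : 'X_{1..n.+1 < d.+1}) g@_k * 'X_[k].@[sp w].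
  move=> hg; rewrite {1}(mpolywE hg) linear_sum.
  by apply: eq_bigr => k _; rewrite linearZ.
pose A (u k : 'X_{1..n.+1 < d.+1}) := (lagrange u)@_k.
pose B (k w : 'X_{1..n.+1 < d.+1}) := ('X_[k] : {mpoly K[n.+1]}).@[sp w].
have hAB (u w : 'X_{1..n.+1 < d.+1}) : (mdeg w <= mdeg u)%N -> (\sum_k A u k * B k w == 0) = (w != u).
  move=> uw; rewrite -E; last by apply: leq_trans (msize_lagrange _) _; apply: bmdeg.
  by rewrite lagrange_sp // pnatr_eq0 eqb0.
have -> : p@_m = 0; last by rewrite scale0r.
apply: (triangular_eq0 hAB (c := fun k => p@_k)) => w.
by rewrite -E // hp // -ltnS bmdeg.
Qed.

Lemma grid_eq d p g : (msize p <= d.+1)%N -> (msize g <= d.+1)%N ->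
  (forall w, (mdeg w <= d)%N -> p.@[sp w] = g.@[sp w]) -> p = g.
Proof.
move=> hp hg h; apply/eqP; rewrite -subr_eq0; apply/eqP/(@grid_eq0 d).
  by apply: leq_trans (msizeD_le _ _) _; rewrite msizeN geq_max hp.
by move=> w hw; rewrite mevalB h // subrr.
Qed.

Lemma gridP p g : (forall w, p.@[sp w] = g.@[sp w]) -> p = g.
Proof.
move=> h; apply: (@grid_eq (msize p + msize g)) => //; apply/leqW.
  exact: leq_addr.
exact: leq_addl.
Qed.
End Interpolation.

(** * Raising, lowering and eigenvalue identities *)

Section LagrangeIdentities.
Variables (K : numFieldType) (q t : K) (n : nat).
Hypothesis qt_generic : generic q t.
Implicit Types (u v w : 'X_{1..n.+1}) (p g : {mpoly K[n.+1]}) (x : 'I_n.+1 -> K).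

Local Notation sp := (spectral q t).
Local Notation N := (lagrange qt_generic).
Local Notation hop := (@hop K t n).
Local Notation exch := (@exch K t n).
Local Notation tau := (@tau K q n).
Local Notation tauV := (@tauV K q n).
Local Notation phiop := (@phiop K q n).

Let q_neq0 : q != 0. Proof. by case: qt_generic. Qed.
Let t_neq0 : t != 0. Proof. by case: qt_generic. Qed.

Definition hops (s : seq nat) p : {mpoly K[n.+1]} := foldr hop p s.

Lemma hops_is_linear s : linear (hops s).
Proof. by elim: s => [|r s IH] c p g //=; rewrite IH linearP. Qed.

HB.instance Definition _ s :=
  GRing.isLinear.Build K {mpoly K[n.+1]} {mpoly K[n.+1]} _ (hops s) (hops_is_linear s).

Lemma hops_cons r s p : hops (r :: s) p = hop r (hops s p).
Proof. by []. Qed.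

Lemma hops_cat s1 s2 p : hops (s1 ++ s2) p = hops s1 (hops s2 p).
Proof. exact: foldr_cat. Qed.

Lemma hops_homog s d p : p \is d.-homog -> hops s p \is d.-homog.
Proof. by move=> hp; elim: s => //= r s; apply: hop_homog. Qed.

Lemma msize_hops s p : (msize (hops s p) <= msize p)%N.
Proof. by apply: (msize_linear (L := hops s)) => k g; apply: hops_homog. Qed.

Definition Hop : {mpoly K[n.+1]} -> {mpoly K[n.+1]} := hops (iota 0 n).
HB.instance Definition _ := GRing.Linear.on Hop.
Definition Hrev : {mpoly K[n.+1]} -> {mpoly K[n.+1]} := hops (rev (iota 0 n)).
HB.instance Definition _ := GRing.Linear.on Hrev.

(** The second coefficient is taken at <cswap r u>, because it is the value of [hop r (N u)] there
    that picks up N u at <u>. *)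
Lemma hop_lagrange r u : (r < n)%N ->
  hop r (N u) = (1 - exch r (sp u)) *: N u
                  + exch r (sp (cswap r u)) *: N (cswap r u).
Proof.
move=> rn; apply: (grid_eq qt_generic (d := mdeg u)).
- exact: leq_trans (msize_hop _ _ _) (msize_lagrange _ _).
- apply: leq_trans (msizeD_le _ _) _; rewrite geq_max.
  rewrite !(leq_trans (msizeZ_le _ _)) ?msize_lagrange //.
  by apply: leq_trans (msize_lagrange _ _) _; rewrite mdeg_mperm.
move=> w dw; rewrite hop_sp // mevalD !mevalZ !lagrange_sp ?mdeg_mperm //.
rewrite (can2_eq (@cswapK n r) (@cswapK n r)).
have [->|_] := eqVneq w u; last first.
  by have [->|_] := eqVneq w (cswap r u); rewrite ?mulr0.
by have [<-|_] := eqVneq u (cswap r u); rewrite ?mulr0.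
Qed.

Lemma phiop_lagrange u : phiop (N u) = (q * sp u ord0 - 1) *: N (cshift u).
Proof.
apply: (grid_eq qt_generic (d := mdeg (cshift u))).
- by rewrite mdeg_cshift; apply/msize_phiop/msize_lagrange.
- exact: leq_trans (msizeZ_le _ _) (msize_lagrange _ _).
move=> w dw; rewrite mevalZ lagrange_sp //.
have [w0|/cshiftP[w' ew]] := posnP (w ord_max).
  rewrite phiop_sp0 //; case: eqP => [ew|_]; last by rewrite mulr0.
  by move: w0; rewrite ew cshift_max.
rewrite ew phiop_sp // (inj_eq (@cshift_inj n)) lagrange_sp.
  by case: eqP => [->|_]; rewrite ?mulr0.
by move: dw; rewrite ew !mdeg_cshift ltnS.
Qed.

(** The part of p without X_i has at <w> the value of p at <w> with its i-th entry replaced by 0. It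
    vanishes on the whole grid and is therefore zero. *)
Lemma mpoly_dvdX i p : (forall x, x i = 0 -> p.@[x] = 0) -> exists g, p = 'X_i * g.
Proof.
move=> hp; exists (\sum_(m <- msupp p | m i != 0%N) p@_m *: 'X_[m - U_(i)]).
pose p0 := \sum_(m <- msupp p | ~~ (m i != 0%N)) p@_m *: 'X_[K, m].
have p00 : p0 = 0.
  apply: (gridP qt_generic) => w; rewrite meval0.
  pose x j := if j == i then 0 else sp w j.
  rewrite -(hp x) /x ?eqxx // [in RHS](mpolyE p) (bigID (fun m : 'X_{1..n.+1} => m i != 0%N)) /=.
  rewrite mevalD [X in _ = X + _]linear_sum big1 ?add0r => [|m mi].
    rewrite /p0 !linear_sum; apply: eq_bigr => m /negPn/eqP mi /=.
    rewrite !mevalZ !mevalX; congr (_ * _); apply: eq_bigr => j _.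
    by case: eqP => // ->; rewrite mi !expr0.
  by rewrite /= mevalZ mevalX (bigD1 i) //= eqxx expr0n (negbTE mi) mul0r mulr0.
rewrite {1}[p]mpolyE (bigID (fun m : 'X_{1..n.+1} => m i != 0%N)) /= -/p0 p00 addr0.
rewrite mulr_sumr; apply: eq_bigr => m mi.
by rewrite -scalerAr -mpolyXD addmC submK // lep1mP.
Qed.

Lemma msize_dvdX i p g d : p = 'X_i * g -> (msize p <= d.+1)%N -> (msize g <= d)%N.
Proof.
move=> ->; have [->|g0] := eqVneq g 0; first by rewrite msize0.
have X0 : 'X_i != 0 :> {mpoly K[n.+1]}.
  by apply/eqP => /(congr1 (fun p => msize p)); rewrite msize0 msizeX.
by rewrite msizeM // msizeX mdeg1.
Qed.

(** Where x_k = 0, the divided-difference term of [hop k] disappears and a bare transposition is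
    left; it moves the zero to place k+1, where the next operator meets it. *)
Lemma hops_meval0 k m p x : (k + m)%N = n -> x (inord k) = 0 ->
  (hops (iota k m) p).@[x] =
  p.@[fun i => if (i < k)%N then x i else
               if i == ord_max then x (inord k) else x (ordS i)].
Proof.
elim: m k x => [|m IH] k x.
  rewrite addn0 => -> _ /=; apply: meval_eq => i; case: ltnP => // ni.
  have -> : i = ord_max by apply/val_inj/eqP; rewrite /= eqn_leq ni -ltnS ltn_ord.
  by rewrite eqxx; congr x; apply/val_inj; rewrite /= inordK.
move=> km xk; have kn : (k < n)%N by lia.
have v1 := inord_val kn; have v2 := inordS_val kn.
rewrite /= -/(hops _ _) hop_meval0 // IH ?addSnnS //=; last by rewrite swapr.
apply: meval_eq => i; rewrite /= ltnS swapr.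
case: (ltngtP i k) => [ik|ik|ik].
- by rewrite swapD // -val_eqE /= ?v1 ?v2; lia.
- case: eqP => // /eqP imax; rewrite swapD // -val_eqE; change (val (ordS i)) with (nat_of_ord (ordS i)); rewrite (ordS_lt imax) /= ?v1 ?v2; lia.
have -> : i = inord k by apply/val_inj; rewrite /= v1.
have imax : (inord k : 'I_n.+1) != ord_max by rewrite -val_eqE /= v1; lia.
rewrite swapl (negbTE imax); congr x.
by apply/val_inj; change (val (ordS (inord k : 'I_n.+1))) with (nat_of_ord (ordS (inord k : 'I_n.+1))); rewrite (ordS_lt imax) /= v1 v2.
Qed.

(** The cyclic rotation left by [hops_meval0] differs from [tauV] by the factor q, which multiplies
    x_0 = 0. *)
Lemma Hop_meval0 p x : x ord0 = 0 -> (Hop p).@[x] = (tauV p).@[x].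
Proof.
have e0 : inord 0 = ord0 :> 'I_n.+1 by apply/val_inj; rewrite /= inordK.
move=> x0; rewrite /Hop hops_meval0 ?add0n ?e0 // /tauV scale_substE.
apply: meval_eq => i /=; case: eqP => [->|_]; last by rewrite mul1r.
by rewrite ordS_max x0 mulr0.
Qed.

Lemma hops_sp_eq0 s p d : (forall r, r \in s -> (r < n)%N) ->
  (forall w, (mdeg w < d)%N -> p.@[sp w] = 0) ->
  forall w, (mdeg w < d)%N -> (hops s p).@[sp w] = 0.
Proof.
elim: s => //= r s IH hs hp w dw; rewrite hop_sp ?hs ?mem_head //.
have hs' k : k \in s -> (k < n)%N by move=> ks; apply: hs; rewrite inE ks orbT.
by rewrite !(IH hs' hp) ?mdeg_mperm // !mulr0 addr0.
Qed.

Lemma iota_lt r : r \in iota 0 n -> (r < n)%N.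
Proof. by rewrite mem_iota. Qed.

Lemma rev_iota_lt r : r \in rev (iota 0 n) -> (r < n)%N.
Proof. by rewrite mem_rev mem_iota. Qed.

Lemma lagrange_sp_lt u w : (mdeg w < mdeg u)%N -> (N u).@[sp w] = 0.
Proof.
move=> h; rewrite lagrange_sp 1?ltnW //; case: eqP => // e.
by rewrite e ltnn in h.
Qed.

Lemma Hop_lagrange_dvd u : exists g, [/\ Hop (N u) - tauV (N u) = 'X_ord0 * g,
  (msize g <= mdeg u)%N &
  forall w, (mdeg w < mdeg u)%N -> sp w ord0 * g.@[sp w] = - (cshift w == u)%:R].
Proof.
have [|g eg] := @mpoly_dvdX ord0 (Hop (N u) - tauV (N u)).
  by move=> x x0; rewrite mevalB Hop_meval0 // subrr.
exists g; split=> //.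
  apply: (msize_dvdX eg); apply: leq_trans (msizeD_le _ _) _; rewrite msizeN geq_max.
  rewrite (leq_trans (msize_hops _ _)) ?msize_lagrange //=.
  apply: (leq_trans _ (msize_lagrange qt_generic u)); apply: (msize_linear (L := tauV)) => k f.
  exact: tauV_homog.
move=> w dw; have := congr1 (meval (sp w)) eg; rewrite mevalB mevalM mevalXU => <-.
rewrite (hops_sp_eq0 iota_lt (@lagrange_sp_lt u)) // tauV_sp lagrange_sp ?mdeg_cshift //.
by rewrite sub0r.
Qed.

Lemma Hop_lagrange_cshift v : Hop (N (cshift v)) - tauV (N (cshift v)) =
  - (sp v ord0)^-1 *: ('X_ord0 * N v).
Proof.
have [g [-> sg hg]] := Hop_lagrange_dvd (cshift v).
rewrite scalerAr; congr (_ * _); rewrite mdeg_cshift in sg hg.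
apply: (grid_eq qt_generic sg); first exact: leq_trans (msizeZ_le _ _) (msize_lagrange _ _).
move=> w dw; apply: (mulfI (sp_neq0 qt_generic w ord0)).
rewrite hg // mevalZ lagrange_sp // (inj_eq (@cshift_inj n)).
case: eqP => [->|_]; last by rewrite !mulr0 oppr0.
by rewrite mulr1 mulrN mulfV // sp_neq0.
Qed.

Lemma Hop_lagrange_max0 u : u ord_max = 0%N -> Hop (N u) = tauV (N u).
Proof.
move=> u0; have [g [eg sg hg]] := Hop_lagrange_dvd u.
apply/eqP; rewrite -subr_eq0 eg; suff -> : g = 0 by rewrite mulr0.
case d : (mdeg u) sg hg => [|d'] sg hg.
  by apply/eqP; rewrite -msize_poly_eq0 -leqn0.
apply: (grid_eq0 qt_generic sg) => w dw; apply: (mulfI (sp_neq0 qt_generic w ord0)).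
rewrite mulr0 hg //; case: eqP => [ew|_]; last by rewrite oppr0.
by move: u0; rewrite -ew cshift_max.
Qed.

(** An inhomogeneous Cherednik eigenvalue equation. On x_n = 0 the first factor of [phiop] is -1 and
    [Hop] followed by [tau] preserves values, so N u + phiop (Hop (N u)) is divisible by X_n. The
    quotient has degree at most |u|, and on the grid up to that degree it is nonzero at <u> only. *)
Lemma lagrange_eigen u :
  (sp u ord_max)^-1 *: ('X_ord_max * N u) - N u = phiop (Hop (N u)).
Proof.
have [|g eg] := @mpoly_dvdX ord_max (N u + phiop (Hop (N u))).
  move=> x x0; rewrite mevalD /phiop mevalM mevalB mevalXU meval1 x0 sub0r mulN1r.
  rewrite /tau scale_substE Hop_meval0; last by rewrite eqxx ord_pred0 x0 mulr0.
  rewrite /tauV scale_substE; apply/eqP; rewrite subr_eq0; apply/eqP/meval_eq => i.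
  rewrite ordSK ordS_eq0; case: ifP => _; rewrite ?mul1r //.
  by rewrite mulVKf.
apply/eqP; rewrite subr_eq addrC eg scalerAr; apply/eqP; congr (_ * _).
apply/esym; apply: (grid_eq qt_generic (d := mdeg u)).
- apply: (msize_dvdX eg); apply: leq_trans (msizeD_le _ _) _; rewrite geq_max.
  rewrite (leq_trans (msize_lagrange _ _)) //=; apply: msize_phiop.
  exact: leq_trans (msize_hops _ _) (msize_lagrange _ _).
- exact: leq_trans (msizeZ_le _ _) (msize_lagrange _ _).
move=> w dw; rewrite mevalZ; apply: (mulfI (sp_neq0 qt_generic w ord_max)).
have /esym := congr1 (meval (sp w)) eg; rewrite mevalM mevalXU mevalD => ->.
(* At <cshift w'> this is a multiple of the value of [Hop (N u)] at <w'>, which has degree below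
   |u|. *)
have -> : (phiop (Hop (N u))).@[sp w] = 0.
  have [w0|/cshiftP[w' ew]] := posnP (w ord_max); first by rewrite phiop_sp0.
  rewrite ew phiop_sp // (hops_sp_eq0 iota_lt (@lagrange_sp_lt u)) ?mulr0 //.
  by rewrite -mdeg_cshift -ew.
rewrite addr0 mulrCA lagrange_sp //; case: eqP => [->|_]; last by rewrite !mulr0.
by rewrite mulr1 mulVf // sp_neq0.
Qed.

Lemma lagrange_mdeg0 : N (0%MM : 'X_{1..n.+1}) = 1.
Proof.
apply: (grid_eq qt_generic (d := 0%N)); rewrite ?msize1 //.
  by apply: leq_trans (msize_lagrange _ _) _; rewrite mdeg0.
move=> w; rewrite leqn0 mdeg_eq0 => /eqP ->.
by rewrite meval1 lagrange_sp // eqxx.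
Qed.

Definition topM u : {mpoly K[n.+1]} := pihomog mdeg (mdeg u) (N u).

Lemma topM_homog u : topM u \is (mdeg u).-homog. Proof. exact: pihomogP. Qed.

Lemma topM_mdeg0 : topM 0%MM = 1.
Proof. by rewrite /topM mdeg0 lagrange_mdeg0 (pihomog_dE (dhomog1 _ _)). Qed.

Lemma hop_topM r u : (r < n)%N ->
  hop r (topM u) = (1 - exch r (sp u)) *: topM u
                  + exch r (sp (cswap r u)) *: topM (cswap r u).
Proof.
move=> rn; rewrite /topM mdeg_mperm -(pihomog_linear (L := hop r)).
  by rewrite /= hop_lagrange // linearD !linearZ.
by move=> d p; apply: hop_homog.
Qed.

Lemma pihomog_phiop d p : (msize p <= d.+1)%N ->
  pihomog mdeg d.+1 (phiop p) = 'X_ord_max * tau (pihomog mdeg d p).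
Proof.
move=> sp_p; rewrite /phiop mulrBl mul1r linearB /= pihomogXM.
rewrite !(pihomog_linear (L := tau)) => [|k g|k g]; try exact: tau_homog.
by rewrite [pihomog mdeg d.+1 p](msize_pihomogP _ _ sp_p) //= linear0 subr0.
Qed.

Lemma tau_topM u : 'X_ord_max * tau (topM u) = (q * sp u ord0 - 1) *: topM (cshift u).
Proof.
by rewrite /topM mdeg_cshift -pihomog_phiop ?msize_lagrange // phiop_lagrange linearZ.
Qed.

Lemma Hop_topM_cshift v : Hop (topM (cshift v)) - tauV (topM (cshift v)) =
  - (sp v ord0)^-1 *: ('X_ord0 * topM v).
Proof.
rewrite /topM mdeg_cshift -pihomogXM -linearZ -Hop_lagrange_cshift linearB /=.
by rewrite !(pihomog_linear (L := Hop)) ?(pihomog_linear (L := tauV)) //;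
  move=> k g; [apply: tauV_homog|apply: hops_homog].
Qed.

Lemma Hop_topM_max0 u : u ord_max = 0%N -> Hop (topM u) = tauV (topM u).
Proof.
move=> /Hop_lagrange_max0 h.
rewrite /topM -(pihomog_linear (L := Hop)) => [|k g]; last exact: hops_homog.
by rewrite /= h (pihomog_linear (L := tauV)) // => k g; apply: tauV_homog.
Qed.

Lemma mpolyX_neq0 i : 'X_i != 0 :> {mpoly K[n.+1]}.
Proof. by apply/eqP => /(congr1 (fun p => msize p)); rewrite msize0 msizeX. Qed.

(** The component of degree |u| + 1 of [lagrange_eigen]; the subtracted N u does not reach that
    degree. *)
Lemma topM_eigen u : tau (Hop (topM u)) = (sp u ord_max)^-1 *: topM u.
Proof.
apply: (mulfI (mpolyX_neq0 ord_max)); rewrite /topM.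
rewrite -(pihomog_linear (L := Hop)) => [|k g]; last exact: hops_homog.
rewrite -pihomog_phiop; last exact: leq_trans (msize_hops _ _) (msize_lagrange _ _).
rewrite -lagrange_eigen linearB linearZ /= pihomogXM.
by rewrite (msize_pihomogP _ _ (msize_lagrange qt_generic u) _ (leqnn _)) subr0 scalerAr.
Qed.

(** The affine Hecke relation between [hop] and multiplication by variables. It also yields the
    injectivity of [hop]. *)
Lemma hop_mulX_hop r p : (r < n)%N ->
  hop r ('X_(inord r.+1) * hop r p) = t^-1 *: ('X_(inord r) * p).
Proof.
move=> rn; apply: (gridP qt_generic) => w.
have h1 := sp_neq qt_generic w rn.
have h2 : (sp w \o swap n r) (inord r) != (sp w \o swap n r) (inord r.+1).
  by rewrite /= swapl swapr eq_sym.
rewrite (hop_meval qt_generic) // !mevalM !mevalXU !(hop_meval qt_generic) // !mevalZ mevalM mevalXU.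
rewrite /exch /= swapl swapr.
have -> : p.@[(sp w \o swap n r) \o swap n r] = p.@[sp w].
  by apply: meval_eq => i /=; rewrite swapK.
set a := sp w _ in h1 *; set b := sp w _ in h1 *.
by field; rewrite !subr_eq0 (eq_sym b) h1 t_neq0.
Qed.

Lemma hops_mulX_hops k m p : (k + m)%N = n ->
  hops (iota k m) ('X_ord_max * hops (rev (iota k m)) p) = t ^- m *: ('X_(inord k) * p).
Proof.
elim: m k p => [|m IH] k p km.
  rewrite /= expr0 invr1 scale1r; congr ('X__ * _).
  by apply/val_inj; rewrite /= inordK; lia.
have kn : (k < n)%N by lia.
rewrite [iota _ _]/= rev_cons -cats1 hops_cat !hops_cons.
by rewrite IH ?addSnnS // linearZ /= hop_mulX_hop // scalerA exprS invfM mulrC.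
Qed.

Lemma hop_eq0 r p : (r < n)%N -> hop r p = 0 -> p = 0.
Proof.
move=> rn h; have := hop_mulX_hop p rn; rewrite h mulr0 linear0 => /esym/eqP.
rewrite scaler_eq0 invr_eq0 (negbTE t_neq0) mulf_eq0 (negbTE (mpolyX_neq0 _)).
by move/eqP.
Qed.

Lemma Hop_eq0 p : Hop p = 0 -> p = 0.
Proof.
rewrite /Hop; elim: (iota 0 n) iota_lt => //= r s IH hs /(hop_eq0 (hs _ (mem_head _ _))).
by apply: IH => k ks; apply: hs; rewrite inE ks orbT.
Qed.

Lemma tauK p : tauV (tau p) = p.
Proof. by apply: (gridP qt_generic) => w; rewrite tauV_sp tau_sp. Qed.

Lemma tauV_inj p g : tauV p = tauV g -> p = g.
Proof.
move=> h; apply: (gridP qt_generic) => w.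
have E f : f.@[sp w] = (tauV f).@[fun i => (if i == ord0 then q^-1 else 1) * sp w (ord_pred i)].
  rewrite /tauV scale_substE; apply: meval_eq => i; rewrite ordS_eq0 ordSK.
  by case: ifP => _; rewrite ?mul1r // mulVKf.
by rewrite E h -E.
Qed.

(** The Cherednik operator belonging to the first spectral entry. Raising and then lowering shows
    that [Hop] sends X_n tau(topM u) to <u>_0^-1 X_0 topM u; by the Hecke relation it sends X_n
    Hrev(topM u) to t^-n X_0 topM u. Cancelling [Hop] and X_n compares [tau] with [Hrev]. *)
Lemma tauV_Hrev_topM u : tauV (Hrev (topM u)) = (t ^- n * sp u ord0) *: topM u.
Proof.
have u0 := sp_neq0 qt_generic u ord0.
have tauVX : tauV 'X_ord_max = q *: 'X_ord0.
  by apply: (gridP qt_generic) => w; rewrite tauV_sp mevalZ !mevalXU sp_cshift_max.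
have h1 : Hop ('X_ord_max * tau (topM u)) = (sp u ord0)^-1 *: ('X_ord0 * topM u).
  rewrite tau_topM linearZ /=.
  have -> : Hop (topM (cshift u)) = tauV (topM (cshift u))
      - (sp u ord0)^-1 *: ('X_ord0 * topM u).
    by rewrite -scaleNr -Hop_topM_cshift addrC subrK.
  rewrite scalerBr -linearZ -tau_topM rmorphM /= tauVX tauK scalerA -scalerAl -scalerBl.
  by congr (_ *: _); rewrite mulrBl mul1r mulfK // subKr.
have h2 := @hops_mulX_hops 0 n (topM u) (add0n n); rewrite -/Hop -/Hrev in h2.
have e0 : inord 0 = ord0 :> 'I_n.+1 by apply/val_inj; rewrite /= inordK.
rewrite e0 in h2.
have h3 : sp u ord0 *: tau (topM u) = t ^+ n *: Hrev (topM u).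
  apply/eqP; rewrite -subr_eq0; apply/eqP.
  apply: (mulfI (mpolyX_neq0 ord_max)); rewrite mulr0; apply: Hop_eq0.
  rewrite mulrBr -!scalerAr linearB !linearZ /= h1 h2 !(scalerN, scalerA) mulfV // mulfV ?subrr //.
  by rewrite expf_neq0.
by rewrite -[Hrev _](scalerK (expf_neq0 n t_neq0)) -h3 scalerA linearZ /= tauK.
Qed.

End LagrangeIdentities.

(** * The normalisation of M_u *)

Section LegLengths.
Variable n : nat.
Implicit Types (u v w : 'X_{1..n.+1}) (i j k : 'I_n.+1).

Lemma legE u i c : leg u i c =
  (\sum_(k < n.+1) (((i < k) && (c <= u k <= u i)) || ((k < i) && (c <= (u k).+1 <= u i))))%N.
Proof.
rewrite /leg -!sum1_card [X in (X + _)%N]big_mkcond.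
rewrite [X in (_ + X)%N]big_mkcond -big_split /=; apply: eq_bigr => k _.
by rewrite !inE; case: (ltngtP i k) => //= _; case: ifP.
Qed.

Lemma leg_cshift u i c : i != ord_max -> leg (cshift u) i c = leg u (ordS i) c.
Proof.
move=> hi; rewrite !legE.
rewrite -(big_ordS _ (fun k : 'I_n.+1 => (((ordS i < k) && (c <= u k <= u (ordS i)))
  || ((k < ordS i) && (c <= (u k).+1 <= u (ordS i))) : nat)%N)).
apply: eq_bigr => k _; rewrite !cshiftE (negbTE hi) addn0 (ordS_lt hi); congr nat_of_bool.
case: (eqVneq k ord_max) => [->|hk]; last by rewrite (ordS_lt hk) addn0 !ltnS.
rewrite ordS_max addn1 ltn0 /=.
have -> : (i < n)%N by move: hi (ltn_ord i); rewrite -val_eqE /=; lia.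
have -> : (n < i)%N = false by move: (ltn_ord i); lia.
by rewrite orbF.
Qed.

Lemma leg_cshift_max u c : leg (cshift u) ord_max c.+1 =
  (\sum_(k < n.+1) (((ord0 : 'I_n.+1) < k) && (c <= u k <= u ord0)))%N.
Proof.
rewrite legE -(big_ordS _ (fun k : 'I_n.+1 => (((ord0 : 'I_n.+1) < k) && (c <= u k <= u ord0) : nat)%N)).
apply: eq_bigr => k _; rewrite !cshift_max cshiftE; congr nat_of_bool.
case: (eqVneq k ord_max) => [->|hk]; first by rewrite ordS_max !ltnn.
rewrite (ordS_lt hk) addn0 !ltnS.
have -> : ((ord_max : 'I_n.+1) < k)%N = false by move: (ltn_ord k) => /=; lia.
by have -> : (k < (ord_max : 'I_n.+1))%N by move: hk (ltn_ord k); rewrite -val_eqE /=; lia.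
Qed.

Lemma leg_cshift_maxS u c : leg (cshift u) ord_max c.+1 = leg u ord0 c.
Proof.
by rewrite leg_cshift_max legE; apply: eq_bigr => k _; rewrite ltn0 orbF.
Qed.

Lemma leg_cshift_max1 u : leg (cshift u) ord_max 1 = spec_exp u ord0.
Proof.
rewrite leg_cshift_max spec_expE; apply: eq_bigr => k _; congr nat_of_bool.
case: (posnP k) => [k0|k0]; last by rewrite /= leq_eqVlt orbC.
have -> : k = ord0 by apply/val_inj.
by rewrite ltnn.
Qed.

(** The rows rotate; the row that becomes last gets a new first box, its old boxes moving one column
    to the right with arms and legs unchanged. The new box has arm u_0 and leg [spec_exp u ord0],
    hence contributes 1 - q<u>_0 to c'. *)
Lemma big_diagram_cshift (R : Type) (idx : R) (op : Monoid.com_law idx) u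
    (F G : 'I_n.+1 -> nat -> R) :
  (forall i c, i != ord_max -> (0 < c <= u (ordS i))%N -> F i c = G (ordS i) c) ->
  (forall c, (0 < c <= u ord0)%N -> F ord_max c.+1 = G ord0 c) ->
  \big[op/idx]_i \big[op/idx]_(1 <= c < (cshift u i).+1) F i c =
  op (F ord_max 1%N) (\big[op/idx]_i \big[op/idx]_(1 <= c < (u i).+1) G i c).
Proof.
move=> h1 h2; rewrite -(big_ordS _ (fun i => \big[op/idx]_(1 <= c < (u i).+1) G i c)).
rewrite (bigD1 ord_max) //= [in RHS](bigD1 ord_max) //= Monoid.mulmA; congr (op _ _).
  rewrite cshift_max ordS_max big_ltn // big_add1 /=; congr (op _ _).
  by rewrite big_nat_cond [RHS]big_nat_cond; apply: eq_bigr => c /andP[hc _]; apply: h2.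
apply: eq_bigr => i hi; rewrite cshiftE (negbTE hi) addn0 big_nat_cond [RHS]big_nat_cond.
by apply: eq_bigr => c /andP[hc _]; apply: h1.
Qed.

Section Swap.
Variables (u : 'X_{1..n.+1}) (r : nat).
Hypotheses (rn : (r < n)%N) (ur : u (inord r) = 0%N) (ur1 : (0 < u (inord r.+1))%N).
Hypothesis u_after : forall k, (r.+1 < k)%N -> u k = 0%N.

Let v1 := inord_val rn.
Let v2 := inordS_val rn.

Lemma leg_cswap i c : (0 < c <= cswap r u i)%N -> i != inord r ->
  leg (cswap r u) i c = leg u (swap n r i) c.
Proof.
move=> hc ir; have ir1 : i != inord r.+1.
  by apply: contraTneq hc => ->; rewrite cswapE swapr ur; lia.
have ilr : (i < r)%N.
  move: ir ir1; rewrite -!val_eqE /= v1 v2 => h1 h2.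
  case: (ltnP r.+1 i) => [h|]; last by lia.
  by move: hc; rewrite cswapE swapD ?u_after // -?val_eqE /= ?v1 ?v2; lia.
rewrite !legE [RHS](reindex_inj (@perm_inj _ (swap n r))) /=; apply: eq_bigr => k _.
rewrite !cswapE (swapD ir ir1); congr (nat_of_bool ((_ && _) || (_ && _))).
  case: (eqVneq k (inord r)) => [->|g1]; first by rewrite swapl v1 v2; lia.
  case: (eqVneq k (inord r.+1)) => [->|g2]; first by rewrite swapr v1 v2; lia.
  by rewrite swapD.
case: (eqVneq k (inord r)) => [->|g1]; first by rewrite swapl v1 v2; lia.
case: (eqVneq k (inord r.+1)) => [->|g2]; first by rewrite swapr v1 v2; lia.
by rewrite swapD.
Qed.

(** The empty row r lies before row r+1 and is counted when c <= 0 + 1, that is for c = 1 only.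
    After the swap the empty row comes later and is never counted. *)
Lemma leg_cswap_row c : (0 < c)%N ->
  leg u (inord r.+1) c = (leg (cswap r u) (inord r) c + (c == 1%N))%N.
Proof.
move=> c0; rewrite !legE (bigD1 (inord r)) //= [in RHS](bigD1 (inord r)) //=.
rewrite v1 v2 ltnn ltnSn cswapE swapl ur ltnNge leqnSn /= add0n addnC; congr (_ + _)%N; last first.
  by congr nat_of_bool; lia.
apply: eq_bigr => k; rewrite -val_eqE /= v1 => kr; congr nat_of_bool; rewrite cswapE.
case: (eqVneq k (inord r.+1)) => [->|g2]; first by rewrite swapr v2 ur; lia.
rewrite swapD // -?val_eqE /= ?v1 //.
case: (ltnP r.+1 k) => [h|h]; first by rewrite u_after //; lia.
by move: g2; rewrite -val_eqE /= v2; lia.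
Qed.

(** It lets the ratio of the entries r+1 and r of <u> be read from the row length and the leg of the
    first box of row r+1. *)
Lemma spec_exp_leg :
  spec_exp u (inord r.+1) = (spec_exp u (inord r) + leg u (inord r.+1) 1)%N.
Proof.
rewrite !spec_expE legE -big_split; apply: eq_bigr => k _ /=.
rewrite v1 v2 ur ltn0 /=.
case: (eqVneq k (inord r.+1)) => [->|g2]; first by rewrite v2; lia.
case: (ltnP r.+1 k) => [h|h]; first by rewrite u_after //; lia.
by move: g2; rewrite -val_eqE /= v2; lia.
Qed.

Lemma big_diagram_cswap (R : Type) (idx : R) (op : Monoid.com_law idx)
    (F G : 'I_n.+1 -> nat -> R) :
  (forall i c, i != inord r -> (0 < c <= cswap r u i)%N -> F i c = G (swap n r i) c) ->
  (forall c, (1 < c)%N -> F (inord r) c = G (inord r.+1) c) ->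
  op (G (inord r.+1) 1%N)
     (\big[op/idx]_i \big[op/idx]_(1 <= c < (cswap r u i).+1) F i c) =
  op (F (inord r) 1%N) (\big[op/idx]_i \big[op/idx]_(1 <= c < (u i).+1) G i c).
Proof.
move=> h1 h2; rewrite [in RHS](reindex_inj (@perm_inj _ (swap n r))) /=.
rewrite (bigD1 (inord r)) //= [in RHS](bigD1 (inord r)) //= cswapE swapl.
rewrite big_ltn // [in RHS]big_ltn // !Monoid.mulmA.
congr (op (op _ _) _); first exact: Monoid.mulmC.
  by rewrite !big_nat; apply: eq_bigr => c /andP[hc _]; apply: h2.
apply: eq_bigr => i hi; rewrite cswapE !big_nat; apply: eq_bigr => c hc.
by apply: h1 => //; rewrite cswapE -ltnS.
Qed.

End Swap.
End LegLengths.

Section FieldIdentities.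
Variable K : fieldType.
Implicit Types q t Q T S c m X Y : K.

(** In [mcoeff_lagrange], Q = q^u_0, T = t^k_0, S = t^n(u), c = c'_u and m = [mu u]. In
    [cswap_ratio], X t is the ratio of the entries r+1 and r of <u>, Y is the entry r, and S belongs
    to the swapped composition. *)
Fact cshift_ratio q Q T S c m : Q != 0 -> c != 0 -> m != 0 -> q * (Q * T) - 1 != 0 ->
  (q * (Q * T) - 1)^-1 * (Q^-1 * (S / c / m)) * (- (Q * T) * m)
  = T * S / ((1 - q * (Q * T)) * c).
Proof.
move=> Q0 c0 m0 h; have h' : 1 - q * (Q * T) != 0 by rewrite -oppr_eq0 opprB.
by field; rewrite Q0 c0 m0 h h'.
Qed.

Fact cswap_ratio t S c m X Y : t != 0 -> c != 0 -> m != 0 -> Y != 0 ->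
    1 - X != 0 -> 1 - X * t != 0 ->
  ((Y * (X * t) - t * Y) / (t * (Y * (X * t) - Y)))^-1 * (t^-1 * (t * S / c / m)) * m
  = S / ((1 - X) * c / (1 - X * t)).
Proof.
move=> t0 c0 m0 Y0 h1 h2; have h3 : X * t - 1 != 0 by rewrite -oppr_eq0 opprB.
have h4 : X - 1 != 0 by rewrite -oppr_eq0 opprB.
have -> : Y * (X * t) - t * Y = t * Y * (X - 1) by ring.
have -> : Y * (X * t) - Y = Y * (X * t - 1) by ring.
by field; rewrite t0 c0 m0 Y0 h1 h2 h3 h4.
Qed.

End FieldIdentities.

Section Normalisation.
Variables (K : numFieldType) (q t : K) (n : nat).
Hypothesis qt_generic : generic q t.
Implicit Types (u v w m : 'X_{1..n.+1}) (p g : {mpoly K[n.+1]}).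

Local Notation sp := (spectral q t).
Local Notation N := (lagrange qt_generic).
Local Notation hop := (@hop K t n).
Local Notation exch := (@exch K t n).
Local Notation tau := (@tau K q n).
Local Notation phiop := (@phiop K q n).

Let q_neq0 : q != 0. Proof. by case: qt_generic. Qed.
Let t_neq0 : t != 0. Proof. by case: qt_generic. Qed.

Lemma mcoeffXM i p m : ('X_i * p)@_(m + U_(i)) = p@_m.
Proof. by rewrite mulrC addmC mcoeffMX. Qed.

Lemma mcoeffXM0 i p m : m i = 0%N -> ('X_i * p)@_m = 0.
Proof.
move=> mi; rewrite (mpolyE p) mulr_sumr raddf_sum big1 // => k _ /=.
rewrite -scalerAr mcoeffZ -mpolyXD mcoeffX; case: eqP => [e|]; last by rewrite mulr0.
by move: mi; rewrite -e mnmDE mnm1E eqxx.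
Qed.

Lemma mcoeff_msize p m : (msize p <= mdeg m)%N -> p@_m = 0.
Proof. by move=> /msize_mdeg_ge; apply: memN_msupp_eq0. Qed.

Let rot m : 'X_{1..n.+1} := [multinom m (ordS i) | i < n.+1].

Lemma mcoeff_tau p m : (tau p)@_(rot m) = q ^- m ord0 * p@_m.
Proof.
elim/mpolyind: p => [|c k p _ _ IH]; first by rewrite linear0 !mcoeff0 mulr0.
rewrite linearP /= !mcoeffD !mcoeffZ IH mulrDr mulrCA; congr (_ * _ + _).
rewrite /tau /scale_subst /= comp_mpolyX.
under eq_bigr do rewrite tnth_mktuple exprZn.
rewrite scaler_prod mcoeffZ (bigD1 ord0) //= big1 ?mulr1 => [|i /negbTE ->]; last first.
  by rewrite expr1n.
have -> : \prod_i 'X_(ord_pred i) ^+ k i = 'X_[rot k] :> {mpoly K[n.+1]}.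
  rewrite mpolyXE_id -(big_ordS _ (fun i => 'X_(ord_pred i) ^+ k i)).
  by apply: eq_bigr => i _; rewrite ordSK mnmE.
rewrite exprVn mcoeffX; have rot_inj : injective rot.
  move=> a b /mnmP h; apply/mnmP => i.
  by move: (h (ord_pred i)); rewrite !mnmE ord_predK.
rewrite (inj_eq rot_inj) mcoeffX; case: eqP => [->//|_].
by rewrite !mulr0.
Qed.

Lemma cshift_rot u : cshift u = (rot u + U_(ord_max))%MM.
Proof. by apply/mnmP => i; rewrite cshiftE mnmDE mnmE mnm1E eq_sym. Qed.

Lemma lagrange_cshift u :
  N (cshift u) = (q * sp u ord0 - 1)^-1 *: phiop (N u).
Proof. by rewrite phiop_lagrange scalerA mulVf ?scale1r // q_sp_neq1. Qed.

Lemma lagrange_cswap u r : (r < n)%N -> u (inord r) != u (inord r.+1) ->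
  N (cswap r u) = (exch r (sp (cswap r u)))^-1 *:
                  (hop r (N u) - (1 - exch r (sp u)) *: N u).
Proof.
move=> rn hu; rewrite hop_lagrange // addrC addKr scalerA mulVf ?scale1r //.
by rewrite exch_sp_eq0 // !cswapE swapl swapr eq_sym.
Qed.

Lemma msize_tau p : (msize (tau p) <= msize p)%N.
Proof. by apply: (msize_linear (L := tau)) => k g; apply: tau_homog. Qed.

Lemma mcoeff_lagrange_cshift u :
  (N (cshift u))@_(cshift u) = (q * sp u ord0 - 1)^-1 * (q ^- u ord0 * (N u)@_u).
Proof.
rewrite lagrange_cshift mcoeffZ /phiop mulrBl mul1r mcoeffB.
rewrite (_ : (tau (N u))@_(cshift u) = 0) ?subr0; last first.
  apply: mcoeff_msize; rewrite mdeg_cshift.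
  exact: leq_trans (msize_tau _) (msize_lagrange _ _).
by rewrite cshift_rot mcoeffXM mcoeff_tau.
Qed.

Lemma hop_mcoeff0 r p m : m (inord r) = 0%N -> (hop r p)@_m = p@_(cswap r m).
Proof.
by move=> h; rewrite /hop mcoeffD mcoeffZ mcoeffXM0 // mulr0 addr0 mcoeff_sym.
Qed.

(** As m is free of x_{r+1}, the coefficient of x^m in X_r times the divided difference is the one
    in (X_r - X_{r+1}) times it, which is known. *)
Lemma hop_mcoeff0S r p m : (r < n)%N -> m (inord r.+1) = 0%N ->
  (hop r p)@_m = t^-1 * p@_(cswap r m) - (t^-1 - 1) * p@_m.
Proof.
move=> rn h; have := congr1 (mcoeff m) (divdiffE p rn).
rewrite mulrBl !mcoeffB [X in _ - X]mcoeffXM0 // subr0 mcoeff_sym => e.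
rewrite /hop mcoeffD mcoeffZ e mcoeff_sym -/(cswap r m).
by set a := _@_(cswap _ _); set b := p@_m; ring.
Qed.

(** The fragment of triangularity that the leading coefficient needs: it makes the coefficient of
    x^(cswap r u) in N u zero. In the swap step m vanishes at r and r+1, so [hop] does not change
    its coefficient. *)
Lemma lagrange_mcoeff_eq0 u j m : (0 < u j)%N -> (forall k : 'I_n.+1, (j < k)%N -> u k = 0%N) ->
  mdeg m = mdeg u -> (forall k : 'I_n.+1, (j <= k)%N -> m k = 0%N) -> (N u)@_m = 0.
Proof.
elim/comp_ind: u j m => [|u IH|u r rn ur ur1 u_after IH] j m uj ulast dm mj.
- by rewrite mnm0E in uj.
- have ej : j = ord_max.
    case: (eqVneq j ord_max) => // hj; have := ulast ord_max.
    by rewrite cshift_max => h; suff : (u ord0).+1 = 0%N by []; apply: h;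
      move: hj (ltn_ord j); rewrite -val_eqE /=; lia.
  rewrite lagrange_cshift mcoeffZ /phiop mulrBl mul1r mcoeffB mcoeffXM0; last first.
    by apply: mj; rewrite ej.
  rewrite (@mcoeff_msize (tau _)) ?subr0 ?mulr0 // dm mdeg_cshift.
  exact: leq_trans (msize_tau _) (msize_lagrange _ _).
- have v1 := inord_val rn; have v2 := inordS_val rn.
  have ej : (j <= r)%N.
    case: (ltnP r j) => // rj; move: uj; rewrite cswapE.
    case: (eqVneq j (inord r.+1)) => [->|j1]; first by rewrite swapr ur.
    rewrite swapD // -?val_eqE /= ?v1; last by lia.
    by rewrite u_after //; move: j1; rewrite -val_eqE /= v2; lia.
  have mr : m (inord r) = 0%N by apply: mj; rewrite v1.
  have mr1 : m (inord r.+1) = 0%N by apply: mj; rewrite v2; lia.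
  have m0 : (N u)@_m = 0.
    apply: (IH (inord r.+1)) => // [k||k]; rewrite ?v2 //.
    - exact: u_after.
    - by rewrite dm mdeg_mperm.
    - by move=> hk; apply: mj; lia.
  rewrite lagrange_cswap //; last by rewrite ur eq_sym -lt0n.
  by rewrite mcoeffZ mcoeffB mcoeffZ hop_mcoeff0 // (@cswap_id _ _ m) ?mr ?mr1 // m0 !mulr0 subr0 mulr0.
Qed.

(* The factor relating nM u to the polynomial of the same degree which takes the
   value 1 at <u>; unlike t^(n(u)) / c'_u it is invariant under transpositions. *)
Definition mu u : K :=
  \prod_i ((-1) ^+ u i * q ^+ 'C(u i, 2) * t ^+ (spec_exp u i * u i)).

Lemma mu_mdeg0 : mu 0%MM = 1.
Proof. by rewrite /mu big1 // => i _; rewrite mnm0E muln0 !expr0 !mulr1. Qed.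

Lemma mu_neq0 u : mu u != 0.
Proof.
by apply/prodf_neq0 => i _; rewrite !mulf_neq0 ?expf_neq0 // oppr_eq0 oner_eq0.
Qed.

Lemma mu_cshift u : mu (cshift u) = - sp u ord0 * mu u.
Proof.
rewrite /mu -[in RHS](big_ordS _ (fun i => (-1) ^+ u i * q ^+ 'C(u i, 2) * t ^+ (spec_exp u i * u i))).
rewrite (bigD1 ord_max) //= [in RHS](bigD1 ord_max) //= mulrA; congr (_ * _); last first.
  apply: eq_bigr => i hi.
  by rewrite cshiftE spec_exp_cshift (negbTE hi) addn0.
rewrite cshift_max spec_exp_cshift ordS_max /spectral mulnS binS bin1 !exprD exprS.
by rewrite mulNr mul1r; ring.
Qed.

Lemma mu_cswap u r : (r < n)%N -> mu (cswap r u) = mu u.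
Proof.
move=> rn; have [e|ne] := eqVneq (u (inord r)) (u (inord r.+1)); first by rewrite cswap_id.
rewrite /mu [RHS](reindex_inj (@perm_inj _ (swap n r))) /=; apply: eq_bigr => i _.
by rewrite cswapE spec_exp_swap.
Qed.

Lemma cprime_neq0 u : cprime q t u != 0.
Proof.
apply/prodf_neq0 => i _; rewrite prodf_seq_neq0; apply/allP => c _ /=.
rewrite subr_eq0; apply/eqP => e.
have e' : q ^+ 0 * t ^+ 0 = q ^+ (u i - c).+1 * t ^+ leg u i c by rewrite !expr0 mulr1.
by have [] := generic_exp qt_generic e'.
Qed.

(** Under a swap as in [comp_ind], c' is multiplied by (1 - X)/(1 - Xt), which is the value of
    [exch] at <cswap r u>, and n(u) drops by one, which is the t^-1 of [hop_mcoeff0S]. So both sides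
    change alike. *)
Lemma mcoeff_lagrange u : (N u)@_u * mu u = t ^+ stat_n u / cprime q t u.
Proof.
elim/comp_ind: u => [|u IH|u r rn ur ur1 u_after IH].
- rewrite lagrange_mdeg0.
  rewrite mcoeff1 eqxx mul1r mu_mdeg0.
  rewrite /stat_n big1 => [|i _]; last by rewrite mnm0E big_nil.
  rewrite /cprime big1 => [|i _]; last by rewrite mnm0E big_nil.
  by rewrite expr0 invr1 mulr1.
- have -> : cprime q t (cshift u) = (1 - q * sp u ord0) * cprime q t u.
    rewrite /cprime (big_diagram_cshift _ (G := fun i c => 1 - q ^+ (u i - c).+1 * t ^+ leg u i c)).
    - rewrite leg_cshift_max1 cshift_max subSS subn0 /spectral.
      by rewrite [in RHS]mulrA -exprS.
    - by move=> i c hi _; rewrite leg_cshift // cshiftE (negbTE hi) addn0.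
    - by move=> c _; rewrite leg_cshift_maxS cshift_max subSS.
  have -> : stat_n (cshift u) = (spec_exp u ord0 + stat_n u)%N.
    rewrite /stat_n (big_diagram_cshift _ (G := leg u)).
    - by rewrite leg_cshift_max1.
    - by move=> i c hi _; rewrite leg_cshift.
    - by move=> c _; rewrite leg_cshift_maxS.
  rewrite mcoeff_lagrange_cshift mu_cshift exprD.
  have h := q_sp_neq1 qt_generic u ord0; have c0 := cprime_neq0 u.
  have -> : (N u)@_u = t ^+ stat_n u / cprime q t u / mu u by rewrite -IH mulfK // mu_neq0.
  exact: cshift_ratio (expf_neq0 _ q_neq0) c0 (mu_neq0 u) h.
- have hne : u (inord r) != u (inord r.+1) by rewrite ur eq_sym -lt0n.
  have v1 := inord_val rn; have v2 := inordS_val rn.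
  rewrite mu_cswap // lagrange_cswap // mcoeffZ mcoeffB mcoeffZ.
  have e0 : (N u)@_(cswap r u) = 0.
    apply: (@lagrange_mcoeff_eq0 u (inord r.+1)); rewrite ?mdeg_mperm // => k; rewrite v2.
      exact: u_after.
    rewrite cswapE leq_eqVlt => /predU1P[e|h].
      have -> : k = inord r.+1 by apply/val_inj; rewrite /= v2.
      by rewrite swapr.
    by rewrite swapD ?u_after // -?val_eqE /= ?v1 ?v2; lia.
  rewrite hop_mcoeff0S //; last by rewrite cswapE swapr.
  rewrite cswapK e0 !mulr0 !subr0.
  have ls : leg u (inord r.+1) 1 = (leg (cswap r u) (inord r) 1).+1.
    by rewrite (leg_cswap_row rn ur ur1 u_after) // addn1.
  have E1 : stat_n u = (stat_n (cswap r u)).+1.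
    have := @big_diagram_cswap _ _ _ ur1 nat 0%N addn (leg (cswap r u)) (leg u).
    rewrite ls /stat_n => E; apply: (@addnI (leg (cswap r u) (inord r) 1)).
    rewrite -E ?addSn ?addnS // => [i c hi hc|c hc].
      by rewrite (leg_cswap rn ur ur1 u_after).
    by rewrite (leg_cswap_row rn ur ur1 u_after) ?(ltnW hc) // gtn_eqF ?addn0.
  set X := q ^+ u (inord r.+1) * t ^+ leg (cswap r u) (inord r) 1.
  have E2 : (1 - X * t) * cprime q t (cswap r u) = (1 - X) * cprime q t u.
    have := @big_diagram_cswap _ _ _ ur1 K 1 *%R
      (fun i c => 1 - q ^+ (cswap r u i - c).+1 * t ^+ leg (cswap r u) i c)
      (fun i c => 1 - q ^+ (u i - c).+1 * t ^+ leg u i c).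
    rewrite cswapE swapl subn1 prednK // ls exprSr mulrA; apply => [i c hi hc|c hc].
      by rewrite cswapE (leg_cswap rn ur ur1 u_after).
    rewrite ?cswapE ?swapl (leg_cswap_row rn ur ur1 u_after) ?(ltnW hc) //.
    by rewrite gtn_eqF ?addn0.
  have X1 : 1 - X != 0.
    rewrite subr_eq0; apply/eqP => e.
    have e' : q ^+ 0 * t ^+ 0 = X by rewrite !expr0 mulr1.
    by have [h _] := generic_exp qt_generic e'; rewrite -h in ur1.
  have Xt1 : 1 - X * t != 0.
    rewrite subr_eq0 -mulrA -exprSr; apply/eqP => e.
    by rewrite -[LHS]mulr1 -[X in X * _](expr0 q) -(expr0 t) in e; have [] := generic_exp qt_generic e.
  have hc : cprime q t (cswap r u) = (1 - X) * cprime q t u / (1 - X * t).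
    by rewrite -E2 mulrC mulKf.
  have cu := cprime_neq0 u; have m0 := mu_neq0 u.
  have -> : (N u)@_u = t ^+ stat_n u / cprime q t u / mu u by rewrite -IH mulfK // mu_neq0.
  have Y0 := sp_neq0 qt_generic u (inord r).
  have HY : sp u (inord r.+1) = sp u (inord r) * (X * t).
    rewrite {1}/spectral (spec_exp_leg rn ur ur1 u_after) ls exprD exprSr /X.
    by rewrite /spectral ur expr0 mul1r; ring.
  rewrite /exch !sp_cswap //= swapl swapr HY hc E1 exprS.
  exact: cswap_ratio.
Qed.

Lemma mcoeff_lagrange_neq0 u : (N u)@_u != 0.
Proof.
apply/eqP => h; have /eqP := mcoeff_lagrange u; rewrite h mul0r eq_sym mulf_eq0 invr_eq0.
by rewrite (negbTE (cprime_neq0 u)) expf_eq0 (negbTE t_neq0) andbF.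
Qed.

(** A polynomial with the defining properties is its value at <u> times N u, so the choice made by
    [xget] is forced; the prescribed coefficient fixes the scalar. *)
Lemma interpM_lagrange u :
  interpM q t u = ((q ^+ stat_n' u)^-1 / (N u)@_u) *: N u.
Proof.
set c := _ / _; have l0 := mcoeff_lagrange_neq0 u.
have c0 : c != 0 by rewrite mulf_neq0 ?invr_eq0 // expf_neq0.
have hN : is_interpM q t u (c *: N u).
  split=> [|v dv vu|]; last by rewrite mcoeffZ /c divfK.
    rewrite msizeZ //; apply/eqP; rewrite eqn_leq msize_lagrange.
    by apply: msize_mdeg_lt; rewrite mcoeff_msupp.
  by rewrite mevalZ lagrange_sp // (negbTE vu) mulr0.
have uniq p : is_interpM q t u p -> p = p.@[sp u] *: N u.
  case=> sp_p hp _; apply: (grid_eq qt_generic (d := mdeg u)); first by rewrite sp_p.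
    exact: leq_trans (msizeZ_le _ _) (msize_lagrange _ _).
  move=> w dw; rewrite mevalZ lagrange_sp //.
  by have [->|wu] := eqVneq w u; rewrite ?mulr1 // mulr0 hp.
rewrite /interpM; case: xgetP => [p _ hp|/(_ _ hN) //].
rewrite (uniq p hp); congr (_ *: _); apply: (mulIf l0).
rewrite /c divfK // -mcoeffZ -uniq //.
by case: hp.
Qed.

Lemma nM_lagrange u : nM q t u = mu u *: N u.
Proof.
have l0 := mcoeff_lagrange_neq0 u.
rewrite /nM interpM_lagrange scalerA; congr (_ *: _).
apply: (mulfI l0); rewrite mcoeff_lagrange.
have c0 := cprime_neq0 u; have q0 := expf_neq0 (stat_n' u) q_neq0.
by field; rewrite q0 l0 c0.
Qed.

Lemma nE_topM u : nE q t u = mu u *: topM qt_generic u.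
Proof. by rewrite /nE nM_lagrange linearZ. Qed.

End Normalisation.

(** * The kernel and its symmetry *)

Section BoundedCompositions.
Variable n : nat.
Implicit Types (u v w : 'X_{1..n.+1}).

(** A list of plain compositions, so that sums can be widened to a larger bound and reindexed by
    [cswap] and [cshift]. *)
Definition comps D : seq 'X_{1..n.+1} :=
  [seq bmnm b | b <- enum {: 'X_{1..n.+1 < D}}].

Lemma mem_comps D u : (u \in comps D) = (mdeg u < D)%N.
Proof.
apply/mapP/idP => [[b _ ->]|h]; first exact: bmdeg.
by exists (BMultinom h) => //; rewrite mem_enum.
Qed.

Lemma comps_uniq D : uniq (comps D).
Proof. by rewrite map_inj_uniq ?enum_uniq //; apply: val_inj. Qed.

Section BigOp.
Variable V : nmodType.
Implicit Type F : 'X_{1..n.+1} -> V.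

Lemma big_comps D F : \sum_(b : 'X_{1..n.+1 < D}) F b = \sum_(u <- comps D) F u.
Proof. by rewrite big_map big_enum. Qed.

Lemma eq_comps D F F' : (forall u, (mdeg u < D)%N -> F u = F' u) ->
  \sum_(u <- comps D) F u = \sum_(u <- comps D) F' u.
Proof.
by move=> h; rewrite !big_seq; apply: eq_bigr => u; rewrite mem_comps; apply: h.
Qed.

Lemma big_comps_widen D1 D2 F : (D1 <= D2)%N ->
  (forall u, (D1 <= mdeg u)%N -> F u = 0) ->
  \sum_(u <- comps D2) F u = \sum_(u <- comps D1) F u.
Proof.
move=> D12 hF; rewrite (bigID (fun u : 'X_{1..n.+1} => mdeg u < D1)%N) /=.
rewrite [X in _ + X]big1 ?addr0 => [|u]; last by rewrite -leqNgt; apply: hF.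
rewrite -big_filter; apply/perm_big/uniq_perm; rewrite ?filter_uniq ?comps_uniq //.
move=> u; rewrite mem_filter !mem_comps andb_idr // => h; exact: leq_trans h D12.
Qed.

Lemma big_comps_cswap r D F :
  \sum_(u <- comps D) F (cswap r u) = \sum_(u <- comps D) F u.
Proof.
rewrite -(big_map (cswap r) predT F); apply/perm_big/uniq_perm.
- by rewrite map_inj_uniq ?comps_uniq //; apply/can_inj/cswapK.
- exact: comps_uniq.
move=> u; rewrite mem_comps; apply/mapP/idP => [[v + ->]|h].
  by rewrite mem_comps mdeg_mperm.
by exists (cswap r u); rewrite ?cswapK // mem_comps mdeg_mperm.
Qed.

Lemma big_comps_cshift D F :
  (forall u, u ord_max = 0%N -> F u = 0) ->
  \sum_(u <- comps D.+1) F u = \sum_(u <- comps D) F (cshift u).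
Proof.
move=> hF; rewrite -(big_map (@cshift n) predT F).
rewrite (bigID (fun u : 'X_{1..n.+1} => 0 < u ord_max)%N) /=.
rewrite [X in _ + X]big1 ?addr0 => [|u]; last by rewrite -eqn0Ngt => /eqP /hF.
rewrite -big_filter; apply/perm_big/uniq_perm.
- by rewrite filter_uniq ?comps_uniq.
- by rewrite map_inj_uniq ?comps_uniq //; apply: cshift_inj.
move=> u; rewrite mem_filter mem_comps; apply/andP/mapP => [[/cshiftP[v ->]]|[v + ->]].
  by rewrite mdeg_cshift => h; exists v; rewrite ?mem_comps.
by rewrite mem_comps mdeg_cshift cshift_max.
Qed.

End BigOp.
End BoundedCompositions.

Section Kernel.
Variables (K : numFieldType) (q t : K) (n : nat).
Hypothesis qt_generic : generic q t.
Implicit Types (u v w z : 'X_{1..n.+1}) (p g : {mpoly K[n.+1]}).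

Local Notation sp := (spectral q t).
Local Notation N := (lagrange qt_generic).
Local Notation topM := (topM qt_generic).
Local Notation mu := (mu q t).
Local Notation hop := (@hop K t n).
Local Notation hops := (@hops K t n).
Local Notation Hop := (@Hop K t n).
Local Notation Hrev := (@Hrev K t n).
Local Notation exch := (@exch K t n).
Local Notation tau := (@tau K q n).
Local Notation tauV := (@tauV K q n).
Local Notation comps := (@comps n).

Let q_neq0 : q != 0. Proof. by case: qt_generic. Qed.
Let t_neq0 : t != 0. Proof. by case: qt_generic. Qed.

Definition topM_sp0 u : K := (topM u).@[sp (0%MM : 'X_{1..n.+1})].

Lemma exch_sp0 r : (r < n)%N -> exch r (sp (0%MM : 'X_{1..n.+1})) = 0.
Proof. by move=> rn; apply/eqP; rewrite exch_sp_eq0 // !mnm0E. Qed.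

Lemma hops_sp0 s p : (forall r, r \in s -> (r < n)%N) ->
  (hops s p).@[sp (0%MM : 'X_{1..n.+1})] = p.@[sp (0%MM : 'X_{1..n.+1})].
Proof.
elim: s => //= r s IH hs; rewrite hop_sp ?hs ?mem_head // exch_sp0 ?hs ?mem_head //.
by rewrite subr0 mul0r mul1r addr0 IH // => k ks; apply: hs; rewrite inE ks orbT.
Qed.

(** [hop_topM] evaluated at <0>, where [exch] vanishes and [hop] preserves values. *)
Lemma topM_sp0_cswap r u : (r < n)%N ->
  exch r (sp u) * topM_sp0 u = exch r (sp (cswap r u)) * topM_sp0 (cswap r u).
Proof.
move=> rn; have := congr1 (meval (sp (0%MM : 'X_{1..n.+1}))) (hop_topM qt_generic u rn).
rewrite hop_sp // exch_sp0 // subr0 mul0r mul1r addr0 mevalD !mevalZ.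
rewrite mulrBl mul1r => h; apply: (addrI (topM_sp0 u - exch r (sp u) * topM_sp0 u)).
by rewrite subrK.
Qed.

(** The last entry of <0> is 1, which removes X_n from [tau_topM]; [tau (topM u)] is a multiple of
    [Hrev (topM u)], and [Hrev] preserves the value at <0>. *)
Lemma topM_sp0_cshift u :
  (q * sp u ord0 - 1) * sp u ord0 * topM_sp0 (cshift u) = t ^+ n * topM_sp0 u.
Proof.
have h : sp u ord0 *: tau (topM u) = t ^+ n *: Hrev (topM u).
  apply: (tauV_inj qt_generic); rewrite !linearZ /= (tauK qt_generic) tauV_Hrev_topM scalerA mulrA.
  by rewrite mulfV ?mul1r // expf_neq0.
have := congr1 (meval (sp (0%MM : 'X_{1..n.+1}))) (tau_topM qt_generic u).
rewrite mevalM mevalXU mevalZ sp_max0 ?mnm0E // mul1r => h2.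
rewrite mulrAC -h2 mulrC -mevalZ h mevalZ hops_sp0 //.
exact: rev_iota_lt.
Qed.

Lemma topM_sp0_neq0 u : topM_sp0 u != 0.
Proof.
elim/comp_ind: u => [|u IH|u r rn ur ur1 _ IH].
- have -> : topM_sp0 0 = 1; last exact: oner_neq0.
  by rewrite /topM_sp0 topM_mdeg0 meval1.
- apply/eqP => h; have /eqP := topM_sp0_cshift u; rewrite h mulr0 eq_sym mulf_eq0.
  by rewrite expf_eq0 (negbTE t_neq0) andbF (negbTE IH).
- apply/eqP => h; have /eqP := topM_sp0_cswap u rn; rewrite h mulr0 mulf_eq0.
  by rewrite exch_sp_eq0 // ur eq_sym eqn0Ngt ur1 (negbTE IH).
Qed.

(** The weight of E_u M_u / E_u(<0>) after both polynomials are expressed by N u: two factors [mu u]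
    arise and one cancels. *)
Definition omega u : K := mu u / topM_sp0 u.

(** Detailed balance: it matches the off-diagonal terms of [hop] through y with those through w in
    [hop_ker]. *)
Lemma omega_cswap r u : (r < n)%N ->
  omega u * exch r (sp (cswap r u)) = omega (cswap r u) * exch r (sp u).
Proof.
move=> rn; rewrite /omega mu_cswap //.
have h0 := topM_sp0_neq0 u; have h1 := topM_sp0_neq0 (cswap r u).
apply: (mulIf h0); apply: (mulIf h1).
have := topM_sp0_cswap u rn.
set a := topM_sp0 u; set b := topM_sp0 _; set c := exch r _; set d := exch r _ => e.
transitivity (mu u * (d * b)); first by field.
by rewrite -e; field.
Qed.

Lemma omega_cshift u :
  omega (cshift u) = t ^- n * sp u ord0 ^+ 2 * (1 - q * sp u ord0) * omega u.
Proof.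
rewrite /omega mu_cshift.
have h0 := topM_sp0_neq0 u; have h1 := topM_sp0_neq0 (cshift u).
have -> : topM_sp0 u = t ^- n * ((q * sp u ord0 - 1) * sp u ord0 * topM_sp0 (cshift u)).
  by rewrite topM_sp0_cshift mulKf // expf_neq0.
have h2 := q_sp_neq1 qt_generic u ord0; have h3 := sp_neq0 qt_generic u ord0.
by field; rewrite h1 h2 h3 expf_neq0.
Qed.

Definition ker w : {mpoly K[n.+1]} :=
  \sum_(u <- comps (mdeg w).+1) (omega u * (N u).@[sp w]) *: topM u.

Lemma kerE D w : (mdeg w < D)%N ->
  ker w = \sum_(u <- comps D) (omega u * (N u).@[sp w]) *: topM u.
Proof.
move=> h; rewrite (big_comps_widen h) // => u hu.
by rewrite lagrange_sp_lt // mulr0 scale0r.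
Qed.

Lemma hop_ker r w : (r < n)%N ->
  hop r (ker w) = (1 - exch r (sp w)) *: ker w + exch r (sp w) *: ker (cswap r w).
Proof.
move=> rn; set D := (mdeg w).+1.
rewrite (@kerE D w) // (@kerE D (cswap r w)) ?mdeg_mperm // linear_sum /=.
transitivity (\sum_(u <- comps D) (omega u * (hop r (N u)).@[sp w]) *: topM u); last first.
  rewrite !scaler_sumr -big_split; apply: eq_bigr => u _ /=.
  by rewrite hop_sp // !scalerA -scalerDl; congr (_ *: _); ring.
under eq_bigr do rewrite linearZ /= hop_topM // scalerDr !scalerA.
under [RHS]eq_bigr do rewrite hop_lagrange // mevalD !mevalZ mulrDr scalerDl.
rewrite !big_split /=; congr (_ + _).
  by apply: eq_bigr => u _; congr (_ *: _); ring.
rewrite -[RHS](big_comps_cswap r); apply: eq_bigr => u _; rewrite cswapK.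
by congr (_ *: _); rewrite [in RHS]mulrA -omega_cswap //; ring.
Qed.

(** Operators are transferred from w to y one at a time, which reverses their order; hence [Hop] in
    w becomes [Hrev] in y. *)
Lemma hops_ker s w D : (forall r, r \in s -> (r < n)%N) -> (mdeg w < D)%N ->
  \sum_(u <- comps D) (omega u * (hops s (N u)).@[sp w]) *: topM u = hops (rev s) (ker w).
Proof.
move=> + dw; elim: s w dw => [|r s IH] w dw hs; first by rewrite /= (kerE dw).
have rn : (r < n)%N by apply: hs; rewrite mem_head.
have hs' k : k \in s -> (k < n)%N by move=> ks; apply: hs; rewrite inE ks orbT.
under eq_bigr do rewrite hops_cons hop_sp //.
rewrite rev_cons -cats1 hops_cat hops_cons hop_ker //.
rewrite linearD !linearZ /= -!IH ?mdeg_mperm // !scaler_sumr -big_split.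
apply: eq_bigr => u _ /=; rewrite !scalerA -scalerDl.
by congr (_ *: _); ring.
Qed.

Lemma lagrange_cshift_sp u w : (N (cshift u)).@[sp (cshift w)] =
  (q * sp w ord0 - 1) / (q * sp u ord0 - 1) * (N u).@[sp w].
Proof. by rewrite lagrange_cshift mevalZ phiop_sp // mulrA; congr (_ * _); rewrite mulrC. Qed.

(** N (cshift v) vanishes at <w> because of its raising factor, and for the remaining u the
    polynomial [topM u] has equal images under [Hop] and [tauV]. *)
Lemma Hop_ker_max0 w : w ord_max = 0%N -> Hop (ker w) = tauV (ker w).
Proof.
move=> w0; rewrite /ker !linear_sum /=; apply: eq_bigr => u _.
rewrite !linearZ /=; have [u0|/cshiftP[v ->]] := posnP (u ord_max).
  by rewrite Hop_topM_max0.
by rewrite lagrange_cshift mevalZ phiop_sp0 // !mulr0 !scale0r.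
Qed.

Let kerH w := tauV (Hrev (ker w)).

(** The first relation, by lowering in y. The constant of [omega_cshift] combines with those of
    raising and lowering into the eigenvalue of [tauV_Hrev_topM]. *)
Lemma Hop_ker_lower w : Hop (ker (cshift w)) - tauV (ker (cshift w)) =
  (q * sp w ord0 - 1) *: ('X_ord0 * kerH w).
Proof.
rewrite /kerH /ker mdeg_cshift (linear_sum Hop) (linear_sum Hrev) !(linear_sum tauV) -sumrB.
rewrite big_comps_cshift => [|u u0]; last first.
  by rewrite !linearZ /= Hop_topM_max0 // scalerN subrr.
rewrite mulr_sumr scaler_sumr; apply: eq_bigr => u _.
rewrite !linearZ /= -scalerDr Hop_topM_cshift tauV_Hrev_topM lagrange_cshift_sp omega_cshift.
rewrite -!(@scalerAr _ {mpoly K[n.+1]}) !(@scalerA _ {mpoly K[n.+1]}); congr (_ *: _).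
have h2 := q_sp_neq1 qt_generic u ord0; have h3 := sp_neq0 qt_generic u ord0.
by field; rewrite h2 h3 expf_neq0.
Qed.

(** The second relation, through w. [topM_eigen] produces the factor q<w>_0 / <u>_n - 1, which
    [lagrange_eigen] at <cshift w> converts into the value of [Hop (N u)] at <w>; then [hops_ker]
    applies. *)
Lemma Hop_ker_eigen w : (q * sp w ord0) *: Hop (ker (cshift w)) - tauV (ker (cshift w)) =
  (q * sp w ord0 - 1) *: kerH w.
Proof.
have tauVK p : tau (tauV p) = p by apply: (tauV_inj qt_generic); rewrite (tauK qt_generic).
suff h : (q * sp w ord0) *: tau (Hop (ker (cshift w))) - ker (cshift w) =
    (q * sp w ord0 - 1) *: Hrev (ker w).
  by have := congr1 tauV h; rewrite linearB /= !linearZ /= (tauK qt_generic).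
rewrite -[Hrev (ker w)](@hops_ker (iota 0 n) w (mdeg (cshift w)).+1) ?mdeg_cshift //; last exact: iota_lt.
rewrite -mdeg_cshift /ker (linear_sum Hop) (linear_sum tau) !scaler_sumr -sumrB; apply: eq_bigr => u _.
rewrite !linearZ /= topM_eigen !(@scalerA _ {mpoly K[n.+1]}) scalerN -scalerBl; congr (_ *: _).
have := congr1 (meval (sp (cshift w))) (lagrange_eigen qt_generic u).
rewrite phiop_sp // mevalB mevalZ mevalM mevalXU sp_cshift_max => e.
by rewrite -[RHS]mulrA [_ * (_ - 1)]mulrC -e; ring.
Qed.

(** The two relations are linear in the [Hop] and [tauV] images of the kernel and are solvable since
    q<w>_0 is not 1. The [tauV] image then gives the recursion [ker_cshift]. *)
Lemma Hop_ker_cshift w : Hop (ker (cshift w)) = (1 - 'X_ord0) * kerH w.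
Proof.
have h := q_sp_neq1 qt_generic w ord0.
apply: (scalerI h); rewrite mulrBl mul1r scalerBr -Hop_ker_lower -Hop_ker_eigen.
by rewrite scalerBl scale1r opprB addrA addrNK.
Qed.

Lemma tauV_ker_cshift w :
  tauV (ker (cshift w)) = (1 - (q * sp w ord0) *: 'X_ord0) * kerH w.
Proof.
have := Hop_ker_eigen w; rewrite Hop_ker_cshift => e.
have -> : tauV (ker (cshift w)) = (q * sp w ord0) *: ((1 - 'X_ord0) * kerH w)
    - (q * sp w ord0 - 1) *: kerH w by rewrite -e opprB addrC subrK.
by rewrite -!mul_mpolyC mpolyCB mpolyC1; ring.
Qed.

Lemma ker_cshift w : ker (cshift w) = (1 - sp w ord0 *: 'X_ord_max) * Hrev (ker w).
Proof.
apply: (tauV_inj qt_generic); rewrite tauV_ker_cshift rmorphM /= rmorphB rmorph1 /=.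
congr ((1 - _) * _); rewrite linearZ /= mulrC -scalerA; congr (_ *: _).
by apply: (gridP qt_generic) => z; rewrite tauV_sp mevalZ !mevalXU sp_cshift_max.
Qed.

End Kernel.

Section CompositionPochhammer.
Variables (n : nat) (A : comNzRingType) (q t : A).
Implicit Types (y : A) (w : 'X_{1..n.+1}).

Lemma qpochS y k : qpoch q y k.+1 = qpoch q y k * (1 - y * q ^+ k).
Proof. by rewrite /qpoch big_ord_recr. Qed.

(** This is (y t^n)_w in n + 1 variables, with the parts listed by spectral exponent instead of
    being sorted, so that [cshift] contributes the single factor 1 - y<w>_0. *)
Definition hpoch y w : A := \prod_i qpoch q (y * t ^+ spec_exp w i) (w i).

Lemma hpoch0 y : hpoch y 0%MM = 1.
Proof. by rewrite /hpoch big1 // => i _; rewrite mnm0E /qpoch big_ord0. Qed.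

Lemma hpoch_cshift y w :
  hpoch y (cshift w) = (1 - y * (q ^+ w ord0 * t ^+ spec_exp w ord0)) * hpoch y w.
Proof.
rewrite /hpoch -[in RHS](big_ordS _ (fun i => qpoch q (y * t ^+ spec_exp w i) (w i))).
rewrite (bigD1 ord_max) //= [in RHS](bigD1 ord_max) //= [RHS]mulrA; congr (_ * _); last first.
  by apply: eq_bigr => i hi; rewrite cshiftE spec_exp_cshift (negbTE hi) addn0.
rewrite cshift_max spec_exp_cshift ordS_max qpochS mulrC; congr ((1 - _) * _).
by rewrite -mulrA; congr (_ * _); rewrite mulrC.
Qed.

Lemma hpoch_cswap y w r : (r < n)%N -> hpoch y (cswap r w) = hpoch y w.
Proof.
move=> rn; have [e|ne] := eqVneq (w (inord r)) (w (inord r.+1)); first by rewrite cswap_id.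
rewrite /hpoch [RHS](reindex_inj (@perm_inj _ (swap n r))) /=; apply: eq_bigr => i _.
by rewrite cswapE spec_exp_swap.
Qed.

End CompositionPochhammer.

Lemma hpoch_morph (n : nat) (A B : comNzRingType) (f : {rmorphism A -> B}) q t y
    (w : 'X_{1..n.+1}) : f (hpoch q t y w) = hpoch (f q) (f t) (f y) w.
Proof.
rewrite rmorph_prod; apply: eq_bigr => i _; rewrite rmorph_prod; apply: eq_bigr => k _.
by rewrite rmorphB rmorph1 !rmorphM !rmorphXn.
Qed.

(** * Symmetry of the kernel on the dilated grid *)

Section KernelSymmetry.
Variables (K : numFieldType) (q t : K) (n : nat).
Hypothesis qt_generic : generic q t.
Implicit Types (u v w z : 'X_{1..n.+1}) (p g : {mpoly K[n.+1]}).

Local Notation sp := (spectral q t).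
Local Notation N := (lagrange qt_generic).
Local Notation hop := (@hop K t n).
Local Notation hops := (@hops K t n).
Local Notation Hop := (@Hop K t n).
Local Notation exch := (@exch K t n).
Local Notation tauV := (@tauV K q n).
Local Notation ker := (ker qt_generic).
Local Notation omega := (omega qt_generic).

Let q_neq0 : q != 0. Proof. by case: qt_generic. Qed.
Let t_neq0 : t != 0. Proof. by case: qt_generic. Qed.

Definition grid_hop r (G : 'X_{1..n.+1} -> K) z : K :=
  (1 - exch r (sp z)) * G z + exch r (sp z) * G (cswap r z).

Definition grid_hops s G := foldr grid_hop G s.

Lemma eq_grid_hops s G G' z : G =1 G' -> grid_hops s G z = grid_hops s G' z.
Proof. by move=> /funext ->. Qed.

Lemma ker_mdeg0 : ker (0%MM : 'X_{1..n.+1}) = 1.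
Proof.
rewrite /ker mdeg0 (perm_big [:: 0%MM]); last first.
  apply: uniq_perm; rewrite ?comps_uniq // => u.
  by rewrite mem_comps inE ltnS leqn0 mdeg_eq0.
rewrite big_seq1 lagrange_sp // eqxx mulr1 /omega /topM_sp0 topM_mdeg0 meval1 divr1.
by rewrite mu_mdeg0 scale1r.
Qed.

Section Dilation.
Variable a : K.
Hypothesis a0 : a != 0.

Local Notation dsp z := (fun i => a * sp z i).

(** The points a<z> are off the grid, but [exch] has degree 0, so [hop] acts on the values there by
    the same formula. *)
Lemma hop_dsp r p z : (r < n)%N ->
  (hop r p).@[dsp z] = grid_hop r (fun z => p.@[dsp z]) z.
Proof.
move=> rn; rewrite (hop_meval qt_generic) //; last by rewrite (inj_eq (mulfI a0)) sp_neq.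
have -> : exch r (dsp z) = exch r (sp z).
  have h := sp_neq qt_generic z rn; rewrite /exch.
  rewrite -mulrBr [t * (a * _)]mulrCA -mulrBr [t * (a * _)]mulrCA -mulf_div divff // mul1r.
  by [].
rewrite /grid_hop; congr (_ + _).
case: (eqVneq (z (inord r)) (z (inord r.+1))) => h.
  by have /eqP -> : exch r (sp z) == 0; rewrite ?exch_sp_eq0 ?h // !mul0r.
by congr (_ * _); apply: meval_eq => i /=; rewrite sp_cswap.
Qed.

Lemma hops_dsp s p z : (forall r, r \in s -> (r < n)%N) ->
  (hops s p).@[dsp z] = grid_hops s (fun z => p.@[dsp z]) z.
Proof.
elim: s z => //= r s IH z hs; rewrite hop_dsp ?hs ?mem_head // /grid_hop.
by rewrite !IH // => k ks; apply: hs; rewrite inE ks orbT.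
Qed.

Definition ksym z w : K := (ker w).@[dsp z] * hpoch q t a z.

Lemma grid_hops_mul s G (P : 'X_{1..n.+1} -> K) z :
  (forall r, r \in s -> (r < n)%N) ->
  (forall r z, (r < n)%N -> P (cswap r z) = P z) ->
  grid_hops s (fun z => G z * P z) z = grid_hops s G z * P z.
Proof.
move=> + hP; elim: s z => //= r s IH z hs; rewrite /grid_hop !IH; first last.
- by move=> k ks; apply: hs; rewrite inE ks orbT.
- by move=> k ks; apply: hs; rewrite inE ks orbT.
by rewrite hP ?hs ?mem_head //; ring.
Qed.

Lemma hops_ksym s z w : (forall r, r \in s -> (r < n)%N) ->
  (hops s (ker w)).@[dsp z] * hpoch q t a z = grid_hops s (ksym^~ w) z.
Proof.
move=> hs; rewrite hops_dsp // -grid_hops_mul //.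
by move=> r z' rn; rewrite hpoch_cswap.
Qed.

Lemma grid_hop_ksym r z w : (r < n)%N ->
  grid_hop r (ksym^~ w) z = grid_hop r (ksym z) w.
Proof.
move=> rn; rewrite -[LHS](@hops_ksym [:: r]) => [|k]; last by rewrite inE => /eqP ->.
rewrite /= hop_ker // mevalD !mevalZ /grid_hop /ksym; ring.
Qed.

Lemma grid_hopsC r s (G : 'X_{1..n.+1} -> 'X_{1..n.+1} -> K) z w :
  grid_hops s (fun z => grid_hop r (G z) w) z = grid_hop r (fun w => grid_hops s (G^~ w) z) w.
Proof.
elim: s z => //= k s IH z; rewrite /grid_hop !IH /grid_hop; ring.
Qed.

Lemma grid_hops_ksym s z w : (forall r, r \in s -> (r < n)%N) ->
  grid_hops s (ksym^~ w) z = grid_hops (rev s) (ksym z) w.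
Proof.
elim: s z w => //= r s IH z w hs.
have hs' k : k \in s -> (k < n)%N by move=> ks; apply: hs; rewrite inE ks orbT.
have rn : (r < n)%N by apply: hs; rewrite mem_head.
rewrite rev_cons -cats1 /grid_hops foldr_cat -/(grid_hops _ _) [foldr grid_hop _ [:: r]]/=.
transitivity (grid_hop r (fun z => grid_hops (rev s) (ksym z) w) z).
  by rewrite /grid_hop !IH.
rewrite -(grid_hopsC r (rev s) (fun w z => ksym z w)).
by apply: eq_grid_hops => w'; rewrite grid_hop_ksym.
Qed.

(** At z = 0 the last spectral entry is 1 and [Hrev] preserves values, so [ker_cshift] contributes
    just 1 - a<w>_0, the recursion of (a)_w. *)
Lemma ksym0l w : ksym 0%MM w = hpoch q t a w.
Proof.
elim/comp_ind: w => [|w IH|w r rn h0 h1 _ IH].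
- by rewrite /ksym !hpoch0 ker_mdeg0 meval1 mulr1.
- rewrite hpoch_cshift -IH /ksym ker_cshift mevalM mevalB meval1 mevalZ mevalXU.
  rewrite sp_max0 ?mnm0E // mulr1 -mulrA hops_ksym; last exact: rev_iota_lt.
  rewrite [sp w ord0 * a]mulrC; congr (_ * _).
  elim: (rev (iota 0 n)) (@rev_iota_lt n) => //= r s IHs hs.
  rewrite /grid_hop exch_sp0 ?hs ?mem_head // subr0 mul0r mul1r addr0 IHs //.
  by move=> k ks; apply: hs; rewrite inE ks orbT.
- rewrite hpoch_cswap // -IH.
  have := grid_hop_ksym 0%MM w rn; rewrite /grid_hop exch_sp0 // subr0 mul0r mul1r addr0.
  rewrite mulrBl mul1r -addrA -{1}[ksym _ w]addr0 => /addrI/esym/eqP.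
  rewrite addrC -mulrBr mulf_eq0 exch_sp_eq0 // h0 eq_sym eqn0Ngt h1 /= subr_eq0.
  by move/eqP.
Qed.

(* In the cshift step the shift of the spectral parameter on the left is removed by
   ker_cshift; on the right it acts on the variable of ker z as tauV, which the
   relations for z = cshift y (or z ord_max = 0) compare with Hop. *)
Lemma ksymC z w : ksym z w = ksym w z.
Proof.
elim/comp_ind: w z => [|w IH|w r rn h0 h1 _ IH] z.
- by rewrite ksym0l /ksym ker_mdeg0 meval1 mul1r.
(* Both orders of the arguments are compared with this expression, in which [Hop] acts on w. *)
- transitivity ((1 - a * sp w ord0 * sp z ord_max) * grid_hops (iota 0 n) (ksym^~ z) w).
    rewrite grid_hops_ksym; last exact: iota_lt.
    rewrite -(@eq_grid_hops _ (ksym^~ w)); last by move=> y; rewrite IH.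
    rewrite -hops_ksym; last exact: rev_iota_lt.
    rewrite /ksym ker_cshift mevalM mevalB meval1 mevalZ mevalXU -[LHS]mulrA.
    by congr (_ * _); ring.
  rewrite -hops_ksym; last exact: iota_lt.
  rewrite /ksym hpoch_cshift -/(sp w ord0).
  have E p : p.@[dsp (cshift w)] = (tauV p).@[dsp w].
    rewrite /tauV scale_substE; apply: meval_eq => i; rewrite sp_cshift.
    by rewrite mulrCA.
  rewrite E; have [z0|/cshiftP[y ->]] := posnP (z ord_max).
    by rewrite -(Hop_ker_max0 _ z0) sp_max0 // mulr1 /Hop; ring.
  rewrite -/Hop tauV_ker_cshift -/(Hop (ker (cshift y))) Hop_ker_cshift sp_cshift_max.
  rewrite !mevalM !mevalB !meval1 mevalZ !mevalXU.
  set T := (tauV _).@[_]; ring.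
(* The [hop] images of both orders agree and so do their diagonal terms, by induction; the other
   coefficient is nonzero because w_r = 0 differs from w_{r+1}. *)
- have e := grid_hop_ksym z w rn.
  have e' : grid_hop r (ksym^~ w) z = grid_hop r (fun y => ksym y z) w.
    by rewrite [RHS](grid_hop_ksym w z rn) /grid_hop !IH.
  move: e; rewrite e' /grid_hop IH => /addrI/eqP.
  have h : exch r (sp w) != 0 by rewrite exch_sp_eq0 // h0 eq_sym -lt0n.
  by rewrite (inj_eq (mulfI h)) => /eqP.
Qed.

End Dilation.
End KernelSymmetry.

(** * The identity at b = 0 *)

Lemma big_comps_split (n : nat) (V : nmodType) k (f g : 'X_{1..n.+1} -> V) :
  \sum_(u <- comps n k.+1) (if (mdeg u < k)%N then f u else g u) =
  \sum_(u <- comps n k) f u + \sum_(u <- comps n k.+1 | mdeg u == k) g u.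
Proof.
rewrite (bigID (fun u : 'X_{1..n.+1} => mdeg u < k)%N) /=; congr (_ + _).
  under eq_bigr => u -> do [].
  rewrite -big_filter; apply/perm_big/uniq_perm; rewrite ?filter_uniq ?comps_uniq //.
  by move=> u; rewrite mem_filter !mem_comps andb_idr // => /ltnW.
rewrite big_seq_cond [RHS]big_seq_cond; apply: eq_big => [u|u /andP[_ /negbTE -> //]].
by rewrite mem_comps ltnS; case: ltngtP.
Qed.

Lemma big_comps_cond1 (n : nat) (V : nmodType) D (P : pred 'X_{1..n.+1}) f w :
  (mdeg w < D)%N -> P w -> (forall u, P u -> u != w -> f u = 0) ->
  \sum_(u <- comps n D | P u) f u = f w :> V.
Proof.
move=> dw Pw h; rewrite big_mkcond (bigD1_seq w) ?mem_comps ?comps_uniq //= Pw.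
by rewrite big1 ?addr0 // => u uw; case: ifP => // Pu; apply: h.
Qed.

Lemma big_comps1 (n : nat) (V : nmodType) D (f : 'X_{1..n.+1} -> V) w :
  (mdeg w < D)%N -> (forall u, (mdeg u < D)%N -> u != w -> f u = 0) ->
  \sum_(u <- comps n D) f u = f w.
Proof.
move=> dw h; rewrite (bigD1_seq w) ?mem_comps ?comps_uniq //= big_seq_cond big1 ?addr0 //.
by move=> u; rewrite mem_comps => /andP[]; apply: h.
Qed.

Lemma pihomogZ (n : nat) (K : fieldType) d (c : K) (p : {mpoly K[n]}) :
  pihomog mdeg d (c *: p) = c *: pihomog mdeg d p.
Proof. by rewrite linearZ. Qed.

Section Expansions.
Variables (K : numFieldType) (q t : K) (n : nat).
Hypothesis qt_generic : generic q t.
Implicit Types (u v w z s : 'X_{1..n.+1}) (p g : {mpoly K[n.+1]}).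

Local Notation sp := (spectral q t).
Local Notation N := (lagrange qt_generic).
Local Notation mu := (mu q t).
Local Notation comps := (@comps n).
Local Notation M := (@nM K q t n.+1).
Local Notation E := (@nE K q t n.+1).

Lemma nM_sp u w : (mdeg w <= mdeg u)%N -> (M u).@[sp w] = mu u * (w == u)%:R.
Proof. by move=> h; rewrite nM_lagrange mevalZ lagrange_sp. Qed.

Lemma nM_sp_lt u w : (mdeg w < mdeg u)%N -> (M u).@[sp w] = 0.
Proof. by move=> h; rewrite nM_lagrange mevalZ lagrange_sp_lt ?mulr0. Qed.

Lemma nM_sp_neq0 u : (M u).@[sp u] != 0.
Proof. by rewrite nM_sp // eqxx mulr1 mu_neq0. Qed.

Lemma msize_nM u : (msize (M u) <= (mdeg u).+1)%N.
Proof. rewrite nM_lagrange; exact: leq_trans (msizeZ_le _ _) (msize_lagrange _ _). Qed.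

Lemma nE_homog u : E u \is (mdeg u).-homog.
Proof. exact: pihomogP. Qed.

Definition nE_sp0 u : K := (E u).@[sp (0%MM : 'X_{1..n.+1})].

Lemma nE_sp0_neq0 u : nE_sp0 u != 0.
Proof.
by rewrite /nE_sp0 nE_topM mevalZ mulf_neq0 ?mu_neq0 //; apply: topM_sp0_neq0.
Qed.

(** Newton interpolation: the M_u of degree k vanish at all grid points of smaller degree, so they
    correct the values in degree k without disturbing the earlier ones. *)
Lemma nM_interpolate k p : exists c : 'X_{1..n.+1} -> K,
  forall w, (mdeg w < k)%N -> (\sum_(u <- comps k) c u *: M u).@[sp w] = p.@[sp w].
Proof.
elim: k => [|k [c hc]]; first by exists (fun=> 0).
set g := \sum_(u <- _) _ in hc.
exists (fun u => if (mdeg u < k)%N then c u else (p - g).@[sp u] / mu u) => w dw.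
have -> : \sum_(u <- comps k.+1) (if (mdeg u < k)%N then c u else (p - g).@[sp u] / mu u) *: M u
    = g + \sum_(u <- comps k.+1 | mdeg u == k) ((p - g).@[sp u] / mu u) *: M u.
  by rewrite -big_comps_split; apply: eq_bigr => u _; case: ifP.
move: {+}g hc => {}g hc; rewrite mevalD linear_sum /=; under eq_bigr do rewrite mevalZ.
move: dw; rewrite ltnS leq_eqVlt => /predU1P[ew|dw].
  rewrite (big_comps_cond1 (w := w)) ?ew // => [|u /eqP du uw].
    by rewrite nM_sp // eqxx mulr1 divfK ?mu_neq0 // mevalB addrC subrK.
  by rewrite nM_sp ?ew ?du // eq_sym (negbTE uw) !mulr0.
by rewrite hc // big1 ?addr0 // => u /eqP du; rewrite nM_sp_lt ?du ?mulr0.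
Qed.

Lemma msize_sum_comps (F : 'X_{1..n.+1} -> {mpoly K[n.+1]}) (c : 'X_{1..n.+1} -> K) D :
  (forall u, msize (F u) <= (mdeg u).+1)%N -> (msize (\sum_(u <- comps D) c u *: F u) <= D)%N.
Proof.
move=> hF; rewrite big_seq; apply: leq_trans (msize_sum _ _ _) _.
apply/bigmax_leqP_seq => u hu _; apply: leq_trans (msizeZ_le _ _) _.
by apply: leq_trans (hF u) _; move: hu; rewrite mem_comps.
Qed.

Lemma nM_expand D p : (msize p <= D)%N ->
  exists c : 'X_{1..n.+1} -> K, p = \sum_(u <- comps D) c u *: M u.
Proof.
case: D => [|d] hp.
  exists (fun=> 0); rewrite big1 => [|u _]; last by rewrite scale0r.
  by apply/eqP; rewrite -msize_poly_eq0 -leqn0.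
have [c hc] := nM_interpolate d.+1 p; exists c.
apply: (grid_eq qt_generic hp); first by apply: msize_sum_comps; apply: msize_nM.
by move=> w dw; rewrite hc.
Qed.

Lemma nM_free D (c : 'X_{1..n.+1} -> K) :
  (forall w, (mdeg w < D)%N -> (\sum_(u <- comps D) c u *: M u).@[sp w] = 0) ->
  forall u, (mdeg u < D)%N -> c u = 0.
Proof.
move=> h; suff H k : forall u, mdeg u = k -> (mdeg u < D)%N -> c u = 0.
  by move=> u; apply: H erefl.
elim/ltn_ind: k => k IH u du dD; have := h u dD.
rewrite linear_sum /= (big_comps1 (w := u)) // => [|v dv vu].
  by rewrite mevalZ => /eqP; rewrite mulf_eq0 (negbTE (nM_sp_neq0 u)) orbF => /eqP.
rewrite mevalZ; case: (ltnP (mdeg v) k) => hv; first by rewrite (IH _ hv) ?mul0r.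
by rewrite nM_sp ?du // eq_sym (negbTE vu) !mulr0.
Qed.

Lemma nE_expandM u : exists c : 'X_{1..n.+1} -> K,
  (forall v, (mdeg u <= mdeg v)%N -> c v = (v == u)%:R) /\
  E u = \sum_(v <- comps (mdeg u).+1) c v *: M v.
Proof.
have [|c hc] := @nM_expand (mdeg u) (E u - M u).
  apply/msize_pihomogP => k hk; rewrite linearB /=; apply/eqP; rewrite subr_eq0; apply/eqP.
  have [->|nk] := eqVneq k (mdeg u); first by rewrite /nE pihomog_id.
  rewrite (@pihomog_ne0 _ _ _ (mdeg u)) ?nE_homog 1?eq_sym //.
  apply/esym; apply: (msize_pihomogP _ _ (msize_nM u)).
  by rewrite ltn_neqAle eq_sym nk.
exists (fun v => if (mdeg v < mdeg u)%N then c v else (v == u)%:R); split.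
  by move=> v; rewrite leqNgt => /negbTE ->.
have -> : \sum_(v <- comps (mdeg u).+1) (if (mdeg v < mdeg u)%N then c v else (v == u)%:R) *: M v
    = (E u - M u) + \sum_(v <- comps (mdeg u).+1 | mdeg v == mdeg u) (v == u)%:R *: M v.
  by rewrite hc -big_comps_split; apply: eq_bigr => v _; case: ifP.
rewrite (big_comps_cond1 (w := u)) ?eqxx // => [|v _ /negbTE ->].
  by rewrite scale1r subrK.
by rewrite scale0r.
Qed.

Lemma nE_expand D p : (msize p <= D)%N ->
  exists c : 'X_{1..n.+1} -> K, p = \sum_(u <- comps D) c u *: E u.
Proof.
elim: D p => [|d IH] p hp.
  exists (fun=> 0); rewrite big1 => [|u _]; last by rewrite scale0r.
  by apply/eqP; rewrite -msize_poly_eq0 -leqn0.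
have [c ec] := nM_expand hp.
set g := \sum_(u <- comps d.+1 | mdeg u == d) c u *: E u.
have [|c' ec'] := IH (p - g).
  apply/msize_pihomogP => k hk; rewrite linearB /=; apply/eqP; rewrite subr_eq0; apply/eqP.
  have [->|nk] := eqVneq k d.
    rewrite ec /g !linear_sum /= [RHS]big_mkcond; apply: eq_comps => u du.
    rewrite pihomogZ; case: eqP => [<-|/eqP ud].
      by rewrite [RHS]pihomogZ (pihomog_dE (nE_homog u)).
    rewrite (msize_pihomogP _ _ (msize_nM u)) ?scaler0 //.
    by rewrite ltn_neqAle ud -ltnS.
  rewrite (msize_pihomogP _ _ hp); last by rewrite ltn_neqAle eq_sym nk.
  rewrite /g linear_sum big1 // => u /eqP ud.
  by rewrite /= pihomogZ (@pihomog_ne0 _ _ _ (mdeg u)) ?scaler0 ?nE_homog // ud eq_sym.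
exists (fun u => if (mdeg u < d)%N then c' u else c u).
rewrite -[p](subrK g) ec' /g -big_comps_split.
by apply: eq_bigr => u _; case: ifP.
Qed.

Lemma nM_expandE u : exists c : 'X_{1..n.+1} -> K,
  (forall v, (mdeg u < mdeg v)%N -> c v = 0) /\
  M u = \sum_(v <- comps (mdeg u).+1) c v *: E v.
Proof.
have [c hc] := nE_expand (msize_nM u).
exists (fun v => if (mdeg v < (mdeg u).+1)%N then c v else 0); split.
  by move=> v uv; rewrite ltnS leqNgt uv.
by rewrite {1}hc; apply: eq_comps => v ->.
Qed.

Definition eM u := projT1 (cid (nE_expandM u)).
Definition mE u := projT1 (cid (nM_expandE u)).

Lemma eM_ge u v : (mdeg u <= mdeg v)%N -> eM u v = (v == u)%:R.
Proof. by rewrite /eM; case: cid => c [h _] /=; apply: h. Qed.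

Lemma eM_gt u v : (mdeg u < mdeg v)%N -> eM u v = 0.
Proof. by move=> h; rewrite eM_ge 1?ltnW //; case: eqP => // e; rewrite e ltnn in h. Qed.

Lemma nE_eM u D : (mdeg u < D)%N -> E u = \sum_(v <- comps D) eM u v *: M v.
Proof.
move=> h; rewrite (big_comps_widen h) => [|v hv]; last by rewrite eM_gt ?scale0r.
by rewrite /eM; case: cid => c [].
Qed.

Lemma mE_gt u v : (mdeg u < mdeg v)%N -> mE u v = 0.
Proof. by rewrite /mE; case: cid => c [h _] /=; apply: h. Qed.

Lemma nM_mE u D : (mdeg u < D)%N -> M u = \sum_(v <- comps D) mE u v *: E v.
Proof.
move=> h; rewrite (big_comps_widen h) => [|v hv]; last by rewrite mE_gt ?scale0r.
by rewrite /mE; case: cid => c [].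
Qed.

Lemma mE_eM u v D : (mdeg u < D)%N -> (mdeg v < D)%N ->
  \sum_(s <- comps D) mE u s * eM s v = (u == v)%:R.
Proof.
move=> du dv; apply/eqP; rewrite -subr_eq0; apply/eqP.
apply: (@nM_free D (fun v => \sum_(s <- comps D) mE u s * eM s v - (u == v)%:R)) => // w dw.
suff -> : \sum_(v <- comps D) (\sum_(s <- comps D) mE u s * eM s v - (u == v)%:R) *: M v = 0.
  by rewrite meval0.
under eq_bigr do rewrite scalerBl scaler_suml.
rewrite sumrB exchange_big /= [X in _ - X](big_comps1 (w := u)) // => [|s ds us].
  rewrite eqxx scale1r (nM_mE du); apply/eqP; rewrite subr_eq0; apply/eqP.
  apply: eq_comps => s ds; rewrite (nE_eM ds) scaler_sumr.
  by apply: eq_bigr => k _; rewrite scalerA.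
by rewrite eq_sym (negbTE us) scale0r.
Qed.

(** For finite square matrices a one-sided inverse is two-sided. *)
Lemma eM_mE u v D : (mdeg u < D)%N -> (mdeg v < D)%N ->
  \sum_(s <- comps D) eM u s * mE s v = (u == v)%:R.
Proof.
move=> du dv.
pose A := \matrix_(i < size (comps D), j < size (comps D))
  mE (nth 0%MM (comps D) i) (nth 0%MM (comps D) j).
pose B := \matrix_(i < size (comps D), j < size (comps D))
  eM (nth 0%MM (comps D) i) (nth 0%MM (comps D) j).
have deg_nth (i : 'I_(size (comps D))) : (mdeg (nth 0%MM (comps D) i) < D)%N.
  by rewrite -mem_comps mem_nth.
have nth_eq (i j : 'I_(size (comps D))) :
    (nth 0%MM (comps D) i == nth 0%MM (comps D) j) = (i == j).
  by rewrite nth_uniq ?comps_uniq.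
have AB : A *m B = 1%:M.
  apply/matrixP => i j; rewrite !mxE; under eq_bigr do rewrite !mxE.
  rewrite -nth_eq -(mE_eM (deg_nth i) (deg_nth j)).
  by rewrite [RHS](big_nth 0%MM) big_mkord.
have ltx k : (mdeg k < D)%N -> (index k (comps D) < size (comps D))%N.
  by rewrite -mem_comps index_mem.
move/mulmx1C/matrixP/(_ (Ordinal (ltx u du)) (Ordinal (ltx v dv))): AB.
rewrite !mxE -nth_eq /= !nth_index ?mem_comps // => <-.
rewrite (big_nth 0%MM) big_mkord; apply: eq_bigr => i _.
by rewrite !mxE /= !nth_index ?mem_comps.
Qed.

End Expansions.

Lemma dhomog_meval (n : nat) (K : comNzRingType) d (p : {mpoly K[n]}) a x :
  p \is d.-homog -> p.@[fun i => a * x i] = a ^+ d * p.@[x].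
Proof.
move/dhomogP => hp; rewrite !mevalE mulr_sumr big_seq [RHS]big_seq; apply: eq_bigr => m hm.
under eq_bigr do rewrite exprMn.
by rewrite big_split /= prodrXr -mdegE (hp m hm) mulrCA.
Qed.

Lemma poly_eq_horner (K : numFieldType) (p g : {poly K}) :
  (forall a, a != 0 -> p.[a] = g.[a]) -> p = g.
Proof.
move=> h; apply/eqP; rewrite -subr_eq0; apply/negPn/negP => nz.
pose r := [seq (k.+1)%:R : K | k <- iota 0 (size (p - g)).+1].
have ur : uniq r.
  by rewrite map_inj_uniq ?iota_uniq // => i j /eqP; rewrite eqr_nat eqSS => /eqP.
have rr : all (root (p - g)) r.
  apply/allP => _ /mapP[k _ ->]; rewrite /root hornerD hornerN h ?subrr //.
  by rewrite pnatr_eq0.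
by have := max_poly_roots nz rr ur; rewrite size_map size_iota ltnNge leqnSn.
Qed.

Section PolynomialIdentity.
Variables (K : numFieldType) (q t : K) (n : nat).
Hypothesis qt_generic : generic q t.
Implicit Types (u v w z s : 'X_{1..n.+1}) (p g : {mpoly K[n.+1]}).

Local Notation sp := (spectral q t).
Local Notation comps := (@comps n).
Local Notation M := (@nM K q t n.+1).
Local Notation E := (@nE K q t n.+1).
Local Notation dd := (@nE_sp0 K q t n).
Local Notation ker := (ker qt_generic).
Local Notation eM := (eM qt_generic).

Definition hpoly w : {poly K} := hpoch q%:P t%:P 'X w.

Lemma hpoly_horner a w : (hpoly w).[a] = hpoch q t a w.
Proof.
rewrite -[LHS]/(horner_eval a (hpoly w)) hpoch_morph.
by rewrite /= /horner_eval !hornerC hornerX.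
Qed.

Lemma hpoly_neq0 w : hpoly w != 0.
Proof.
apply/prodf_neq0 => i _; apply/prodf_neq0 => k _.
apply: contra_eq_neq (oner_neq0 K) => /(congr1 (horner^~ 0)).
by rewrite hornerD hornerN !hornerM hornerX !mul0r hornerC subr0 horner0 => ->; rewrite eqxx.
Qed.

Variable D : nat.

(** The coefficient of M_v(<z>) in the kernel K_w(a<z>), as a polynomial in a, after E_u(a<z>) =
    a^|u| E_u(<z>) is expanded in the M_v. The cut-off D loses nothing when |w| < D. *)
Definition bpoly v w : {poly K} :=
  \sum_(u <- comps D) (eM u v * (M u).@[sp w] / dd u) *: 'X^(mdeg u).

Definition kpoly z w : {poly K} := \sum_(v <- comps D) (M v).@[sp z] *: bpoly v w.

Lemma kpoly_horner a z w : (mdeg w < D)%N ->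
  (kpoly z w).[a] = (ker w).@[fun i => a * sp z i].
Proof.
move=> dw; have -> : kpoly z w =
    \sum_(u <- comps D) ((E u).@[sp z] * (M u).@[sp w] / dd u) *: 'X^(mdeg u).
  rewrite /kpoly; under eq_bigr do rewrite scaler_sumr.
  rewrite exchange_big /=; apply: eq_comps => u du.
  rewrite (nE_eM qt_generic du) linear_sum !mulr_suml scaler_suml; apply: eq_bigr => v _.
  by rewrite /= [(_ *: M v).@[_]]mevalZ scalerA; congr (_ *: _); ring.
rewrite (kerE _ dw) horner_sum linear_sum; apply: eq_bigr => u _ /=.
rewrite [RHS]mevalZ hornerZ hornerXn (dhomog_meval a (sp z) (topM_homog qt_generic u)).
rewrite /nE_sp0 !(nE_topM qt_generic) (nM_lagrange qt_generic) !mevalZ /omega /topM_sp0.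
have h1 := mu_neq0 qt_generic u; have h2 := topM_sp0_neq0 qt_generic u.
rewrite /topM_sp0 in h2; move: (topM qt_generic u) h2 => F h2.
set c := mu q t u in h1 *; set f := F.@[_] in h2 *.
by field; rewrite h1 h2.
Qed.

Lemma kpoly_sym z w : (mdeg z < D)%N -> (mdeg w < D)%N ->
  hpoly z * kpoly z w = hpoly w * kpoly w z.
Proof.
move=> dz dw; apply: poly_eq_horner => a a0; rewrite !hornerM !hpoly_horner !kpoly_horner //.
by have := ksymC qt_generic a0 z w; rewrite /ksym mulrC => ->; rewrite mulrC.
Qed.

Lemma bpoly_le v w : (mdeg w <= mdeg v)%N -> (mdeg v < D)%N ->
  bpoly v w = ((M v).@[sp w] / dd v) *: 'X^(mdeg v).
Proof.
move=> wv dv; rewrite /bpoly (big_comps1 (w := v)) // => [|u du uv].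
  by rewrite eM_ge // eqxx mul1r.
have [wu|uw] := ltnP (mdeg w) (mdeg u).
  by rewrite nM_sp_lt // mulr0 mul0r scale0r.
by rewrite eM_ge ?(leq_trans uw) // eq_sym (negbTE uv) !mul0r scale0r.
Qed.

(** Induction on |v|. Expand both sides of (a)_v K_w(a<v>) = (a)_w K_v(a<w>): the terms with |u| <
    |v| agree by induction, and on each side only u = v remains, since M_u(<v>) = 0 for the other u
    with |u| >= |v| and then [bpoly u v] is 0 as well. *)
Lemma bpolyE v w : (mdeg v < D)%N -> (mdeg w < D)%N ->
  hpoly v * bpoly v w = ((M v).@[sp w] / dd v) *: ('X^(mdeg v) * hpoly w).
Proof.
have [k] := ubnP (mdeg v); elim: k v w => // k IH v w /ltnSE vk dv dw.
have [wv|vw] := leqP (mdeg w) (mdeg v).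
  rewrite bpoly_le // -scalerAr [hpoly v * _]mulrC.
  have [->//|wv'] := eqVneq w v.
  by rewrite nM_sp // (negbTE wv') mulr0 mul0r !scale0r.
have E1 z : kpoly v z = (M v).@[sp v] *: bpoly v z +
    \sum_(u <- comps D | (mdeg u < mdeg v)%N) (M u).@[sp v] *: bpoly u z.
  rewrite /kpoly (bigID (fun u : 'X_{1..n.+1} => mdeg u < mdeg v)%N) addrC; congr (_ + _).
  apply: big_comps_cond1 => // [|u]; first by rewrite ltnn.
  by rewrite -leqNgt => vu uv; rewrite nM_sp // eq_sym (negbTE uv) mulr0 scale0r.
have E2 : kpoly w v = (M v).@[sp w] *: bpoly v v +
    \sum_(u <- comps D | (mdeg u < mdeg v)%N) (M u).@[sp w] *: bpoly u v.
  rewrite /kpoly (bigID (fun u : 'X_{1..n.+1} => mdeg u < mdeg v)%N) addrC; congr (_ + _).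
  rewrite big_seq_cond [RHS](_ : _ = \sum_(u <- comps D | (u \in comps D) && (u == v)) (M u).@[sp w] *: bpoly u v).
    rewrite [LHS]big_mkcond [RHS]big_mkcond; apply: eq_bigr => u _.
    case: (boolP (u \in comps D)) => //=; rewrite mem_comps => du.
    case: (eqVneq u v) => [->|uv]; first by rewrite ltnn.
    case: ifP => //; rewrite -leqNgt => vu.
    by rewrite bpoly_le // (nM_sp qt_generic vu) eq_sym (negbTE uv) mulr0 mul0r scale0r scaler0.
  by rewrite -big_seq_cond (big_comps_cond1 (w := v)) // => u /eqP ->; rewrite eqxx.
have := kpoly_sym dv dw; rewrite E1 E2 !mulrDr.
have -> : hpoly v * (\sum_(u <- comps D | (mdeg u < mdeg v)%N) (M u).@[sp v] *: bpoly u w) =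
    hpoly w * (\sum_(u <- comps D | (mdeg u < mdeg v)%N) (M u).@[sp w] *: bpoly u v).
  rewrite !mulr_sumr; apply: eq_bigr => u uv; apply: (mulfI (hpoly_neq0 u)).
  transitivity ((M u).@[sp v] *: (hpoly v * (hpoly u * bpoly u w))).
    by rewrite -!(@scalerAr _ {poly K}) mulrCA.
  transitivity ((M u).@[sp w] *: (hpoly w * (hpoly u * bpoly u v))); last first.
    by rewrite -!(@scalerAr _ {poly K}) mulrCA.
  rewrite !IH ?(leq_trans uv vk) ?(ltn_trans uv dv) //.
  rewrite -!(@scalerAr _ {poly K}) !(@scalerA _ {poly K}).
  by congr (_ *: _); ring.
move/addIr; rewrite [bpoly v v]bpoly_le // -!(@scalerAr _ {poly K}) !(@scalerA _ {poly K}) => e.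
apply: (scalerI (nM_sp_neq0 qt_generic v)); rewrite e scalerA [hpoly w * _]mulrC.
by congr (_ *: _); ring.
Qed.

End PolynomialIdentity.

(** * Power series in a and b *)

Section FpsAlgebra.
Variable A : comNzRingType.
Implicit Types (f g : fps A) (p : {poly A}).

Lemma fcoefB f g i : fcoef (f - g) i = fcoef f i - fcoef g i. Proof. by []. Qed.
Lemma fcoefM f g i : fcoef (f * g) i = \sum_(j < i.+1) fcoef f j * fcoef g (i - j).
Proof. by []. Qed.

Lemma fcoef_sum (I : Type) (r : seq I) (P : pred I) (F : I -> fps A) i :
  fcoef (\sum_(k <- r | P k) F k) i = \sum_(k <- r | P k) fcoef (F k) i.
Proof. exact: (big_morph (fun f => fcoef f i)). Qed.

Lemma fcoefCM c f i : fcoef (fpsC c * f) i = c * fcoef f i.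
Proof.
rewrite fcoefM big_ord_recl /= subn0 big1 ?addr0 // => j _.
by rewrite mul0r.
Qed.

Lemma fcoefXM f i : fcoef (fpsX A * f) i = if i is i'.+1 then fcoef f i' else 0.
Proof.
rewrite fcoefM; case: i => [|i]; first by rewrite big_ord1 /= mul0r.
rewrite big_ord_recl /= mul0r add0r big_ord_recl /= mul1r subSS subn0.
by rewrite big1 ?addr0 // => j _; rewrite mul0r.
Qed.

Lemma fpsC_additive : additive (@fpsC A).
Proof. by move=> c d; apply/fpsP => -[|i] //=; rewrite subr0. Qed.

Lemma fpsC_multiplicative : multiplicative (@fpsC A).
Proof.
split=> [c d|]; last by apply/fpsP => -[|i].
by apply/fpsP => i; rewrite fcoefCM; case: i => //= i; rewrite mulr0.
Qed.

HB.instance Definition _ := GRing.isAdditive.Build A (fps A) (@fpsC A) fpsC_additive.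
HB.instance Definition _ :=
  GRing.isMultiplicative.Build A (fps A) (@fpsC A) fpsC_multiplicative.

Definition fps_of_poly p : fps A := Fps (fun i => p`_i).

Lemma fps_of_poly_additive : additive fps_of_poly.
Proof. by move=> p g; apply/fpsP => i /=; rewrite coefB. Qed.

Lemma fps_of_poly_multiplicative : multiplicative fps_of_poly.
Proof.
split=> [p g|]; apply/fpsP => i; first by rewrite fcoefM /= coefM.
by rewrite /= coef1.
Qed.

HB.instance Definition _ :=
  GRing.isAdditive.Build {poly A} (fps A) fps_of_poly fps_of_poly_additive.
HB.instance Definition _ :=
  GRing.isMultiplicative.Build {poly A} (fps A) fps_of_poly fps_of_poly_multiplicative.

Lemma fps_of_polyX : fps_of_poly 'X = fpsX A.
Proof. by apply/fpsP => i /=; rewrite coefX. Qed.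

Lemma fps_of_polyC c : fps_of_poly c%:P = fpsC c.
Proof. by apply/fpsP => i /=; rewrite coefC. Qed.

Lemma fcoef_expX_lt f n i : fcoef f 0 = 0 -> (i < n)%N -> fcoef (f ^+ n) i = 0.
Proof.
move=> f0; elim: n i => // n IH i; rewrite ltnS => ni; rewrite exprS fcoefM big1 // => j _.
case: (posnP j) => [->|j0]; first by rewrite f0 mul0r.
by rewrite IH ?mulr0 //; move: (ltn_ord j); lia.
Qed.

End FpsAlgebra.

(** The geometric series in h = 1 - f / f_0. As h has no constant term, its powers up to i determine
    the i-th coefficient. *)
Lemma fps_unitE (A : comUnitRingType) (f : fps A) :
  fcoef f 0 \is a GRing.unit -> f \is a GRing.unit.
Proof.
move=> u0; pose h : fps A := 1 - fpsC (fcoef f 0)^-1 * f.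
have h0 : fcoef h 0 = 0 by rewrite fcoefB fcoefCM mulVr // subrr.
pose g : fps A := Fps (fun i => fcoef (\sum_(k < i.+1) h ^+ k) i).
have gE i j : (i <= j)%N -> fcoef g i = fcoef (\sum_(k < j.+1) h ^+ k) i.
  move=> ij; rewrite /= !fcoef_sum -(big_mkord xpredT (fun k => fcoef (h ^+ k) i)).
  rewrite -(big_mkord xpredT (fun k => fcoef (h ^+ k) i)) [RHS](@big_cat_nat _ _ _ i.+1) //=.
  rewrite [X in _ = _ + X]big_nat [X in _ = _ + X]big1 ?addr0 // => k /andP[ik _].
  exact: fcoef_expX_lt.
have e : (1 - h) * g = 1.
  apply/fpsP => i; transitivity (fcoef ((1 - h) * \sum_(k < i.+1) h ^+ k) i).
    rewrite !fcoefM; apply: eq_bigr => j _; congr (_ * _).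
    by apply: gE; rewrite leq_subr.
  have -> : (1 - h) * \sum_(k < i.+1) h ^+ k = 1 - h ^+ i.+1.
    rewrite -[1 in RHS](expr1n _ i.+1) subrXX; congr (_ * _).
    by apply: eq_bigr => k _; rewrite expr1n mul1r.
  by rewrite fcoefB (@fcoef_expX_lt _ h) // subr0.
have : fpsC (fcoef f 0)^-1 * f * g = 1 by rewrite -[RHS]e /h opprB addrC subrK.
by rewrite mulrAC mulrC => e'; apply/unitrPr; exists (fpsC (fcoef f 0)^-1 * g).
Qed.

Section FpsMap.
Variables (A B : comNzRingType) (m : {rmorphism A -> B}).

Definition fps_map (f : fps A) : fps B := Fps (fun i => m (fcoef f i)).

Lemma fps_map_additive : additive fps_map.
Proof. by move=> f g; apply/fpsP => i /=; rewrite rmorphB. Qed.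

Lemma fps_map_multiplicative : multiplicative fps_map.
Proof.
split=> [f g|]; apply/fpsP => i; last by rewrite /= rmorph_nat.
by rewrite fcoefM /= rmorph_sum; apply: eq_bigr => j _; rewrite rmorphM.
Qed.

HB.instance Definition _ :=
  GRing.isAdditive.Build (fps A) (fps B) fps_map fps_map_additive.
HB.instance Definition _ :=
  GRing.isMultiplicative.Build (fps A) (fps B) fps_map fps_map_multiplicative.

End FpsMap.

Section Fps2.
Variable K : fieldType.

Definition in_a : fps K -> fps2 K := fps_map (@fpsC K).
HB.instance Definition _ := GRing.RMorphism.on in_a.

Definition in_b : fps K -> fps2 K := @fpsC (fps K).
HB.instance Definition _ := GRing.RMorphism.on in_b.

HB.instance Definition _ := GRing.RMorphism.copy (@cst K) (in_b \o @fpsC K).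

Lemma in_aX : in_a (fpsX K) = ser_a K.
Proof. by apply/fpsP => i; rewrite /= rmorph_nat. Qed.

Lemma in_bX : in_b (fpsX K) = ser_b K. Proof. by []. Qed.

Lemma in_aC c : in_a (fpsC c) = cst c.
Proof. by apply/fpsP => -[|i] //=; rewrite rmorph0. Qed.

Lemma in_bC c : in_b (fpsC c) = cst c. Proof. by []. Qed.

Lemma coef2_sum (I : Type) (r : seq I) (P : pred I) (F : I -> fps2 K) i j :
  coef2 (\sum_(k <- r | P k) F k) i j = \sum_(k <- r | P k) coef2 (F k) i j.
Proof. by rewrite /coef2 !fcoef_sum. Qed.

Lemma coef2M (f g : fps2 K) i j : coef2 (f * g) i j =
  \sum_(k < i.+1) \sum_(l < j.+1) coef2 f k l * coef2 g (i - k) (j - l).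
Proof. by rewrite /coef2 fcoefM fcoef_sum. Qed.

Lemma coef2_cstM c (f : fps2 K) i j : coef2 (cst c * f) i j = c * coef2 f i j.
Proof. by rewrite /coef2 !fcoefCM. Qed.

Lemma fps2P (f g : fps2 K) : (forall i j, coef2 f i j = coef2 g i j) -> f = g.
Proof. by move=> h; apply/fpsP => i; apply/fpsP => j; apply: h. Qed.

Lemma fps2_of_polyE (p : {poly {poly K}}) :
  fps2_of_poly p = fps_of_poly (map_poly (@fps_of_poly K) p).
Proof. by apply/fps2P => i j; rewrite /coef2 /= coef_map. Qed.

End Fps2.

(** * The polynomials E_{u/v}(a,b) and the identity on the grid *)

Section SkewPolynomials.
Variables (K : numFieldType) (q t : K) (n : nat).
Hypothesis qt_generic : generic q t.
Implicit Types (u v w z s r : 'X_{1..n.+1}) (p g : {mpoly K[n.+1]}).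

Local Notation sp := (spectral q t).
Local Notation comps := (@comps n).
Local Notation M := (@nM K q t n.+1).
Local Notation E := (@nE K q t n.+1).
Local Notation dd := (@nE_sp0 K q t n).
Local Notation eM := (eM qt_generic).
Local Notation mE := (mE qt_generic).
Local Notation hpoly := (@hpoly K q t n).

(** This is E_{s/v}(a,0) in the variable a, and [polyM u s] is E_{u/s}(0,b) in the variable b. Where
    the truncated subtraction of degrees would matter, the coefficient is zero. *)
Definition polyE s v : {poly K} := (dd v / dd s * eM s v) *: 'X^(mdeg s - mdeg v).
Definition polyM u s : {poly K} := (dd s / dd u * mE u s) *: 'X^(mdeg u - mdeg s).

Let dd0 u : dd u != 0. Proof. exact: nE_sp0_neq0. Qed.

Lemma hpoly_sum_polyE v w D : (mdeg v < D)%N -> (mdeg w < D)%N ->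
  hpoly v * \sum_(u <- comps D) (M u).@[sp w] *: polyE u v = (M v).@[sp w] *: hpoly w.
Proof.
move=> dv dw; have Xn0 : 'X^(mdeg v) != 0 :> {poly K} by rewrite monic_neq0 ?monicXn.
apply: (mulfI Xn0); rewrite mulrCA.
have -> : 'X^(mdeg v) * (\sum_(u <- comps D) (M u).@[sp w] *: polyE u v) =
    dd v *: bpoly qt_generic D v w.
  rewrite mulr_sumr scaler_sumr; apply: eq_bigr => u _.
  rewrite /polyE !(@scalerA _ {poly K}) -(@scalerAr _ {poly K}) -exprD.
  have [uv|vu] := ltnP (mdeg u) (mdeg v).
    by rewrite eM_gt // !(mulr0, mul0r) !scale0r.
  rewrite subnKC //; congr (_ *: _); have := dd0 u; set a := dd u; set b := dd v => a0.
  by field.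
rewrite -(@scalerAr _ {poly K}) bpolyE // (@scalerA _ {poly K}) mulrCA divff // mulr1.
by rewrite -(@scalerAr _ {poly K}).
Qed.

Lemma sum_polyE_polyM r s D : (mdeg r < D)%N -> (mdeg s < D)%N ->
  \sum_(u <- comps D) polyE r u * polyM u s = (r == s)%:R.
Proof.
move=> dr ds.
transitivity (\sum_(u <- comps D) (dd s / dd r * (eM r u * mE u s)) *: 'X^(mdeg r - mdeg s) : {poly K}).
  apply: eq_bigr => u _; rewrite /polyE /polyM -(@scalerAl _ {poly K}) -(@scalerAr _ {poly K}).
  rewrite (@scalerA _ {poly K}) -exprD.
  have [ru|ur] := ltnP (mdeg r) (mdeg u).
    by rewrite eM_gt // !(mulr0, mul0r) !scale0r.
  have [us|su] := ltnP (mdeg u) (mdeg s).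
    by rewrite mE_gt // !(mulr0, mul0r) !scale0r.
  have -> : (mdeg r - mdeg u + (mdeg u - mdeg s) = mdeg r - mdeg s)%N by lia.
  congr (_ *: _); have := dd0 u; have := dd0 r.
  by set a := dd u; set b := dd r => b0 a0; field; rewrite a0 b0.
rewrite -scaler_suml -mulr_sumr eM_mE //; case: eqP => [->|_]; last by rewrite mulr0 scale0r.
by rewrite subnn mulr1 divff // scale1r.
Qed.

Definition skew_poly u v : {poly {poly K}} :=
  \sum_(s <- comps (mdeg u).+1) (polyM u s)%:P * map_poly polyC (polyE s v).

Lemma skew_polyE u v D : (mdeg u < D)%N ->
  skew_poly u v = \sum_(s <- comps D) (polyM u s)%:P * map_poly polyC (polyE s v).
Proof.
move=> h; rewrite /skew_poly (big_comps_widen h) // => s hs.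
by rewrite /polyM mE_gt // mulr0 scale0r mul0r.
Qed.

(** The connection coefficients are factored through the E_s: these are homogeneous, so passing from
    ax to bx multiplies E_s by (a/b)^|s|. *)
Definition conn u a b v : K :=
  \sum_(s <- comps (mdeg u).+1) mE u s * (a / b) ^+ mdeg s * eM s v.

Lemma dilate_meval n' a (p : {mpoly K[n']}) x : (dilate a p).@[x] = p.@[fun i => a * x i].
Proof.
rewrite /dilate comp_mpoly_meval; apply: meval_eq => i.
by rewrite tnth_mktuple mevalZ mevalXU.
Qed.

Lemma conn_is_connection u a b : b != 0 -> is_connection q t u a b (conn u a b).
Proof.
move=> b0; exists (mdeg u).+1; split=> [v hv|].
  rewrite /conn big_seq big1 // => s; rewrite mem_comps => hs.
  by rewrite eM_gt ?mulr0 // (leq_trans hs).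
rewrite (big_comps _ (fun v => conn u a b v *: dilate b (M v))).
apply: (gridP qt_generic) => w; rewrite dilate_meval linear_sum /=.
rewrite {1}(nM_mE qt_generic (ltnSn (mdeg u))) linear_sum /=.
transitivity (\sum_(s <- comps (mdeg u).+1) \sum_(v <- comps (mdeg u).+1)
    mE u s * (a / b) ^+ mdeg s * eM s v * (M v).@[fun i => b * sp w i]).
  apply: eq_comps => s ds; rewrite [LHS]mevalZ (dhomog_meval a _ (nE_homog q t s)).
  have -> : a ^+ mdeg s = (a / b) ^+ mdeg s * b ^+ mdeg s by rewrite -exprMn divfK.
  rewrite -mulrA -(dhomog_meval b _ (nE_homog q t s)) {1}(nE_eM qt_generic ds).
  rewrite linear_sum !mulr_sumr; apply: eq_bigr => v _ /=.
  by rewrite [(_ *: M v).@[_]]mevalZ !mulrA.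
rewrite exchange_big; apply: eq_bigr => v _ /=.
by rewrite [RHS]mevalZ dilate_meval /conn mulr_suml.
Qed.

(** Evaluation at <w>/b turns M_v(bx) into M_v(<w>), and the M_v are independent on the grid; so any
    two expansions agree once their cut-offs are raised to a common one. *)
Lemma connection_conn u v a b : b != 0 -> connection q t u v a b = conn u a b v.
Proof.
move=> b0; rewrite /connection; case: xgetP => [c _|/(_ _ (conn_is_connection u a b0)) //].
case=> D [hD ec].
have [D' [hD' ec']] := conn_is_connection u a b0.
pose m := maxn (maxn D D') (mdeg v).+1.
suff : c v - conn u a b v = 0 by move/eqP; rewrite subr_eq0 => /eqP.
apply: (@nM_free _ _ _ _ qt_generic m (fun v => c v - conn u a b v)); last by rewrite leq_maxr.
move=> w _; rewrite linear_sum /=.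
under eq_bigr do rewrite [(_ *: M _).@[_]]mevalZ mulrBl.
rewrite sumrB.
have dil p : p.@[sp w] = (dilate b p).@[fun i => b^-1 * sp w i].
  by rewrite dilate_meval; apply: meval_eq => i; rewrite mulVKf.
have eqm (c0 : 'X_{1..n.+1} -> K) D0 : (D0 <= m)%N -> (forall v, (D0 <= mdeg v)%N -> c0 v = 0) ->
    dilate a (M u) = \sum_(v : 'X_{1..n.+1 < D0}) c0 v *: dilate b (M v) ->
    \sum_(v <- comps m) c0 v * (M v).@[sp w] = (dilate a (M u)).@[fun i => b^-1 * sp w i].
  move=> Dm h0 ->; rewrite (big_comps _ (fun v => c0 v *: dilate b (M v))).
  rewrite (big_comps_widen Dm) => [|v' hv]; last by rewrite h0 ?mul0r.
  by rewrite linear_sum; apply: eq_bigr => v' _; rewrite dil -mevalZ.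
by rewrite (eqm c D) ?(eqm (conn u a b) D') ?subrr // /m !leq_max leqnn ?orbT.
Qed.

Lemma skew_poly_horner u v a b : a != 0 -> b != 0 ->
  (skew_poly u v).[a%:P].[b] = skewE_at q t u v a b.
Proof.
move=> a0 b0; rewrite /skewE_at connection_conn //.
have hE x u' : (E u').@[fun i => sp (0%MM : 'X_{1..n.+1}) i / x] = x ^- mdeg u' * dd u'.
  rewrite -exprVn -(dhomog_meval _ _ (nE_homog q t u')).
  by apply: meval_eq => i; rewrite mulrC.
rewrite !hE /conn /skew_poly !horner_sum mulr_sumr; apply: eq_comps => s ds.
rewrite hornerM hornerC hornerM [(map_poly _ _).[_]]horner_map /= hornerC.
rewrite /polyM /polyE !hornerZ !hornerXn.
have [sv|vs] := ltnP (mdeg s) (mdeg v); first by rewrite eM_gt // !(mulr0, mul0r).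
have h1 : a ^+ mdeg s = a ^+ (mdeg s - mdeg v) * a ^+ mdeg v by rewrite -exprD subnK.
have h2 : b ^+ mdeg u = b ^+ (mdeg u - mdeg s) * b ^+ mdeg s by rewrite -exprD subnK.
rewrite expr_div_n h1 h2.
have := dd0 u; have := dd0 s; have := expf_neq0 (mdeg v) a0; have := expf_neq0 (mdeg s) b0.
have := expf_neq0 (mdeg u - mdeg s) b0.
set A := a ^+ mdeg v; set B := b ^+ mdeg s; set C := b ^+ (_ - _); set A' := a ^+ (_ - _).
set x := dd u; set y := dd s; set y' := dd v => C0 B0 A0 y0 x0.
by field; rewrite C0 B0 A0 y0 x0.
Qed.

(** The nonzero values of a and b are infinitely many, which is enough to determine a polynomial in
    both. *)
Lemma skewE_skew_poly u v : skewE q t u v = skew_poly u v.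
Proof.
have hsk : [set p : {poly {poly K}} | forall a b : K, a != 0 -> b != 0 ->
    p.[a%:P].[b] = skewE_at q t u v a b]%classic (skew_poly u v).
  by move=> a b a0 b0; apply: skew_poly_horner.
rewrite /skewE; case: xgetP => [p _ hp|/(_ _ hsk) //].
apply/eqP; rewrite -subr_eq0; apply/negPn/negP => nz.
set d := p - _ in nz *.
have hd a : a != 0 -> d.[a%:P] = 0.
  move=> a0; apply: poly_eq_horner => b b0.
  by rewrite hornerD hornerN hornerD hornerN hp // hsk // subrr horner0.
pose rs := [seq (k.+1)%:R%:P : {poly K} | k <- iota 0 (size d).+1].
have ur : uniq rs.
  rewrite map_inj_uniq ?iota_uniq // => i j /polyC_inj /eqP.
  by rewrite eqr_nat eqSS => /eqP.
have rr : all (root d) rs.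
  by apply/allP => _ /mapP[k _ ->]; rewrite /root hd // pnatr_eq0.
by have := max_poly_roots nz rr ur; rewrite size_map size_iota ltnNge leqnSn.
Qed.

Lemma coef2_skewE u v i j : (i + j < mdeg u - mdeg v)%N ->
  coef2 (fps2_of_poly (skewE q t u v)) i j = 0.
Proof.
move=> hij; rewrite skewE_skew_poly /coef2 /= /skew_poly !coef_sum big1 // => s _.
rewrite coefCM coef_map /= coefMC /polyM /polyE !coefZ !coefXn.
have [sv|vs] := ltnP (mdeg s) (mdeg v); first by rewrite eM_gt // !(mulr0, mul0r).
have [us|su] := ltnP (mdeg u) (mdeg s); first by rewrite mE_gt // !(mulr0, mul0r).
case: eqP => [e1|_]; last by rewrite mulr0 mul0r.
case: eqP => [e2|_]; last by rewrite !mulr0.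
lia.
Qed.

Definition fpsE s v : fps K := fps_of_poly (polyE s v).
Definition fpsM u s : fps K := fps_of_poly (polyM u s).
Definition fhpoch w : fps K := fps_of_poly (hpoly w).

Lemma fps2_skewE u v D : (mdeg u < D)%N ->
  fps2_of_poly (skewE q t u v) = \sum_(s <- comps D) in_b (fpsM u s) * in_a (fpsE s v).
Proof.
move=> du; rewrite skewE_skew_poly (skew_polyE v du) fps2_of_polyE.
rewrite -[fps_of_poly _]/((@fps_of_poly _ \o map_poly (@fps_of_poly K)) _) rmorph_sum.
apply: eq_bigr => s _; rewrite rmorphM /=; congr (_ * _).
  by rewrite map_polyC fps_of_polyC.
apply/fps2P => i j; rewrite /coef2 /= !coef_map /=.
by rewrite coefC.
Qed.

Lemma fhpoch_unit w : fhpoch w \is a GRing.unit.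
Proof.
apply: fps_unitE; rewrite /fhpoch /= -horner_coef0 hpoly_horner /hpoch.
rewrite big1 ?unitr1 // => i _; rewrite /qpoch big1 // => k _.
by rewrite !mul0r subr0.
Qed.

(** The case b = 0, used with b in place of a, replaces (b)_w M_u(<w>) / (b)_u by a sum of
    E_{r/u}(b,0) M_r(<w>). Summation over u cancels this matrix against its inverse [polyM], and the
    case b = 0 with parameter a finishes. *)
Lemma grid_identity v w D : (mdeg v < D)%N -> (mdeg w < D)%N ->
  (\sum_(u <- comps D) in_b (fhpoch v) / in_b (fhpoch u) *
      fps2_of_poly (skewE q t u v) * cst (M u).@[sp w]) *
    in_b (fhpoch w) * in_a (fhpoch v) =
  cst (M v).@[sp w] * in_b (fhpoch v) * in_a (fhpoch w).
Proof.
move=> dv dw.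
have I v' : (mdeg v' < D)%N -> \sum_(u <- comps D) fpsE u v' * fpsC (M u).@[sp w] =
    fpsC (M v').@[sp w] * fhpoch w / fhpoch v'.
  move=> dv'; apply: (canRL (mulrK (fhpoch_unit v'))); rewrite mulrC.
  have := congr1 (@fps_of_poly K) (hpoly_sum_polyE dv' dw).
  rewrite rmorphM rmorph_sum -!mul_polyC rmorphM /= fps_of_polyC => <-; congr (_ * _).
  by apply: eq_bigr => u _; rewrite -mul_polyC rmorphM /= fps_of_polyC mulrC.
have orth r s : (mdeg r < D)%N -> (mdeg s < D)%N ->
    \sum_(u <- comps D) fpsE r u * fpsM u s = fps_of_poly ((r == s)%:R).
  move=> dr ds; rewrite -(sum_polyE_polyM dr ds) rmorph_sum; apply: eq_bigr => u _.
  by rewrite rmorphM.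
have ub u : in_b (fhpoch u) \is a GRing.unit by rewrite rmorph_unit // fhpoch_unit.
have ua u : in_a (fhpoch u) \is a GRing.unit by rewrite rmorph_unit // fhpoch_unit.
have step u : (mdeg u < D)%N -> in_b (fhpoch v) / in_b (fhpoch u) *
      fps2_of_poly (skewE q t u v) * cst (M u).@[sp w] * in_b (fhpoch w) =
    in_b (fhpoch v) * \sum_(s <- comps D) \sum_(r <- comps D)
      in_b (fpsE r u * fpsM u s) * (in_a (fpsE s v) * cst (M r).@[sp w]).
  move=> du; have := congr1 (@in_b K) (I u du); rewrite rmorph_sum rmorphM rmorphV ?fhpoch_unit //.
  rewrite rmorphM => e.
  rewrite (fps2_skewE v du) -!mulrA; congr (_ * _).
  rewrite mulrC -!mulrA [cst _ * _]mulrA -[cst _]in_bC -e mulr_suml.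
  apply: eq_bigr => s _; rewrite mulr_sumr; apply: eq_bigr => r _.
  by rewrite !rmorphM /= in_bC; ring.
rewrite !mulr_suml (eq_comps (F' := fun u => in_b (fhpoch v) * (\sum_(s <- comps D) \sum_(r <- comps D)
      in_b (fpsE r u * fpsM u s) * (in_a (fpsE s v) * cst (M r).@[sp w])) * in_a (fhpoch v))); last first.
  by move=> u du; rewrite step.
rewrite -mulr_suml -mulr_sumr.
have -> : \sum_(u <- comps D) \sum_(s <- comps D) \sum_(r <- comps D)
      in_b (fpsE r u * fpsM u s) * (in_a (fpsE s v) * cst (M r).@[sp w]) =
    in_a (\sum_(s <- comps D) fpsE s v * fpsC (M s).@[sp w]).
  rewrite exchange_big rmorph_sum /=; apply: eq_comps => s ds.
  rewrite exchange_big /= (big_comps1 (w := s)) // => [|r dr rs].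
    rewrite -mulr_suml -rmorph_sum.
    have -> : \sum_(u <- comps D) fpsE s u * fpsM u s = 1.
      by rewrite orth // eqxx rmorph1.
    by rewrite rmorph1 mul1r rmorphM /= in_aC.
  rewrite -mulr_suml -rmorph_sum.
  have -> : \sum_(u <- comps D) fpsE r u * fpsM u s = 0.
    by rewrite orth // (negbTE rs) rmorph0.
  by rewrite rmorph0 mul0r.
rewrite I // rmorphM rmorphV ?fhpoch_unit // rmorphM /= in_aC.
by rewrite -!mulrA mulVr // mulr1; ring.
Qed.

End SkewPolynomials.

(** * Infinite products and the theorem *)

Lemma nth_sorted_geq (s : seq nat) c r : sorted geq s ->
  (count (fun x => c < x) s <= r < count (fun x => c <= x) s)%N -> nth 0%N s r = c.
Proof.
elim: s r => [|x s IH] r; first by case: r.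
move=> /= xs; have sx : all (geq x) s by apply: order_path_min xs => a b d /= h1 h2; apply: leq_trans h2 h1.
have ss : sorted geq s by apply: path_sorted xs.
have c0 d : (x < d)%N -> count (fun y => d <= y)%N s = 0%N.
  move=> xd; apply/eqP; rewrite -leqn0 leqNgt -has_count; apply/hasPn => y /(allP sx) /= h.
  by rewrite -ltnNge (leq_ltn_trans h).
case: (ltngtP x c) => [xc|cx|exc].
- by rewrite (c0 c xc) ltn0 andbF.
- by case: r => [|r] //=; rewrite !add1n !ltnS => h; apply: IH.
- subst c; have e : count (fun y => x < y)%N s = 0%N by apply: (c0 x.+1).
  rewrite e; case: r => [|r] //=; rewrite add1n ltnS => h.
  by apply: IH => //; rewrite e.
Qed.

Section SpectralRank.
Variable n : nat.
Implicit Types (u : 'X_{1..n.+1}) (i j : 'I_n.+1).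

Lemma spec_exp_lt u i j : (u i < u j)%N || ((j < i)%N && (u i == u j)) ->
  (spec_exp u i < spec_exp u j)%N.
Proof.
move=> h; rewrite !spec_expE (bigD1 i) //= [X in (_ < X)%N](bigD1 i) //= !ltnn h /= add0n add1n ltnS.
apply: leq_sum => k ki.
have imp : (u k < u i)%N || ((i < k)%N && (u k == u i)) ->
    (u k < u j)%N || ((j < k)%N && (u k == u j)) by move: h; clear; lia.
by case: (_ || _) imp => // ->.
Qed.

Lemma spec_exp_inj u : injective (spec_exp u).
Proof.
move=> i j e; case: (eqVneq i j) => // ij.
have [h|h] : ((u i < u j)%N || ((j < i)%N && (u i == u j))) \/
    ((u j < u i)%N || ((i < j)%N && (u j == u i))).
- by move: ij; rewrite -val_eqE /= neq_ltn; case: (ltngtP (u i) (u j)); case: (ltngtP i j); auto.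
- by move/spec_exp_lt: h; rewrite e ltnn.
- by move/spec_exp_lt: h; rewrite e ltnn.
Qed.

Lemma count_mnm u (a : pred nat) : count a u = (\sum_i a (u i))%N.
Proof.
rewrite -sum1_count big_tuple big_mkcond; apply: eq_bigr => i _.
by rewrite -mnm_tnth; case: (a _).
Qed.

Lemma sum_pred_leq (a : pred 'I_n.+1) : (\sum_i a i + \sum_i ~~ a i = n.+1)%N.
Proof.
rewrite -big_split /= -[RHS]card_ord -sum1_card; apply: eq_bigr => i _.
by case: (a i).
Qed.

Lemma spec_exp_leq u i : (spec_exp u i <= n)%N.
Proof.
have e1 : (\sum_k (k == i) = 1)%N.
  by rewrite (bigD1 i) //= eqxx big1 // => k /negbTE ->.
have := sum_pred_leq (pred1 i); rewrite /= e1 add1n => -[e2].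
apply: (@leq_trans (\sum_k ~~ (k == i))%N); last by rewrite e2.
rewrite spec_expE; apply: leq_sum => k _; case: (eqVneq k i) => [->|_]; first by rewrite !ltnn.
by case: (_ || _).
Qed.

(** The entries above u_i and those counted by [spec_exp] are disjoint and omit i, while the entries
    at least u_i together with the counted ones cover everything. Hence place n - k_i falls in the
    block of entries equal to u_i. *)
Lemma nth_sort_spec u i : nth 0%N (sort geq u) (n - spec_exp u i) = u i.
Proof.
apply: nth_sorted_geq.
  by apply: sort_sorted => a b; exact: leq_total.
rewrite !count_sort !count_mnm.
have h1 : (\sum_k (u i < u k) + spec_exp u i < n.+1)%N.
  rewrite -[X in (_ < X)%N](sum_pred_leq (fun k => u i < u k)%N) ltn_add2l.
  rewrite spec_expE (bigD1 i) //= [X in (_ < X)%N](bigD1 i) //= !ltnn /= add0n add1n ltnS.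
  apply: leq_sum => k _; rewrite -leqNgt.
  have imp : (u k < u i)%N || ((i < k)%N && (u k == u i)) -> (u k <= u i)%N by clear; lia.
  by case: (_ || _) imp => // ->.
have h2 : (n < \sum_k (u i <= u k) + spec_exp u i)%N.
  apply: (@leq_trans (\sum_k (u i <= u k)%N + \sum_k ~~ (u i <= u k)%N)%N).
    by rewrite (sum_pred_leq (fun k => u i <= u k)%N).
  rewrite leq_add2l spec_expE; apply: leq_sum => k _; rewrite -ltnNge.
  by case: (u k < u i)%N.
move: h1 h2 (spec_exp_leq u i).
set a := (\sum_k _)%N; set b := (\sum_k _)%N; lia.
Qed.

Lemma big_sort_spec (R : Type) (idx : R) (op : Monoid.com_law idx) u
    (F : nat -> nat -> R) :
  \big[op/idx]_(i < n.+1) F (n - i)%N (nth 0%N (sort geq u) i) =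
  \big[op/idx]_i F (spec_exp u i) (u i).
Proof.
pose rank i : 'I_n.+1 := inord (n - spec_exp u i).
have rankE i : rank i = (n - spec_exp u i)%N :> nat by rewrite inordK // ltnS leq_subr.
rewrite (reindex_inj (h := rank)) => [|i j /(congr1 val)]; last first.
  rewrite /= !rankE => e; apply: (@spec_exp_inj u).
  by move: e (spec_exp_leq u i) (spec_exp_leq u j); lia.
by apply: eq_bigr => i _; rewrite rankE nth_sort_spec subKn // spec_exp_leq.
Qed.

End SpectralRank.

(** * Infinite products as power series *)

Section QPochhammerLimit.
Local Open Scope classical_set_scope.
Variables (K : numFieldType) (q : K).
Hypothesis q_unity : forall i, 1 - q ^+ i.+1 != 0.
Hypothesis q_cvg : (fun N => q ^+ N : K) @ \oo --> (0 : K).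

Definition fin_poch N c : {poly K} := \prod_(k < N) (1 - (c * q ^+ k) *: 'X).

(* The coefficients in Euler's expansion of the infinite product. *)
Fixpoint euler i : K := if i is i'.+1 then - q ^+ i' / (1 - q ^+ i) * euler i' else 1.

Lemma coef_mul_lin (p : {poly K}) c i :
  (p * (1 - c *: 'X))`_i.+1 = p`_i.+1 - c * p`_i.
Proof. by rewrite mulrBr mulr1 coefB -scalerAr coefZ coefMX. Qed.

Lemma coef0_fin_poch N c : (fin_poch N c)`_0 = 1.
Proof.
rewrite -horner_coef0 horner_prod big1 // => k _.
by rewrite hornerD hornerN hornerZ hornerX mulr0 subr0 hornerC.
Qed.

Lemma fin_pochS N c : fin_poch N.+1 c = fin_poch N c * (1 - (c * q ^+ N) *: 'X).
Proof. by rewrite /fin_poch big_ord_recr. Qed.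

Lemma fin_pochSl N c : fin_poch N.+1 c = fin_poch N (c * q) * (1 - c *: 'X).
Proof.
rewrite /fin_poch big_ord_recl expr0 mulr1 mulrC; congr (_ * _).
by apply: eq_bigr => k _; rewrite exprS mulrA.
Qed.

Lemma coef_fin_poch N c i : (fin_poch N c)`_i = c ^+ i * (fin_poch N 1)`_i.
Proof.
elim: N i => [|N IH] [|i]; rewrite ?coef0_fin_poch ?mulr1 //.
  by rewrite /fin_poch !big_ord0 coef1 mulr0.
by rewrite !fin_pochS !coef_mul_lin (IH i) (IH i.+1) mul1r exprS; ring.
Qed.

(** The product of N + 1 factors is split in two ways, at its last factor and at its first; the
    second leaves the product at q, whose i-th coefficient is q^i times the old one. This is the
    recursion of the q-binomial theorem. *)
Lemma fin_poch_rec N i :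
  (fin_poch N 1)`_i.+1 = (q ^+ N - q ^+ i) / (1 - q ^+ i.+1) * (fin_poch N 1)`_i.
Proof.
have := fin_pochS N 1; rewrite fin_pochSl !mul1r => /(congr1 (fun p : {poly K} => p`_i.+1)).
rewrite !coef_mul_lin ![(fin_poch N q)`__]coef_fin_poch mul1r => e.
have h := q_unity i; apply: (mulfI h).
rewrite mulrA [_ * (_ / _)]mulrCA mulfV // mulr1.
move: e; set a := _`_i.+1; set b := _`_i; set Q := q ^+ i.+1; set p := q ^+ i => e.
apply/eqP; rewrite -subr_eq0.
have -> : (1 - Q) * a - (q ^+ N - p) * b = a - q ^+ N * b - (Q * a - p * b) by ring.
by rewrite e subrr.
Qed.

Lemma fin_poch_cvg i : (fun N => (fin_poch N 1)`_i : K) @ \oo --> (euler i : K).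
Proof.
elim: i => [|i IH].
  by rewrite (_ : (fun N => _) = fun=> 1); [exact: cvg_cst | apply/funext => N; rewrite coef0_fin_poch].
rewrite (_ : (fun N => _) = fun N => (q ^+ N - q ^+ i) / (1 - q ^+ i.+1) * (fin_poch N 1)`_i); last first.
  by apply/funext => N; rewrite fin_poch_rec.
have -> : euler i.+1 = (0 - q ^+ i) / (1 - q ^+ i.+1) * euler i by rewrite sub0r.
apply: cvgM => //; apply: cvgM; last exact: cvg_cst.
by apply: cvgB => //; exact: cvg_cst.
Qed.

Definition poch_inf c : fps K := Fps (fun i => c ^+ i * euler i).

Lemma poch_inf_lim c i : limn (fun N => (fin_poch N c)`_i : K) = fcoef (poch_inf c) i.
Proof.
apply: cvg_lim; first exact: norm_hausdorff.
rewrite (_ : (fun N => _) = fun N => c ^+ i * (fin_poch N 1)`_i); last first.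
  by apply/funext => N; rewrite coef_fin_poch.
by apply: cvgM; [exact: cvg_cst | exact: fin_poch_cvg].
Qed.

Lemma poch_infE c : poch_inf c = (1 - fpsC c * fpsX K) * poch_inf (c * q).
Proof.
apply/fpsP => i; rewrite mulrBl mul1r fcoefB -mulrA fcoefCM fcoefXM.
case: i => [|i] /=; first by rewrite !expr0 mulr0 subr0.
have h := q_unity i; rewrite !exprMn !exprS; rewrite exprS in h.
by field.
Qed.

Lemma poch_inf_unit c : poch_inf c \is a GRing.unit.
Proof. by apply: fps_unitE; rewrite /= expr0 mulr1 unitr1. Qed.

Lemma qpoch_in (m : {rmorphism fps K -> fps2 K}) c N :
  (forall d, m (fpsC d) = cst d) ->
  qpoch (cst q) (m (fpsX K) * cst c) N = m (fps_of_poly (fin_poch N c)).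
Proof.
move=> mC; rewrite /fin_poch !rmorph_prod; apply: eq_bigr => k _.
rewrite -mul_polyC !rmorphB !rmorph1 !rmorphM /= fps_of_polyC fps_of_polyX mC.
by rewrite fps_of_polyC mC (rmorphXn (@cst K)) /=; ring.
Qed.

Lemma qpoch_inf_a c : qpoch_inf q (ser_a K * cst c) = in_a (poch_inf c).
Proof.
apply/fps2P => i j; rewrite /coef2 /=.
rewrite (_ : (fun N => _) = fun N => if j == 0%N then (fin_poch N c)`_i else 0); last first.
  apply/funext => N; rewrite -in_aX (qpoch_in (m := @in_a K)) //.
  exact: in_aC.
case: eqP => _; first exact: poch_inf_lim.
by apply: cvg_lim; [exact: norm_hausdorff | exact: cvg_cst].
Qed.

Lemma qpoch_inf_b c : qpoch_inf q (ser_b K * cst c) = in_b (poch_inf c).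
Proof.
apply/fps2P => i j; rewrite /coef2 /=.
rewrite (_ : (fun N => _) = fun N => if i == 0%N then (fin_poch N c)`_j else 0); last first.
  apply/funext => N; rewrite -in_bX (qpoch_in (m := @in_b K)) //.
  by rewrite /coef2 /=; case: ifP.
case: eqP => _ /=; first exact: poch_inf_lim.
by apply: cvg_lim; [exact: norm_hausdorff | exact: cvg_cst].
Qed.

End QPochhammerLimit.

Lemma complex_expr_cvg (R : realType) (K := complex R : numFieldType) (q : K) :
  `|q| < 1 -> ((fun N => q ^+ N : K) @ \oo --> (0 : K))%classic.
Proof.
move=> q1; pose r : R := complex.Re `|q|.
have nq : `|q| = (r%:C)%C by rewrite /r normc_def.
have r0 : 0 <= r by have := normr_ge0 q; rewrite nq lecR.
have r1 : r < 1 by move: q1; rewrite nq -[1]/(1%:C)%C ltcR.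
have hr : ((fun N => r ^+ N : R) @ \oo --> (0 : R))%classic.
  by apply: cvg_expr; rewrite ger0_norm.
apply/cvgrPdist_lt => e e0.
have ee : e = ((complex.Re e)%:C)%C.
  by move: e0; rewrite ltcE => /andP[/eqP /= h _]; case: e h => a b /= ->.
have Re0 : 0 < complex.Re e by move: e0; rewrite {1}ee ltcR.
move/cvgrPdist_lt: hr => /(_ _ Re0); apply: filterS => N.
rewrite sub0r normrN ger0_norm ?exprn_ge0 // => h.
have key : `|q ^+ N| < e by rewrite normrX nq ee -rmorphXn ltcR.
by rewrite sub0r normrN.
Qed.

(** * Series with coefficients polynomial in x *)

Section PolynomialFamilies.
Variables (K : numFieldType) (n : nat).
Implicit Types f g : ('I_n.+1 -> K) -> fps2 K.

(** The degree of p may grow with i and j: [gridP] asks for no bound. *)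
Definition polyfam f := forall i j, exists p : {mpoly K[n.+1]},
  forall x, coef2 (f x) i j = p.@[x].

Lemma polyfam_const (c : fps2 K) : polyfam (fun=> c).
Proof. by move=> i j; exists (coef2 c i j)%:MP => x; rewrite mevalC. Qed.

Lemma polyfam_meval (p : {mpoly K[n.+1]}) : polyfam (fun x => cst p.@[x]).
Proof.
move=> i j; exists (if (i == 0%N) && (j == 0%N) then p else 0) => x.
rewrite /coef2 /=; case: i => [|i] /=; last by rewrite meval0.
by case: j => [|j]; rewrite ?meval0.
Qed.

Lemma polyfamM f g : polyfam f -> polyfam g -> polyfam (fun x => f x * g x).
Proof.
move=> hf hg i j.
pose pf k l := projT1 (cid (hf k l)); pose pg k l := projT1 (cid (hg k l)).
exists (\sum_(k < i.+1) \sum_(l < j.+1) pf k l * pg (i - k)%N (j - l)%N) => x.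
rewrite coef2M rmorph_sum; apply: eq_bigr => k _; rewrite rmorph_sum.
apply: eq_bigr => l _; rewrite rmorphM /=; congr (_ * _).
  by rewrite /pf; case: cid => p /= ->.
by rewrite /pg; case: cid => p /= ->.
Qed.

Lemma polyfam_prod (I : Type) (r : seq I) (F : I -> ('I_n.+1 -> K) -> fps2 K) :
  (forall i, polyfam (F i)) -> polyfam (fun x => \prod_(i <- r) F i x).
Proof.
move=> hF; elim: r => [|i r IH].
  by move=> k l; have [p hp] := polyfam_const 1 k l; exists p => x; rewrite big_nil -(hp x).
by move=> k l; have [p hp] := polyfamM (hF i) IH k l; exists p => x; rewrite big_cons hp.
Qed.

Lemma polyfam_in_a q i : polyfam (fun x => in_a (poch_inf q (x i))).
Proof.
move=> k l; exists (if l == 0%N then euler q k *: 'X_i ^+ k else 0) => x.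
rewrite /coef2 /=; case: eqP => _; last by rewrite meval0.
by rewrite mevalZ rmorphXn /= mevalXU mulrC.
Qed.

Lemma polyfam_in_b q i : polyfam (fun x => in_b (poch_inf q (x i))).
Proof.
move=> k l; exists (if k == 0%N then euler q l *: 'X_i ^+ l else 0) => x.
rewrite /coef2 /=; case: eqP => _ /=; last by rewrite meval0.
by rewrite mevalZ rmorphXn /= mevalXU mulrC.
Qed.

Lemma polyfam_eq q t f g : generic q t -> polyfam f -> polyfam g ->
  (forall w : 'X_{1..n.+1}, f (spectral q t w) = g (spectral q t w)) -> forall x, f x = g x.
Proof.
move=> qt hf hg h x; apply: fps2P => i j.
have [p hp] := hf i j; have [r hr] := hg i j; rewrite hp hr; congr meval.
by apply: (gridP qt) => w; rewrite -hp -hr h.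
Qed.

End PolynomialFamilies.

Lemma coef2M_eq0 (K : fieldType) (f g : fps2 K) i j :
  (forall k l, (k <= i)%N -> (l <= j)%N -> coef2 g k l = 0) -> coef2 (f * g) i j = 0.
Proof.
move=> h; rewrite coef2M big1 // => k _; rewrite big1 // => l _.
by rewrite h ?mulr0 ?leq_subr.
Qed.

Section SpectralGrid.
Variables (K : numFieldType) (q t : K) (n : nat).
Hypothesis qt_generic : generic q t.
Hypothesis q_cvg : ((fun N => q ^+ N : K) @ \oo --> (0 : K))%classic.
Implicit Types (u v w : 'X_{1..n.+1}) (x : 'I_n.+1 -> K).

Local Notation sp := (spectral q t).
Local Notation comps := (@comps n).
Local Notation M := (@nM K q t n.+1).
Local Notation fhpoch := (@fhpoch K q t n).
Local Notation gpoch := (poch_inf q).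

Lemma q_not_unity i : 1 - q ^+ i.+1 != 0.
Proof.
rewrite subr_eq0; apply/eqP => e.
have e' : q ^+ 0 * t ^+ 0 = q ^+ i.+1 * t ^+ 0 by rewrite -e !expr0.
by have [] := generic_exp qt_generic e'.
Qed.

Lemma qpoch_comp_fhpoch u :
  qpoch_comp q t (ser_b K * cst (t ^+ n)) u = in_b (fhpoch u).
Proof.
rewrite /fhpoch /hpoly -[in_b _]/((@in_b K \o @fps_of_poly K) _) hpoch_morph /hpoch.
rewrite /= !fps_of_polyC fps_of_polyX !in_bC in_bX.
rewrite -(big_sort_spec _ u (fun k c => qpoch (cst q) (ser_b K * cst t ^+ k) c)).
have t0 : t != 0 by case: qt_generic.
have e (i : 'I_n.+1) : ser_b K * cst (t ^+ n) * cst (t ^- i) = ser_b K * cst t ^+ (n - i).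
  rewrite -mulrA -(rmorphM (@cst K)) -(rmorphXn (@cst K)) /=; congr (_ * cst _).
  by rewrite -{1}(@subnK i n) ?exprD ?mulfK ?expf_neq0 // -ltnS.
by apply: eq_bigr => i _; rewrite e.
Qed.

Definition spoch w : fps K := \prod_i gpoch (sp w i).

Lemma fhpoch_cshift w : fhpoch (cshift w) = (1 - fpsC (sp w ord0) * fpsX K) * fhpoch w.
Proof.
rewrite /fhpoch /hpoly hpoch_cshift rmorphM rmorphB rmorph1; congr ((1 - _) * _).
by rewrite -!rmorphXn -rmorphM /= rmorphM /= fps_of_polyC fps_of_polyX mulrC.
Qed.

(** A [cshift] replaces <w>_0 by q<w>_0, removing the first factor of that infinite product; the
    same factor is gained by the finite symbol. *)
Lemma spoch_fhpoch w : spoch w * fhpoch w = spoch 0%MM.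
Proof.
elim/comp_ind: w => [|w <-|w r rn h0 h1 _ <-].
- by rewrite /fhpoch /hpoly hpoch0 rmorph1 mulr1.
- rewrite fhpoch_cshift mulrA; congr (_ * _); rewrite /spoch.
  rewrite -[RHS](big_ordS _ (fun i => gpoch (sp w i))).
  rewrite (bigD1 ord_max) //= [RHS](bigD1 ord_max) //= ordS_max sp_cshift_max.
  rewrite [gpoch (sp w ord0)](poch_infE q_not_unity) [sp w ord0 * q]mulrC [LHS]mulrC [LHS]mulrA.
  congr (_ * _); apply: eq_bigr => i hi.
  by rewrite sp_cshift (negbTE hi) mul1r.
- congr (_ * _); last by rewrite /fhpoch /hpoly hpoch_cswap.
  rewrite /spoch [RHS](reindex_inj (@perm_inj _ (swap n r))) /=; apply: eq_bigr => i _.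
  by rewrite (sp_cswap _ _ rn) // h0 eq_sym -lt0n.
Qed.

Section Series.
Variable v : 'X_{1..n.+1}.

Definition series_term x u : fps2 K :=
  qpoch_comp q t (ser_b K * cst (t ^+ n)) v / qpoch_comp q t (ser_b K * cst (t ^+ n)) u *
    fps2_of_poly (skewE q t u v) * cst (M u).@[x].

Lemma coef2_series_term x u i j : (i + j + mdeg v < mdeg u)%N ->
  coef2 (series_term x u) i j = 0.
Proof.
move=> h; rewrite /series_term mulrAC; apply: coef2M_eq0 => k l ki lj.
by apply: (coef2_skewE qt_generic); lia.
Qed.

(** E_{u/v} is homogeneous of degree |u| - |v|, so compositions with |u| > i + j + |v| do not reach
    a^i b^j. *)
Definition series_sum x : fps2 K := Fps (fun i => Fps (fun j =>
  \sum_(u <- comps (i + j + mdeg v).+1) coef2 (series_term x u) i j)).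

Lemma polyfam_series_sum : polyfam series_sum.
Proof.
move=> i j; pose c u := qpoch_comp q t (ser_b K * cst (t ^+ n)) v /
  qpoch_comp q t (ser_b K * cst (t ^+ n)) u * fps2_of_poly (skewE q t u v).
exists (\sum_(u <- comps (i + j + mdeg v).+1) coef2 (c u) i j *: M u) => x.
rewrite /coef2 /= linear_sum /=; apply: eq_bigr => u _.
by rewrite [RHS]mevalZ /series_term mulrC -[RHS]mulrC -[LHS]/(coef2 _ i j) coef2_cstM.
Qed.

(** At <w> the sum is also cut off by M_u(<w>) = 0, uniformly in i and j; both truncations are
    compared with a larger one. *)
Lemma series_sum_sp w D : (mdeg w < D)%N ->
  series_sum (sp w) = \sum_(u <- comps D) series_term (sp w) u.
Proof.
move=> wD; apply: fps2P => i j; rewrite coef2_sum /coef2 /= -/(coef2 _ _ _).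
set D' := (_ + _ + _).+1; pose m := maxn D D'.
transitivity (\sum_(u <- comps m) coef2 (series_term (sp w) u) i j).
  rewrite [RHS](big_comps_widen (D1 := D')) ?leq_maxr // => u hu.
  exact: coef2_series_term.
rewrite (big_comps_widen (D1 := D)) ?leq_maxl // => u hu.
rewrite /series_term nM_sp_lt ?(leq_trans wD) //.
by rewrite [_ * _]mulrC coef2_cstM mul0r.
Qed.

Lemma series_sum_grid w :
  series_sum (sp w) * (in_b (spoch v) * in_a (spoch w)) =
  cst (M v).@[sp w] * (in_a (spoch v) * in_b (spoch w)).
Proof.
pose D := (maxn (mdeg v) (mdeg w)).+1.
have vD : (mdeg v < D)%N by rewrite ltnS leq_maxl.
have wD : (mdeg w < D)%N by rewrite ltnS leq_maxr.
have ub u : in_b (fhpoch u) \is a GRing.unit by rewrite rmorph_unit // fhpoch_unit.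
have ua u : in_a (fhpoch u) \is a GRing.unit by rewrite rmorph_unit // fhpoch_unit.
have [S eS] : exists S, S = \sum_(u <- comps D) series_term (sp w) u by eexists.
rewrite (series_sum_sp wD) -eS.
have eS' : S = \sum_(u <- comps D) in_b (fhpoch v) / in_b (fhpoch u) *
    fps2_of_poly (skewE q t u v) * cst (M u).@[sp w].
  by rewrite eS; apply: eq_bigr => u _; rewrite /series_term !qpoch_comp_fhpoch.
have e : S * in_b (fhpoch w) * in_a (fhpoch v) =
    cst (M v).@[sp w] * in_b (fhpoch v) * in_a (fhpoch w).
  by rewrite eS'; exact: grid_identity.
apply: (mulIr (ub w)); apply: (mulIr (ua v)).
have Eb u : in_b (spoch u) * in_b (fhpoch u) = in_b (spoch 0%MM) by rewrite -rmorphM spoch_fhpoch.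
have Ea u : in_a (spoch u) * in_a (fhpoch u) = in_a (spoch 0%MM) by rewrite -rmorphM spoch_fhpoch.
transitivity (S * in_b (fhpoch w) * in_a (fhpoch v) * (in_b (spoch v) * in_a (spoch w))).
  by ring.
rewrite e.
transitivity (cst (M v).@[sp w] * (in_b (spoch v) * in_b (fhpoch v)) *
  (in_a (spoch w) * in_a (fhpoch w))); first by ring.
rewrite Eb Ea -(Eb w) -(Ea v); ring.
Qed.

(** With denominators cleared, both sides are products of families with polynomial coefficients, so
    the equality on the grid extends to all x. *)
Lemma series_sumE x :
  series_sum x * (in_b (spoch v) * \prod_i in_a (gpoch (x i))) =
  cst (M v).@[x] * (in_a (spoch v) * \prod_i in_b (gpoch (x i))).
Proof.
apply: (polyfam_eq (f := fun x => series_sum x * (in_b (spoch v) * \prod_i in_a (gpoch (x i))))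
  (g := fun x => cst (M v).@[x] * (in_a (spoch v) * \prod_i in_b (gpoch (x i)))) qt_generic).
- apply: polyfamM; first exact: polyfam_series_sum.
  apply: polyfamM; first exact: polyfam_const.
  by apply: polyfam_prod => i; apply: polyfam_in_a.
- apply: polyfamM; first exact: polyfam_meval.
  apply: polyfamM; first exact: polyfam_const.
  by apply: polyfam_prod => i; apply: polyfam_in_b.
by move=> w; rewrite -!rmorph_prod series_sum_grid.
Qed.

End Series.
End SpectralGrid.

Lemma prod_unitV (A : comUnitRingType) (I : Type) (r : seq I) (F : I -> A) :
  (forall i, F i \is a GRing.unit) -> \prod_(i <- r) (F i)^-1 = (\prod_(i <- r) F i)^-1.
Proof.
move=> hF; elim: r => [|i r IH]; first by rewrite !big_nil invr1.
rewrite !big_cons invrM ?hF ?IH 1?mulrC //.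
by apply: rpred_prod => j _; apply: hF.
Qed.

Lemma mul_eq_subst (A : pzRingType) (S c h h' k k' f f' g g' : A) :
  h = h' -> k = k' -> f = f' -> g = g' ->
  S * (h' * k') = c * (f' * g') -> S * (h * k) = c * (f * g).
Proof. by move=> -> -> -> ->. Qed.

Lemma prod_quot (A : comUnitRingType) n (f g h k : 'I_n -> A) :
  (forall i, h i \is a GRing.unit) -> (forall i, k i \is a GRing.unit) ->
  \prod_i ((f i * g i) / (h i * k i)) =
  (\prod_i f i * \prod_i g i) / (\prod_i k i * \prod_i h i).
Proof.
move=> hu ku; rewrite big_split /= prod_unitV => [|i]; last by rewrite unitrM hu ku.
by rewrite !big_split /= [X in _ / X]mulrC.
Qed.

Lemma prod_quot_solve (A : comUnitRingType) n (S c : A) (f g h k : 'I_n -> A) :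
  (forall i, h i \is a GRing.unit) -> (forall i, k i \is a GRing.unit) ->
  S * (\prod_i h i * \prod_i k i) = c * (\prod_i f i * \prod_i g i) ->
  S = c * \prod_i ((f i * g i) / (h i * k i)).
Proof.
move=> hu ku e; have u : \prod_i k i * \prod_i h i \is a GRing.unit.
  by rewrite unitrM; apply/andP; split; apply: rpred_prod.
by rewrite prod_quot // mulrA -e [\prod_i h i * _]mulrC mulrK.
Qed.

Lemma sigma_differences (K : numFieldType) (q : K) n (a b : fps2 K) (X V : 'I_n -> fps2 K) :
  sigma q 1 (alph_mul (alph_sub (letter a) (letter b)) (alph_sub (alph_sum X) (alph_sum V))) =
  (\prod_i qpoch_inf q (a * V i) * \prod_i qpoch_inf q (b * X i)) /
  (\prod_i qpoch_inf q (a * X i) * \prod_i qpoch_inf q (b * V i)).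
Proof.
have E c (Y : 'I_n -> fps2 K) :
    \prod_(y <- [seq c * z | z <- [seq Y i | i <- enum 'I_n]]) qpoch_inf q (1 * y) =
    \prod_i qpoch_inf q (c * Y i).
  by rewrite 2!big_map big_enum; apply: eq_bigr => i _; rewrite mul1r.
by rewrite /sigma /alph_mul /= !cats0 !big_cat (E a X) (E b V) (E a V) (E b X).
Qed.

Section GeneratingFunction.
Variables (K : numFieldType) (q t : K) (n : nat).
Hypothesis qt_generic : generic q t.
Hypothesis q_cvg : ((fun N => q ^+ N : K) @ \oo --> (0 : K))%classic.
Variables (v : 'X_{1..n.+1}) (x : 'I_n.+1 -> K).

Let q_unity := q_not_unity qt_generic.

Local Notation sv := (spectral q t v).
Local Notation a := (ser_a K).
Local Notation b := (ser_b K).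

Lemma qpoch_inf_a_unit c : qpoch_inf q (a * cst c) \is a GRing.unit.
Proof.
have -> : qpoch_inf q (a * cst c) = in_a (poch_inf q c) by exact: qpoch_inf_a.
by rewrite rmorph_unit // poch_inf_unit.
Qed.

Lemma qpoch_inf_b_unit c : qpoch_inf q (b * cst c) \is a GRing.unit.
Proof.
have -> : qpoch_inf q (b * cst c) = in_b (poch_inf q c) by exact: qpoch_inf_b.
by rewrite rmorph_unit // poch_inf_unit.
Qed.

Lemma series_sum_prod : series_sum q t v x = cst (nM q t v).@[x] *
  \prod_(i < n.+1) ((qpoch_inf q (a * cst (sv i)) * qpoch_inf q (b * cst (x i))) /
                   (qpoch_inf q (b * cst (sv i)) * qpoch_inf q (a * cst (x i)))).
Proof.
apply: prod_quot_solve => [i|i|]; [exact: qpoch_inf_b_unit | exact: qpoch_inf_a_unit|].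
have Ea c : qpoch_inf q (a * cst c) = in_a (poch_inf q c) by exact: qpoch_inf_a.
have Eb c : qpoch_inf q (b * cst c) = in_b (poch_inf q c) by exact: qpoch_inf_b.
have e1 : \prod_i qpoch_inf q (b * cst (sv i)) = in_b (spoch q t v).
  by rewrite rmorph_prod; apply: eq_bigr => i _; exact: Eb.
have e2 : \prod_i qpoch_inf q (a * cst (sv i)) = in_a (spoch q t v).
  by rewrite rmorph_prod; apply: eq_bigr => i _; exact: Ea.
have e3 : \prod_i qpoch_inf q (a * cst (x i)) = \prod_i in_a (poch_inf q (x i)).
  by apply: eq_bigr => i _; exact: Ea.
have e4 : \prod_i qpoch_inf q (b * cst (x i)) = \prod_i in_b (poch_inf q (x i)).
  by apply: eq_bigr => i _; exact: Eb.
exact: (mul_eq_subst e1 e3 e2 e4 (series_sumE qt_generic v x)).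
Qed.

Lemma sigma_prod : \prod_(i < n.+1) ((qpoch_inf q (a * cst (sv i)) * qpoch_inf q (b * cst (x i))) /
                   (qpoch_inf q (b * cst (sv i)) * qpoch_inf q (a * cst (x i)))) =
  sigma q 1 (alph_mul (alph_sub (letter a) (letter b))
    (alph_sub (alph_sum (fun i => cst (x i))) (alph_sum (fun i => cst (sv i))))).
Proof.
rewrite sigma_differences; apply: prod_quot => i;
  [exact: qpoch_inf_b_unit | exact: qpoch_inf_a_unit].
Qed.

Lemma series_sums_to : fps2_sums_to (series_term q t v x) (series_sum q t v x).
Proof.
move=> i j; exists (i + j + mdeg v).+1; split.
  by move=> u hu; apply: (coef2_series_term qt_generic x).
by rewrite (big_comps _ (fun u => coef2 (series_term q t v x u) i j)).
Qed.

End GeneratingFunction.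

Theorem theorem9p1 (R : realType) (n : nat) (q t : complex R)
    (n_ge1 : (1 <= n)%N) (q_lt1 : `|q| < 1) (qt_generic : generic q t)
    (v : 'X_{1..n}) (x : 'I_n -> complex R) :
  let a : fps2 (complex R) := ser_a _ in
  let b : fps2 (complex R) := ser_b _ in
  let sv : 'I_n -> complex R := spectral q t v in
  let X : alphabet (fps2 (complex R)) := alph_sum (fun i => cst (x i)) in
  let V : alphabet (fps2 (complex R)) := alph_sum (fun i => cst (sv i)) in
  let bt : fps2 (complex R) := b * cst (t ^+ n.-1) in
  let rhs : fps2 (complex R) :=
    cst (nM q t v).@[x] *
    \prod_(i < n) ((qpoch_inf q (a * cst (sv i)) * qpoch_inf q (b * cst (x i))) /
                   (qpoch_inf q (b * cst (sv i)) * qpoch_inf q (a * cst (x i)))) in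
  fps2_sums_to
    (fun u : 'X_{1..n} =>
       qpoch_comp q t bt v / qpoch_comp q t bt u *
       fps2_of_poly (skewE q t u v) * cst (nM q t u).@[x])
    rhs /\
  rhs = cst (nM q t v).@[x] *
        sigma q 1 (alph_mul (alph_sub (letter a) (letter b)) (alph_sub X V)).
Proof.
case: n n_ge1 v x => // n _ v x a b sv X V bt rhs.
have q_cvg := complex_expr_cvg q_lt1.
split; last by rewrite -(sigma_prod qt_generic q_cvg).
exact: (eq_ind _ _ (series_sums_to qt_generic v x) _ (series_sum_prod qt_generic q_cvg v x)).
Qed.
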